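(* Let $b\ge 3$ be an integer, let $\mu\in\mathscr{P}_b$, and for $n\ge 1$ let $\sigma_n=\left(\int (x-1)^2\,\mathsf{T}^n\mu(\mathrm{d}x)\right)^{1/2}$. Then: (1) The limit of $(b-1)^{n/2}\sigma_n$ as $n\to\infty$ exists and is positive; so $\lim_{n\to\infty}\mathsf{T}^n\mu=\delta_1$ (weak convergence). (2) If $\mu\in\mathscr{D}_b$, then $\displaystyle\sup_{n\ge 1}\int\left(\frac{|x-1|}{\sigma_n}\right)^3\,\mathsf{T}^n\mu(\mathrm{d}x)<\infty$. (3) Suppose that there exists $p>2$ such that $\displaystyle\sup_{n\ge 1}\int\left(\frac{|x-1|}{\sigma_n}\right)^p\,\mathsf{T}^n\mu(\mathrm{d}x)<\infty$. Then, if $W_n$ is a random variable whose distribution is $\mathsf{T}^n\mu$, the variables $\displaystyle\frac{W_n-1}{\sigma_n}$ converge in distribution to $\mathcal{N}(0,1)$ as $n\to\infty$.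
   Context: For a Borel probability measure $\mu$ on $\mathbb{R}_+=[0,\infty)$ and $p>0$, $\mathbf{m}_p(\mu)=\int x^p\,\mu(\mathrm{d}x)$. Let $\mathscr{P}_b$ be the set of Borel probability measures $\mu$ on $\mathbb{R}_+$ with $\mathbf{m}_1(\mu)=1$ and $1<\mathbf{m}_2(\mu)<b-1$. The transformation $\mathsf{T}$: let $\mathscr{A}=\{0,\dots,b-1\}$, $\mathscr{A}^*=\bigcup_{n\ge0}\mathscr{A}^n$, and for a word $w=w_1\cdots w_n$ and $k\le n$ let $w|_k=w_1\cdots w_k$. For $\mu\in\mathscr{P}_b$, let $(W(w))_{w\in\mathscr{A}^*}$ be independent random variables with distribution $\mu$. The non-negative martingale $Y_n=b^{-n}\sum_{w\in\mathscr{A}^n}W(w|_1)W(w|_2)\cdots W(w|_n)$ is uniformly integrable and converges almost surely to a random variable $Y$; $\mathsf{T}\mu$ denotes the probability distribution of $Y$. One has $\mathsf{T}\mu\in\mathscr{P}_b$, so $\mathsf{T}$ maps $\mathscr{P}_b$ into itself and can be iterated; $\mathsf{T}^n$ is its $n$-th iterate. $\delta_1$ is the Dirac mass at $1$. The set $\mathscr{D}_b$: put $$w_2(b)=\min\left(b-1,\ b\,\frac{b^4-4b^2+12b-8}{b^4+8b^2-12b+4}\right),$$ and, for $1<t<w_2(b)$, $$w_3(b,t)=\frac{b^2}{2}+\frac12\sqrt{\frac{b(b^4-4b^2+12b-8)-t(b^4+8b^2-12b+4)}{b-t}}.$$ Then $\mathscr{D}_b$ is the set of Borel probability measures $\mu$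 on $\mathbb{R}_+$ with $\mathbf{m}_1(\mu)=1$, $1<\mathbf{m}_2(\mu)<w_2(b)$ and $\mathbf{m}_3(\mu)<w_3(b,\mathbf{m}_2(\mu))$. (Thus $\mathscr{D}_b\subset\mathscr{P}_b$.) *)

(* Defs.v *)
From HB Require Import structures.
From mathcomp Require Import all_boot all_order all_algebra finmap.
From mathcomp Require Import all_classical all_reals all_analysis.

Set Implicit Arguments.
Unset Strict Implicit.
Unset Printing Implicit Defensive.
Import Order.TTheory GRing.Theory Num.Theory.
Import numFieldNormedType.Exports.

Local Open Scope classical_set_scope.
Local Open Scope ring_scope.

(* A Borel probability measure on R_+ is encoded as a Borel probability measure
   on R giving mass 1 to [0, +oo[. *)
Definition on_Rplus (R : realType) (mu : probability (measurableTypeR R) R) : Prop :=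
  mu `[0%R, +oo[%classic = 1%E.

Definition moment (R : realType) (p : R)
    (mu : probability (measurableTypeR R) R) : \bar R :=
  (\int[mu]_(x in `[0%R, +oo[) (x `^ p)%:E)%E.

Definition Pb (R : realType) (b : nat) : set (probability (measurableTypeR R) R) :=
  [set mu | [/\ on_Rplus mu, moment 1 mu = 1%E &
    (1 < moment 2 mu < (b%:R - 1)%:E)%E]].

Definition w2 (R : realType) (b : nat) : R :=
  let B : R := b%:R in
  Num.min (B - 1)
    (B * ((B ^+ 4 - 4 * B ^+ 2 + 12 * B - 8) /
          (B ^+ 4 + 8 * B ^+ 2 - 12 * B + 4))).

Definition w3 (R : realType) (b : nat) (t : R) : R :=
  let B : R := b%:R in
  B ^+ 2 / 2 + 1 / 2 * Num.sqrt
    ((B * (B ^+ 4 - 4 * B ^+ 2 + 12 * B - 8) -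
      t * (B ^+ 4 + 8 * B ^+ 2 - 12 * B + 4)) / (B - t)).

(* [fine] is harmless: the second moment is bounded by w2 b. *)
Definition Db (R : realType) (b : nat) : set (probability (measurableTypeR R) R) :=
  [set mu | [/\ on_Rplus mu, moment 1 mu = 1%E,
    (1 < moment 2 mu < (w2 R b)%:E)%E &
    (moment 3 mu < (w3 b (fine (moment 2 mu)))%:E)%E]].

(* Equality of laws is only required on measurable sets: the set function
   underlying a measure is also defined, arbitrarily, on the other sets. *)
Definition has_law d (Omega : measurableType d) (R : realType)
    (P : probability Omega R) (X : {RV P >-> R})
    (mu : probability (measurableTypeR R) R) : Prop :=
  forall A : set (measurableTypeR R), measurable A -> distribution P X A = mu A.

Definition independent_family d (Omega : measurableType d) (R : realType)
    (P : probability Omega R) (I : choiceType) (X : I -> {RV P >-> R}) : Prop :=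
  forall (J : {fset I}) (A : I -> set (measurableTypeR R)),
    (forall i, measurable (A i)) ->
    P (\bigcap_(i in [set` J]) (X i @^-1` A i)) =
    (\prod_(i <- J) P (X i @^-1` A i))%E.

(* Words over the alphabet {0, ..., b-1} are elements of [seq 'I_b];
   [take k w] is the prefix of w of length k. *)
Definition cascade (R : realType) (b : nat) (Omega : Type)
    (W : seq 'I_b -> Omega -> R) (n : nat) (omega : Omega) : R :=
  b%:R ^- n * \sum_(w : n.-tuple 'I_b) \prod_(k < n) W (take k.+1 w) omega.

Definition is_transform (R : realType) (b : nat)
    (mu nu : probability (measurableTypeR R) R) : Prop :=
  exists (d : measure_display) (Omega : measurableType d)
    (P : probability Omega R) (W : seq 'I_b -> {RV P >-> R}) (Y : {RV P >-> R}),
    [/\ independent_family W,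
        forall w, has_law (W w) mu,
        {ae P, forall omega, cascade W n omega @[n --> \oo] --> Y omega} &
        has_law Y nu].

(* For mu in [Pb b] such a nu exists and is unique on Borel sets; outside of
   the domain of the transformation the value mu is a junk value. *)
Definition transform (R : realType) (b : nat)
    (mu : probability (measurableTypeR R) R) : probability (measurableTypeR R) R :=
  xget mu [set nu | is_transform b mu nu].

Definition sigma (R : realType) (nu : probability (measurableTypeR R) R) : R :=
  Num.sqrt (fine (\int[nu]_x ((x - 1) ^+ 2)%:E)%E).

Definition std_abs_moment (R : realType) (p : R)
    (nu : probability (measurableTypeR R) R) : \bar R :=
  (\int[nu]_x ((`|x - 1| / sigma nu) `^ p)%:E)%E.

Definition weak_cvg (R : realType)
    (nu_ : nat -> probability (measurableTypeR R) R)
    (nu : probability (measurableTypeR R) R) : Prop :=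
  forall f : R -> R, continuous f -> bounded_fun f ->
    (\int[nu_ n]_x (f x)%:E)%E @[n --> \oo] --> (\int[nu]_x (f x)%:E)%E.

(* The Z n may live on different probability spaces. *)
Definition cvg_in_distribution (R : realType) (d : nat -> measure_display)
    (Omega : forall n, measurableType (d n))
    (P : forall n, probability (Omega n) R) (Z : forall n, Omega n -> R)
    (nu : probability (measurableTypeR R) R) : Prop :=
  forall f : R -> R, continuous f -> bounded_fun f ->
    ('E_(P n)[f \o Z n])%E @[n --> \oo] --> (\int[nu]_x (f x)%:E)%E.

(* Main.v *)
Require Import Defs.
From HB Require Import structures.
From mathcomp Require Import all_boot all_order all_algebra finmap.
From mathcomp Require Import all_classical all_reals all_analysis.
From mathcomp Require Import measurable_realfun.
From mathcomp Require Import ring lra.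

Set Implicit Arguments.
Unset Strict Implicit.
Unset Printing Implicit Defensive.
Import Order.TTheory GRing.Theory Num.Theory.
Import numFieldNormedType.Exports.

Local Open Scope classical_set_scope.
Local Open Scope ring_scope.

(** Write [nu] for the image of [mu]. Splitting the cascade at its first letter, [nu] is
    the law of the mean over [j < b] of i.i.d. products [W_j * Y_j] with [(W_j, Y_j)] of
    law [mu x nu] ([Phi b mu nu] below).
    (1) Second moments of this identity give the recursion [v' = v / (b - 1 - v)] for the
    variances, which is affine in [1 / v].
    (2) Third moments give [M' * (b^2 - M) <= g0]; the bound defining [Db] is the larger
    root of [r^2 - b^2 r + g0], so [M] ends up below [b^2 / 2], and then the normalised
    third absolute moment satisfies a contracting affine recursion.
    (3) To first order the standardised variable [X_(n+1)] is a sum of [b] independent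
    copies of [alpha X_n + beta X'_(n+1)] with [alpha = sqrt (b - 1) / b], [beta = 1 / b],
    so that [b (alpha^2 + beta^2) = 1]. For a smooth [f], the uniform distance between the
    averages of [f] over [a X_n] and over [a N] is at most [C a^(2 + theta)] by a Taylor
    expansion, and one step of the recursion improves [C] to
    [b (alpha^(2 + theta) + beta^(2 + theta)) C], up to a vanishing error.
    Gaussian smoothings supply enough functions [f]: shifting one amounts to inserting an
    exponential density, which is expanded instead of [f]. *)

(** [transform] is picked by [xget], so nothing is known about its value until one realisation of
    the cascade exists and all realisations are seen to behave alike. For the former, i.i.d.
    families indexed by words are built from one uniform variable; for the latter, any realisation
    is transported to the space of real families with its product sigma-algebra, where passing to a
    subtree is a measurable law-preserving map. There the increments of the cascade obey a centred
    copy of the one-step identity and decay geometrically in L2, because the second moment is below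
    [b]; this yields convergence, domination and the fixed-point law at once. The identity is
    implicit, [nu] occurring on both sides. Hence the moment recursions are rational, [M < b^2] is
    what keeps the next third moment finite, and in (3) the induction runs on the constant [C], for
    large [n], and not on [n]. The threshold [b^2 / 2] works because [(b - 1)^(3/2) < b^2 / 2], the
    left side being the limit of the cubed ratio of consecutive standard deviations. *)

Lemma measurable_preimage d1 d2 (T1 : measurableType d1) (T2 : measurableType d2)
    (f : T1 -> T2) (A : set T2) :
  measurable_fun setT f -> measurable A -> measurable (f @^-1` A).
Proof. by move=> mf mA; rewrite -[X in measurable X]setTI; exact: mf. Qed.

(** * Real-valued integrals and equality of laws *)

Definition itg d (T : measurableType d) (R : realType)
    (m : {measure set T -> \bar R}) (f : T -> R) : Prop :=
  m.-integrable [set: T] (EFin \o f).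

(** [Rintegral] is the [fine] part of an integral, so the value is informative only together with
    integrability. Keeping it real lets moment identities be closed by [ring] and [lra]. *)
Definition Ex d (T : measurableType d) (R : realType)
    (m : {measure set T -> \bar R}) (f : T -> R) : R := \int[m]_x f x.

Section expect.
Context d (T : measurableType d) (R : realType) (m : probability T R).
Implicit Types f g : T -> R.

Lemma itg_meas f : itg m f -> measurable_fun [set: T] f.
Proof. by move=> /integrableP[/measurable_EFinP]. Qed.

Lemma itg_le f g : measurable_fun [set: T] f -> itg m g ->
  (forall x, `|f x| <= g x) -> itg m f.
Proof.
move=> mf ig fg; apply: le_integrable ig => //; first exact/measurable_EFinP.
by move=> x _ /=; rewrite lee_fin (le_trans (fg x))// ler_norm.
Qed.

Lemma itg_cst c : itg m (fun=> c).
Proof. exact: finite_measure_integrable_cst. Qed.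

Lemma itg_bounded f M : measurable_fun [set: T] f ->
  (forall x, `|f x| <= M) -> itg m f.
Proof. by move=> mf; apply: itg_le => //; exact: itg_cst. Qed.

Lemma itgD f g : itg m f -> itg m g -> itg m (fun x => f x + g x).
Proof. by move=> i j; exact: (integrableD _ i j). Qed.

Lemma itgB f g : itg m f -> itg m g -> itg m (fun x => f x - g x).
Proof. by move=> i j; exact: (integrableB _ i j). Qed.

Lemma itgZ c f : itg m f -> itg m (fun x => c * f x).
Proof. by move=> i; exact: (integrableZl _ c i). Qed.

Lemma itg_norm f : itg m f -> itg m (fun x => `|f x|).
Proof. by move=> i; exact: integrable_norm. Qed.

Lemma itg_sum I (s : seq I) (h : I -> T -> R) : (forall i, itg m (h i)) ->
  itg m (fun x => \sum_(i <- s) h i x).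
Proof.
move=> ih; elim: s => [|i s IH].
  by under eq_fun do rewrite big_nil; exact: itg_cst.
by under eq_fun do rewrite big_cons; exact: itgD.
Qed.

Lemma ExD f g : itg m f -> itg m g -> Ex m (fun x => f x + g x) = Ex m f + Ex m g.
Proof. exact: RintegralD. Qed.

Lemma ExB f g : itg m f -> itg m g -> Ex m (fun x => f x - g x) = Ex m f - Ex m g.
Proof. exact: RintegralB. Qed.

Lemma ExZ c f : itg m f -> Ex m (fun x => c * f x) = c * Ex m f.
Proof. exact: RintegralZl. Qed.

Lemma Ex_cst c : Ex m (fun=> c) = c.
Proof. rewrite /Ex Rintegral_cst// [X in fine X](_ : _ = 1%E) ?mulr1//; exact: probability_setT. Qed.

Lemma Ex_sum I (s : seq I) (h : I -> T -> R) : (forall i, itg m (h i)) ->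
  Ex m (fun x => \sum_(i <- s) h i x) = \sum_(i <- s) Ex m (h i).
Proof.
move=> ih; elim: s => [|i s IH].
  by rewrite big_nil -[RHS](Ex_cst 0); congr Ex; apply/funext => x; rewrite big_nil.
rewrite big_cons -IH -ExD//; last exact: itg_sum.
by congr Ex; apply/funext => x; rewrite big_cons.
Qed.

Lemma Ex_le f g : itg m f -> itg m g -> (forall x, f x <= g x) -> Ex m f <= Ex m g.
Proof. by move=> i j fg; apply: le_Rintegral. Qed.

Lemma Ex_ge0 f : (forall x, 0 <= f x) -> 0 <= Ex m f.
Proof. by move=> f0; apply: Rintegral_ge0 => x _; exact: f0. Qed.

Lemma Ex_norm_le f : itg m f -> `|Ex m f| <= Ex m (fun x => `|f x|).
Proof. by move=> i; apply: le_normr_Rintegral. Qed.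

Lemma Ex_bounded f M : measurable_fun [set: T] f ->
  (forall x, `|f x| <= M) -> `|Ex m f| <= M.
Proof.
move=> mf fM; have i := itg_bounded mf fM.
rewrite (le_trans (Ex_norm_le i))// -[leRHS](Ex_cst M) Ex_le//.
  exact: itg_norm.
exact: itg_cst.
Qed.

Lemma Ex_dist f g c : itg m f -> itg m g -> (forall x, `|f x - g x| <= c) ->
  `|Ex m f - Ex m g| <= c.
Proof.
move=> i j fg; rewrite -ExB//; apply: Ex_bounded => //.
by apply: measurable_funB; exact: itg_meas.
Qed.

Lemma EFin_Ex f : itg m f -> (Ex m f)%:E = (\int[m]_x (f x)%:E)%E.
Proof. by move=> i; rewrite /Ex /Rintegral fineK//; exact: integrable_fin_num. Qed.

Lemma itg_ge0P f : measurable_fun [set: T] f -> (forall x, 0 <= f x) ->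
  (\int[m]_x (f x)%:E < +oo)%E -> itg m f.
Proof.
move=> mf f0 fy; apply/integrableP; split; first exact/measurable_EFinP.
by under eq_integral do rewrite /= ger0_norm//.
Qed.

Lemma ae_eq_Ex f g : itg m f -> measurable_fun [set: T] g ->
  {ae m, forall x, f x = g x} -> itg m g /\ Ex m g = Ex m f.
Proof.
move=> i mg fg.
have mf := itg_meas i.
have e : (\int[m]_x `|(EFin \o g) x| = \int[m]_x `|(EFin \o f) x|)%E.
  apply: ae_eq_integral => //.
  - by apply: measurableT_comp => //; exact/measurable_EFinP.
  - by apply: measurableT_comp => //; exact/measurable_EFinP.
  - by apply: filterS fg => x /= -> _.
split.
  by case/integrableP: i => _ i; apply/integrableP; split; [exact/measurable_EFinP|rewrite e].
rewrite /Ex /Rintegral; congr fine; apply: ae_eq_integral => //.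
- exact/measurable_EFinP.
- exact/measurable_EFinP.
- by apply: filterS fg => x /= -> _.
Qed.

End expect.

(** Expand the nonnegative expectation of [(f - c)^2] at [c = Ex m f]. *)
Lemma sqr_Ex_le d (T : measurableType d) (R : realType) (m : probability T R)
    (f : T -> R) : itg m f -> itg m (fun x => f x ^+ 2) ->
  Ex m f ^+ 2 <= Ex m (fun x => f x ^+ 2).
Proof.
move=> i i2; set c := Ex m f.
have : 0 <= Ex m (fun x => (f x - c) ^+ 2) by apply: Ex_ge0 => x; exact: sqr_ge0.
have -> : (fun x => (f x - c) ^+ 2) = (fun x => f x ^+ 2 - (2 * c) * f x + c ^+ 2).
  by apply/funext => x; ring.
have j := itgZ (2 * c) i.
rewrite ExD; [|exact: itgB|exact: itg_cst].
rewrite ExB// ExZ// Ex_cst -/c; lra.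
Qed.

Section eqlaw.
Context d (T : measurableType d) (R : realType).
(** Agreement on measurable sets is all that integrals can see; the values of the two set functions
    elsewhere are arbitrary. *)
Definition eqlaw (m1 m2 : probability T R) :=
  forall A, measurable A -> m1 A = m2 A.

Lemma eqlaw_sym m1 m2 : eqlaw m1 m2 -> eqlaw m2 m1.
Proof. by move=> h A mA; rewrite h. Qed.

Lemma eqlaw_trans m1 m2 m3 : eqlaw m1 m2 -> eqlaw m2 m3 -> eqlaw m1 m3.
Proof. by move=> h k A mA; rewrite h// k. Qed.

Lemma eqlaw_integral m1 m2 (f : T -> \bar R) : eqlaw m1 m2 ->
  (\int[m1]_x f x = \int[m2]_x f x)%E.
Proof. by move=> h; apply: eq_measure_integral => A mA _; exact: h. Qed.

Lemma eqlaw_itg m1 m2 (f : T -> R) : eqlaw m1 m2 -> itg m1 f -> itg m2 f.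
Proof.
move=> h /integrableP[mf fy]; apply/integrableP; split => //.
by rewrite -(eqlaw_integral _ h).
Qed.

Lemma eqlaw_Ex m1 m2 (f : T -> R) : eqlaw m1 m2 -> Ex m1 f = Ex m2 f.
Proof. by move=> h; rewrite /Ex /Rintegral (eqlaw_integral _ h). Qed.
End eqlaw.

(** * Image laws and product laws *)

Section law.
Context d1 d2 (T1 : measurableType d1) (T2 : measurableType d2) (R : realType).

Definition law_mfun (f : T1 -> T2) (mf : measurable_fun setT f) : {mfun T1 >-> T2} :=
  HB.pack f (isMeasurableFun.Build _ _ _ _ f mf).

Definition law (m : probability T1 R) (f : T1 -> T2) (mf : measurable_fun setT f) :
  probability T2 R := distribution m (law_mfun mf).

Variables (m : probability T1 R) (f : T1 -> T2) (mf : measurable_fun setT f).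

Lemma lawE A : law m mf A = m (f @^-1` A).
Proof. by []. Qed.

Lemma ge0_integral_law (g : T2 -> \bar R) : measurable_fun setT g ->
  (forall x, 0 <= g x)%E -> (\int[law m mf]_x g x = \int[m]_x g (f x))%E.
Proof. by move=> mg g0; rewrite ge0_integral_distribution. Qed.

Lemma itg_law (g : T2 -> R) : measurable_fun setT g ->
  itg (law m mf) g <-> itg m (fun x => g (f x)).
Proof.
move=> mg; split => /integrableP[_ h]; apply/integrableP; split.
- by apply/measurable_EFinP; exact: measurableT_comp.
- move: h; rewrite ge0_integral_law//.
  by apply: measurableT_comp => //; exact/measurable_EFinP.
- exact/measurable_EFinP.
- rewrite ge0_integral_law//.
  by apply: measurableT_comp => //; exact/measurable_EFinP.
Qed.

Lemma Ex_law (g : T2 -> R) : itg m (fun x => g (f x)) -> measurable_fun setT g ->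
  Ex (law m mf) g = Ex m (fun x => g (f x)).
Proof.
move=> i mg; rewrite /Ex /Rintegral; congr fine.
by rewrite integral_distribution//; exact/measurable_EFinP.
Qed.
End law.

Section pushm.
Context d1 d2 (T1 : measurableType d1) (T2 : measurableType d2) (R : realType).
Variables (m : {measure set T1 -> \bar R}) (X : {mfun T1 >-> T2}).

(** Unlike in [law], the measure need not be a probability: restricted measures and Lebesgue measure
    are pushed forward below. *)
Definition pushm (A : set T2) : \bar R := m (X @^-1` A).

Let pushm0 : pushm set0 = 0%E.
Proof. by rewrite /pushm preimage_set0 measure0. Qed.

Let pushm_ge0 A : (0 <= pushm A)%E.
Proof. exact: measure_ge0. Qed.

Let pushm_sigma_additive : semi_sigma_additive pushm.
Proof. exact: (@measure_semi_sigma_additive _ _ _ (pushforward m X)). Qed.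

HB.instance Definition _ := isMeasure.Build _ _ _ pushm pushm0 pushm_ge0
  pushm_sigma_additive.
End pushm.

Section pprod.
Context d1 d2 (T1 : measurableType d1) (T2 : measurableType d2) (R : realType).
Variables (m1 : probability T1 R) (m2 : probability T2 R).
Let prodT : (m1 \x m2)%E setT = 1%E.
Proof.
rewrite -setXTT product_measure1E// -[RHS]mule1.
by congr (_ * _)%E; exact: probability_setT.
Qed.

HB.instance Definition _ := Measure_isProbability.Build _ _ _ (m1 \x m2)%E prodT.
Definition pprod : probability (T1 * T2)%type R := (m1 \x m2)%E.

Lemma Ex_pprod (f : T1 * T2 -> R) M : measurable_fun setT f ->
  (forall x, `|f x| <= M) ->
  Ex pprod f = Ex m1 (fun x => Ex m2 (fun y => f (x, y))).
Proof.
move=> mf fM.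
have i : itg pprod f by exact: itg_bounded fM.
rewrite /Ex /Rintegral; congr fine.
rewrite -(integral12_prod_meas1 i); apply: eq_integral => x _.
rewrite /fubini_F fineK//; apply: integrable_fin_num => //.
apply: (@itg_bounded _ _ _ _ _ M) => //.
exact: (measurableT_comp mf (pair1_measurable x)).
Qed.

Lemma Ex_pprod_swap (f : T1 * T2 -> R) M : measurable_fun setT f ->
  (forall x, `|f x| <= M) ->
  Ex m1 (fun x => Ex m2 (fun y => f (x, y))) = Ex m2 (fun y => Ex m1 (fun x => f (x, y))).
Proof.
move=> mf fM.
have i : itg pprod f by exact: itg_bounded fM.
rewrite -(Ex_pprod mf fM) /Ex /Rintegral; congr fine.
rewrite -(integral21_prod_meas1 i); apply: eq_integral => x _.
rewrite /fubini_G fineK//; apply: integrable_fin_num => //.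
apply: (@itg_bounded _ _ _ _ _ M) => //.
exact: (measurableT_comp mf (pair2_measurable x)).
Qed.

Lemma measurable_Ex2 (f : T1 * T2 -> R) M : measurable_fun setT f ->
  (forall x, `|f x| <= M) -> measurable_fun setT (fun x => Ex m2 (fun y => f (x, y))).
Proof.
move=> mf fM.
have i : itg pprod f by exact: itg_bounded fM.
apply: measurableT_comp; first exact: fine_measurable.
exact: (measurable_fubini_F i).
Qed.

(** Tonelli: the inner integral of [|f x * g y|] is [|f x|] times a finite constant. *)
Lemma itg_prodM (f : T1 -> R) (g : T2 -> R) : itg m1 f -> itg m2 g ->
  itg pprod (fun z => f z.1 * g z.2).
Proof.
move=> i j; have mf := itg_meas i; have mg := itg_meas j.
have mfg : measurable_fun setT (fun z : T1 * T2 => f z.1 * g z.2).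
  by apply: measurable_funM; [exact: measurableT_comp mf _|exact: measurableT_comp mg _].
apply/integrable12ltyP; first exact/measurable_EFinP.
have e x : (\int[m2]_y `|(f x * g y)%:E| = `|f x|%:E * (Ex m2 (fun y => `|g y|))%:E)%E.
  rewrite EFin_Ex; last exact: itg_norm.
  rewrite -ge0_integralZl//.
  - by apply: eq_integral => y _; rewrite /= normrM EFinM.
  - by apply/measurable_EFinP; exact: measurableT_comp.
under eq_integral do rewrite e.
rewrite ge0_integralZr//.
- rewrite -EFin_Ex; last exact: itg_norm.
  by rewrite -EFinM ltry.
- by apply/measurable_EFinP; exact: measurableT_comp.
- by rewrite lee_fin Ex_ge0.
Qed.

Lemma Ex_prodM (f : T1 -> R) (g : T2 -> R) : itg m1 f -> itg m2 g ->
  Ex pprod (fun z => f z.1 * g z.2) = Ex m1 f * Ex m2 g.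
Proof.
move=> i j; have ij := itg_prodM i j.
rewrite mulrC -ExZ// /Ex /Rintegral; congr fine.
rewrite -(integral12_prod_meas1 ij); apply: eq_integral => x _.
rewrite /fubini_F /=.
under eq_integral do rewrite EFinM.
rewrite integralZl// -EFin_Ex//.
by rewrite -EFinM mulrC.
Qed.

Lemma itg_prod1 (f : T1 -> R) : itg m1 f -> itg pprod (fun z => f z.1).
Proof.
move=> i; have := itg_prodM i (itg_cst m2 1).
by congr itg; apply/funext => z; rewrite mulr1.
Qed.

Lemma itg_prod2 (f : T2 -> R) : itg m2 f -> itg pprod (fun z => f z.2).
Proof.
move=> i; have := itg_prodM (itg_cst m1 1) i.
by congr itg; apply/funext => z; rewrite mul1r.
Qed.

Lemma Ex_prod1 (f : T1 -> R) : itg m1 f -> Ex pprod (fun z => f z.1) = Ex m1 f.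
Proof.
move=> i; have := Ex_prodM i (itg_cst m2 1); rewrite Ex_cst mulr1 => <-.
by congr Ex; apply/funext => z; rewrite mulr1.
Qed.

End pprod.

(** * Independent families *)

Section sequence_space.
Context (R : realType) (I : choiceType).
Implicit Types (S : {fset I}) (A : I -> set (measurableTypeR R)) (J K : {pred I}).

Definition box S A : set (I -> R) := \bigcap_(i in [set` S]) [set u | A i (u i)].

(** The finite-dimensional cylinders: a class closed under intersection and containing the whole
    space, hence enough to identify finite measures. *)
Definition boxes : set (set (I -> R)) :=
  [set C | exists S A, (forall i, measurable (A i)) /\ C = box S A].

(** The canonical space of families: any family of random variables, on any probability space,
    induces a law here, so a fact proved on [seqspace] holds for all realisations. *)
Definition seqspace := g_sigma_algebraType boxes.

Lemma measurable_box S A : (forall i, measurable (A i)) ->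
  measurable (box S A : set seqspace).
Proof. by move=> mA; apply: sub_sigma_algebra; exists S, A. Qed.

Lemma box1 i A : box [fset i]%fset A = [set u | A i (u i)].
Proof.
apply/seteqP; split => u /=; first by apply; rewrite /= inE.
by move=> Au j /=; rewrite inE => /eqP ->.
Qed.

Lemma measurable_coord i : measurable_fun setT (fun u : seqspace => u i : measurableTypeR R).
Proof.
move=> _ A mA; rewrite setTI.
have -> : (fun u : seqspace => u i : measurableTypeR R) @^-1` A = box [fset i]%fset (fun=> A).
  by rewrite box1.
exact: measurable_box.
Qed.

Lemma measurable_into_seqspace d (T : measurableType d) (g : T -> seqspace) :
  (forall i, measurable_fun setT (fun t => g t i : measurableTypeR R)) ->
  measurable_fun setT g.
Proof.
move=> mg; apply: (@measurability _ _ T seqspace setT g boxes) => //.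
move=> _ [_ [S [A [mA ->]]] <-].
rewrite setTI /box preimage_bigcap; apply: fin_bigcap_measurable; first exact: finite_fset.
by move=> i _; exact: (measurable_preimage (mg i) (mA i)).
Qed.

(* A function of [u] depends only on the coordinates in [J] when [keep J] does not change it. *)
Definition keep J (u : seqspace) : seqspace := fun i => if i \in J then u i else 0.

Lemma measurable_keep J : measurable_fun setT (keep J).
Proof.
apply: measurable_into_seqspace => i; rewrite /keep.
by case: (i \in J); [exact: measurable_coord|exact: measurable_cst].
Qed.

Lemma boxI S1 A1 S2 A2 : box S1 A1 `&` box S2 A2 =
  box (S1 `|` S2)%fset (fun i => (if i \in S1 then A1 i else setT) `&`
                          (if i \in S2 then A2 i else setT)).
Proof.
apply/seteqP; split=> u.
  move=> [u1 u2] i /= _; split; case: ifP => // iS; [exact: u1|exact: u2].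
move=> h; split=> i /= iS.
  by have /= := h i; rewrite inE iS /= => /(_ isT) [].
by have /= := h i; rewrite inE iS orbT /= => /(_ isT) [].
Qed.

Lemma boxes_setI_closed : setI_closed boxes.
Proof.
move=> _ _ [S1 [A1 [mA1 ->]]] [S2 [A2 [mA2 ->]]].
rewrite boxI; eexists; eexists; split; last by reflexivity.
by move=> i; apply: measurableI; case: ifP.
Qed.

Lemma boxesT : boxes setT.
Proof.
by exists fset0, (fun=> setT); split => //; apply/seteqP; split => u.
Qed.

Lemma seqspace_measure_unique (m1 m2 : {measure set seqspace -> \bar R}) :
  (forall S A, (forall i, measurable (A i)) -> m1 (box S A) = m2 (box S A)) ->
  (m1 setT < +oo)%E -> forall E : set seqspace, measurable E -> m1 E = m2 E.
Proof.
move=> h m1T E mE; apply: (@measure_unique _ R seqspace boxes (fun=> setT) _ _ _ _ m1 m2) => //.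
- exact: boxes_setI_closed.
- by move=> _; exact: boxesT.
- by apply/seteqP; split => // u _; exists 0%N.
- by move=> _ [S [A [mA ->]]]; exact: h.
Qed.

(** Independence of the coordinates as a property of the law, with the marginals left free. *)
Definition prodlike (m : probability seqspace R) := forall S A,
  (forall i, measurable (A i)) ->
  m (box S A) = (\prod_(i <- S) m [set u | A i (u i)])%E.

Lemma prodlike_eqlaw (m1 m2 : probability seqspace R) :
  prodlike m1 -> prodlike m2 ->
  (forall i (E : set (measurableTypeR R)), measurable E ->
    m1 [set u | E (u i)] = m2 [set u | E (u i)]) ->
  eqlaw m1 m2.
Proof.
move=> p1 p2 h A mA; apply: seqspace_measure_unique => //.
  move=> S B mB; rewrite [LHS]p1// [RHS]p2//; apply: eq_bigr => i _; exact: h.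
by rewrite (le_lt_trans (probability_le1 m1 _)) ?ltry//.
Qed.

(** In the variable [E] both sides are finite measures: the image of [m] restricted to [D], and
    [m D] times the image of [m]. Agreement on boxes therefore extends to the generated
    sigma-algebra. *)
Lemma indep_ext d (T : measurableType d) (m : probability T R) (g : T -> seqspace) D :
  measurable_fun setT g -> measurable D ->
  (forall S A, (forall i, measurable (A i)) ->
    m (g @^-1` box S A `&` D) = m (g @^-1` box S A) * m D)%E ->
  forall E : set seqspace, measurable E -> (m (g @^-1` E `&` D) = m (g @^-1` E) * m D)%E.
Proof.
move=> mg mD h A mA.
have mDge0 : (0 <= fine (m D))%R by rewrite fine_ge0.
have mDE : m D = (fine (m D))%:E by rewrite fineK// fin_num_measure.
pose m1 := mscale (NngNum mDge0) (law m mg).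
pose m2 := pushm (mrestr m mD) (law_mfun mg).
have e2 B : m2 B = m (g @^-1` B `&` D) by [].
have e1 B : m1 B = (m (g @^-1` B) * m D)%E by rewrite muleC mDE.
have fin1 : (m1 [set: seqspace] < +oo)%E.
  apply: (@eq_ind_r _ _ (fun z => z < +oo)%E _ _ (e1 setT)).
  rewrite preimage_setT [X in (X * _)%E](_ : _ = 1%E) ?mul1e; first by rewrite mDE ltry.
  exact: probability_setT.
have e12 : forall S B, (forall i, measurable (B i)) -> m1 (box S B) = m2 (box S B).
  by move=> S B mB; exact: etrans (e1 _) (etrans (esym (h S B mB)) (esym (e2 _))).
exact: etrans (esym (e2 A)) (etrans (esym (seqspace_measure_unique e12 fin1 mA)) (e1 A)).
Qed.

Variables (m : probability seqspace R) (pm : prodlike m).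

(** Outside [J] the coordinate becomes 0, so the constraint [A i] turns vacuous or impossible
    according to whether it contains 0. The preimage of a box under [keep J] is thus again a box. *)
Let keepset J A i : set (measurableTypeR R) :=
  if i \in J then A i else (if `[< A i 0 >] then setT else set0).

Let measurable_keepset J A i : (forall i, measurable (A i)) -> measurable (keepset J A i).
Proof. by move=> mA; rewrite /keepset; case: ifP => // _; case: ifP. Qed.

Let keep_box J S A : keep J @^-1` box S A = box S (keepset J A).
Proof.
apply/seteqP; split=> u h i /= iS; have := h i iS; rewrite /keep /keepset /=; case: ifP => // iJ.
  by move=> Ai; rewrite asboolT.
by case: asboolP.
Qed.

(** Applying [indep_ext] to each of the two sets reduces them to boxes. There the probabilities
    factor coordinate by coordinate: as [J] and [K] are disjoint, one of the two constraints on each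
    coordinate is [setT] or [set0]. *)
Lemma keep_indep J K (A B : set seqspace) : (forall i, i \in J -> i \notin K) -> measurable A -> measurable B ->
  m (keep J @^-1` A `&` keep K @^-1` B) =
  (m (keep J @^-1` A) * m (keep K @^-1` B))%E.
Proof.
move=> JK mA mB.
have mJ := measurable_keep J; have mK := measurable_keep K.
have mmB : measurable (keep K @^-1` B) by exact: measurable_preimage.
apply: (indep_ext mJ) => // S1 A1 mA1 {mA A}.
rewrite setIC muleC; apply: (indep_ext mK) => //.
  by rewrite keep_box; apply: measurable_box => i; exact: measurable_keepset.
move=> S2 A2 mA2 {mB mmB B}; rewrite setIC muleC !keep_box boxI.
pose B1 i : set (measurableTypeR R) := if i \in S1 then keepset J A1 i else setT.
pose B2 i : set (measurableTypeR R) := if i \in S2 then keepset K A2 i else setT.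
have mB1 i : measurable (B1 i) by rewrite /B1; case: (i \in S1) => //; exact: measurable_keepset.
have mB2 i : measurable (B2 i) by rewrite /B2; case: (i \in S2) => //; exact: measurable_keepset.
have e1 : box S1 (keepset J A1) = box (S1 `|` S2)%fset B1.
  apply/seteqP; split => u h i /= iS.
    by rewrite /B1; case: ifP => // iS1; exact: h.
  by have /= := h i; rewrite inE iS /B1 iS => /(_ isT).
have e2 : box S2 (keepset K A2) = box (S1 `|` S2)%fset B2.
  apply/seteqP; split => u h i /= iS.
    by rewrite /B2; case: ifP => // iS1; exact: h.
  by have /= := h i; rewrite inE iS orbT /B2 iS => /(_ isT).
have mB12 i : measurable (B1 i `&` B2 i) by exact: measurableI.
rewrite e1 e2 (pm _ mB12) (pm _ mB1) (pm _ mB2).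
rewrite -big_split/=; apply: eq_bigr => i _.
have triv C : m (setT `&` C) = (m setT * m C)%E /\ m (set0 `&` C) = (m set0 * m C)%E.
  rewrite setTI set0I measure0 mul0e [X in (X * _)%E](_ : _ = 1%E) ?mul1e//.
  exact: probability_setT.
have -> : [set u : I -> R | (B1 i `&` B2 i) (u i)] =
  [set u | B1 i (u i)] `&` [set u | B2 i (u i)] by [].
have [iJ|iJ] := boolP (i \in J).
  have iK : (i \in K) = false by exact/negbTE/JK.
  have [->|->] : [set u : I -> R | B2 i (u i)] = setT \/ [set u : I -> R | B2 i (u i)] = set0.
    rewrite /B2 /keepset iK; case: ifP => _; last by left.
    by case: ifP => _; [left|right].
  - by rewrite setIC muleC; have [] := triv [set u | B1 i (u i)].
  - by rewrite setIC muleC; have [] := triv [set u | B1 i (u i)].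
have [->|->] : [set u : I -> R | B1 i (u i)] = setT \/ [set u : I -> R | B1 i (u i)] = set0.
  rewrite /B1 /keepset (negbTE iJ); case: ifP => _; last by left.
  by case: ifP => _; [left|right].
- by have [] := triv [set u | B2 i (u i)].
- by have [] := triv [set u | B2 i (u i)].
Qed.

Definition depends J d (T : measurableType d) (f : seqspace -> T) :=
  forall u, f (keep J u) = f u.

Lemma depends_indep J K (f h : seqspace -> measurableTypeR R)
    (A B : set (measurableTypeR R)) :
  (forall i, i \in J -> i \notin K) -> measurable_fun setT f -> measurable_fun setT h ->
  depends J f -> depends K h -> measurable A -> measurable B ->
  m (f @^-1` A `&` h @^-1` B) = (m (f @^-1` A) * m (h @^-1` B))%E.
Proof.
move=> JK mf mh fJ hK mA mB.
have -> : f @^-1` A = keep J @^-1` (f @^-1` A).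
  by apply/seteqP; split => u /=; rewrite fJ.
have -> : h @^-1` B = keep K @^-1` (h @^-1` B).
  by apply/seteqP; split => u /=; rewrite hK.
apply: keep_indep => //.
  exact: (measurable_preimage mf mA).
exact: (measurable_preimage mh mB).
Qed.

Lemma depends_pair_law J K (f h : seqspace -> measurableTypeR R)
  (mf : measurable_fun setT f) (mh : measurable_fun setT h) :
  (forall i, i \in J -> i \notin K) -> depends J f -> depends K h ->
  eqlaw (law m (measurable_fun_pair mf mh)) (pprod (law m mf) (law m mh)).
Proof.
move=> JK fJ hK A mA; apply/esym; apply: product_measure_unique => // B C mB mC.
exact: (depends_indep JK mf mh fJ hK mB mC).
Qed.

End sequence_space.

Section real_limsup.
Context d (T : measurableType d) (R : realType).
Implicit Types f : nat -> T -> R.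

(* The total function [Lsup] is measurable; it is the pointwise limit wherever there is one. *)
Definition Lsup f (x : T) : R := fine (limn_esup (fun n => (f n x)%:E)).

Lemma Lsup_cvg f x l : f ^~ x @ \oo --> l -> Lsup f x = l.
Proof.
move=> fl; rewrite /Lsup (_ : limn_esup _ = l%:E)//.
have /cvg_limn_einf_sup[_ ->]// : (fun n => (f n x)%:E) @ \oo --> l%:E.
exact: cvg_EFin (nearW _ _) fl.
Qed.

Lemma measurable_Lsup f : (forall n, measurable_fun setT (f n)) ->
  measurable_fun setT (Lsup f).
Proof.
move=> mf; apply: measurableT_comp; first exact: fine_measurable.
by apply: measurable_fun_limn_esup => n; exact/measurable_EFinP.
Qed.
End real_limsup.

Section family.
Context (R : realType) (I K : choiceType).
Variables (m : probability (seqspace R I) R) (pm : prodlike m).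
Variables (F : K -> seqspace R I -> measurableTypeR R) (J : K -> {pred I}).
Hypothesis mF : forall k, measurable_fun setT (F k).
Hypothesis FJ : forall k, depends (J k) (F k).
Hypothesis JJ : forall k l i, i \in J k -> i \in J l -> k = l.

Definition joint (u : seqspace R I) : seqspace R K := fun k => F k u.

Lemma measurable_joint : measurable_fun setT joint.
Proof. exact: measurable_into_seqspace. Qed.

(** Induction over the finite index set, splitting off one block of coordinates from the union of
    the others. *)
Lemma joint_prodlike : prodlike (law m measurable_joint).
Proof.
move=> S A mA; rewrite lawE.
pose B (s : seq K) := \bigcap_(k in [set` s]) (F k @^-1` A k).
have -> : joint @^-1` box S A = B (enum_fset S) by [].
transitivity (\prod_(k <- enum_fset S) m (F k @^-1` A k))%E; last by [].
have mFA k : measurable (F k @^-1` A k).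
  by rewrite -[X in measurable X]setTI; exact: mF.
have mB s : measurable (B s).
  by apply: fin_bigcap_measurable => //; exact: finite_seq.
have : uniq (enum_fset S) by [].
elim: (enum_fset S) => [_|k s IH /= /andP[ks us]].
  rewrite big_nil [B _](_ : _ = setT); first exact: probability_setT.
  by apply/seteqP; split => // u _ k.
rewrite big_cons -IH//.
(* [L] is the union of the blocks of the remaining indices; [B s] depends on [L] only, and [L]
   avoids [J k]. *)
pose L : {pred I} := [pred i | has (fun l => i \in J l) s].
have JL i : i \in J k -> i \notin L.
  move=> ik; apply/negP => /hasP[l ls il]; by move: ks; rewrite (JJ ik il) ls.
have -> : B (k :: s) = F k @^-1` A k `&` B s.
  apply/seteqP; split => u.
    move=> h; split; first by apply: (h k); rewrite /= inE eqxx.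
    by move=> l /= ls; apply: (h l); rewrite /= inE ls orbT.
  by move=> [h1 h2] l /=; rewrite inE => /orP[/eqP -> //|ls]; exact: h2.
have e1 : F k @^-1` A k = keep (J k) @^-1` (F k @^-1` A k).
  by apply/seteqP; split => u /=; rewrite FJ.
have e2 : B s = keep L @^-1` B s.
  have h l u : l \in s -> F l (keep L u) = F l u.
    move=> ls; rewrite -(FJ l u) -(FJ l (keep L u)); congr F.
    apply/funext => i; rewrite /keep; case: ifP => // il; case: ifP => // /negP[].
    by apply/hasP; exists l.
  by apply/seteqP; split => u /= Bs l /= ls; have := Bs l ls; rewrite /= h.
by rewrite {1}e1 {1}e2 keep_indep// -e1 -e2.
Qed.
End family.

Section reindex.
Context (R : realType) (I K : choiceType) (m : probability (seqspace R I) R).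
Variables (pm : prodlike m) (h : K -> I) (h_inj : injective h).

Definition pull (u : seqspace R I) : seqspace R K := u \o h.

Lemma measurable_pull : measurable_fun setT pull.
Proof. by apply: measurable_into_seqspace => k; exact: measurable_coord. Qed.

Lemma pull_prodlike : prodlike (law m measurable_pull).
Proof.
have mF k : measurable_fun setT (fun u : seqspace R I => u (h k) : measurableTypeR R).
  exact: measurable_coord.
have := joint_prodlike pm mF (J := fun k => pred1 (h k)).
apply.
  by move=> k u; rewrite /keep inE eqxx.
by move=> k l i; rewrite !inE => /eqP-> /eqP/h_inj.
Qed.
End reindex.

Section affine.
Context (R : realType).
Local Notation leb := (@lebesgue_measure R).

Lemma measurable_affine (a c : R) :
  measurable_fun setT (fun x : measurableTypeR R => a * x + c : measurableTypeR R).
Proof. by apply: measurable_funD => //; exact: measurable_funM. Qed.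

(** Multiplied by [a], the measure of the preimage gives every interval its length, so by uniqueness
    it is Lebesgue measure. *)
Lemma lebesgue_affine (a c : R) (B : set (measurableTypeR R)) : 0 < a -> measurable B ->
  leb ((fun x => a * x + c)%R @^-1` B) = (a^-1%:E * leb B)%E.
Proof.
move=> a0 mB; have a1 := ltW a0.
pose mu : {measure set (measurableTypeR R) -> \bar R} :=
  mscale (NngNum a1) (pushm leb (law_mfun (measurable_affine a c))).
have muE D : mu D = (a%:E * leb ((fun x => a * x + c)%R @^-1` D))%E by [].
rewrite (lebesgue_measure_unique (mu := mu) _ mB) ?muE.
  by rewrite muleA -EFinM mulVf ?gt_eqF// mul1e.
move=> _ [[p q] _ <-]; rewrite muE /=.
have -> : (fun x => a * x + c) @^-1` `]p, q] = `](p - c) / a, (q - c) / a]%classic.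
  apply/seteqP; split => x /=; rewrite !in_itv/= ltr_pdivrMr// ler_pdivlMr// mulrC => /andP[? ?];
    apply/andP; split; lra.
rewrite !lebesgue_measure_itv/= !lte_fin ltr_pM2r ?invr_gt0// ltrD2r.
case: ifP => // _; last by rewrite mule0.
by rewrite -!EFinB -EFinM; congr EFin; field; rewrite gt_eqF.
Qed.
End affine.

(** * Binary digits of a uniform variable *)

Section bits.
Context (R : realType).
Local Notation leb := (@lebesgue_measure R).

Definition unif : set (measurableTypeR R) -> \bar R :=
  mrestr leb (measurable_itv `[0%R, 1%R[ : measurable (`[0%R, 1%R[%classic : set (measurableTypeR R))).
HB.instance Definition _ := Measure.on unif.
Let unifT : unif setT = 1%E.
Proof. by rewrite /unif /mrestr setTI lebesgue_measure_itv/= lte_fin ltr01 oppr0 adde0. Qed.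
HB.instance Definition _ := Measure_isProbability.Build _ _ _ unif unifT.

Lemma unifE A : unif A = leb (A `&` `[0, 1[). Proof. by []. Qed.

(* The digits of a uniform variable are read along the doubling map; splitting them into
   countably many streams and applying a quantile function gives the i.i.d. families. *)
Definition bit (x : R) : R := if x < 2^-1 then 0 else 1.
Definition dbl (x : R) : R := if x < 2^-1 then 2 * x else 2 * x - 1.

Lemma measurable_bit : measurable_fun setT bit.
Proof.
apply: measurable_fun_ifT => //; apply: measurable_fun_ltr => //.
Qed.

Lemma measurable_dbl : measurable_fun setT dbl.
Proof.
apply: measurable_fun_ifT => //.
- exact: measurable_fun_ltr.
by apply: measurable_funB.
Qed.

(** On the half of [[0, 1[] where [bit] equals [c], [dbl] is the affine bijection [x -> 2 x - c]
    onto [[0, 1[]. *)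
Let half_dbl (c : R) E : measurable E -> c = 0 \/ c = 1 ->
  unif (bit @^-1` [set c] `&` dbl @^-1` E) = (2^-1%:E * unif E)%E.
Proof.
move=> mE c01; rewrite !unifE.
rewrite -(@lebesgue_affine R 2 (- c)) ?ltr0n//; last by apply: measurableI.
congr (leb _); apply/seteqP; split => x /=.
  rewrite /bit /dbl; case: ltP => h [[c0 Ex]]; rewrite !in_itv/= => /andP[x0 x1].
    rewrite -c0 oppr0 addr0; split=> //; apply/andP; split; lra.
  rewrite -c0; split=> //; apply/andP; split; lra.
rewrite !in_itv/= => -[Ex /andP[x0 x1]]; case: c01 => ?; subst c.
  have h : x < 2^-1 by lra.
  rewrite /bit /dbl h; split; [split => //|apply/andP; split; lra].
  by move: Ex; rewrite oppr0 addr0.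
have h : (x < 2^-1) = false by apply/negbTE; rewrite -leNgt; lra.
by rewrite /bit /dbl h; split; [split => //|apply/andP; split; lra].
Qed.

Let bit_dbl_aux A E (p : R) : measurable A -> measurable E ->
  (forall E, measurable E -> unif (bit @^-1` A `&` dbl @^-1` E) = (p%:E * unif E)%E) ->
  unif (bit @^-1` A `&` dbl @^-1` E) = (unif (bit @^-1` A) * unif E)%E.
Proof.
move=> mA mE h; rewrite h//; congr (_ * _)%E.
by have := h setT measurableT; rewrite preimage_setT setIT (@probability_setT _ _ _ unif) mule1.
Qed.

(** The first digit is independent of the remainder, and [dbl] preserves the uniform law. Only the
    membership of 0 and 1 in [A] matters, which leaves four cases. *)
Lemma bit_dbl A E : measurable A -> measurable E ->
  unif (bit @^-1` A `&` dbl @^-1` E) = (unif (bit @^-1` A) * unif E)%E.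
Proof.
move=> mA mE.
have mbit c : measurable (bit @^-1` [set c]).
  exact: (measurable_preimage measurable_bit (measurable_set1 c)).
have mdbl E' : measurable E' -> measurable (dbl @^-1` E').
  exact: (measurable_preimage measurable_dbl).
have b01 x : bit x = 0 \/ bit x = 1 by rewrite /bit; case: ifP => _; [left|right].
have split01 E' : measurable E' -> unif (dbl @^-1` E') = unif E'.
  move=> mE'.
  have -> : dbl @^-1` E' = (bit @^-1` [set 0] `&` dbl @^-1` E') `|`
    (bit @^-1` [set 1] `&` dbl @^-1` E').
    apply/seteqP; split => x /=; last by move=> [[]|[]].
    by have [|] := b01 x => ->; [left|right].
  rewrite measureU//; last first.
  - apply/seteqP; split => x //= -[[-> _] [/eqP]].
    by rewrite eq_sym oner_eq0.
  - by apply: measurableI; [exact: mbit|exact: mdbl].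
  - by apply: measurableI; [exact: mbit|exact: mdbl].
  rewrite [X in (X + _)%E]half_dbl//; last by left.
  rewrite [X in (_ + X)%E]half_dbl//; last by right.
  rewrite -ge0_muleDl ?lee_fin ?invr_ge0// -EFinD.
  by rewrite (_ : 2^-1 + 2^-1 = 1 :> R) ?mul1e//; lra.
have [A0|A0] := pselect (A 0); have [A1|A1] := pselect (A 1).
- apply: (bit_dbl_aux (p := 1)) => // E' mE'.
  rewrite (_ : bit @^-1` A = setT) ?setTI ?mul1e ?split01//.
  by apply/seteqP; split => x //= _; have [|] := b01 x => ->.
- apply: (bit_dbl_aux (p := 2^-1)) => // E' mE'.
  rewrite (_ : bit @^-1` A = bit @^-1` [set 0]) ?half_dbl//; first by left.
  apply/seteqP; split => x /=; last by move=> ->.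
  by have [|] := b01 x => ->.
- apply: (bit_dbl_aux (p := 2^-1)) => // E' mE'.
  rewrite (_ : bit @^-1` A = bit @^-1` [set 1]) ?half_dbl//; first by right.
  apply/seteqP; split => x /=; last by move=> ->.
  by have [|] := b01 x => ->.
- apply: (bit_dbl_aux (p := 0)) => // E' mE'.
  rewrite (_ : bit @^-1` A = set0) ?set0I ?measure0 ?mul0e//.
  by apply/seteqP; split => x //=; have [|] := b01 x => ->.
Qed.

Definition bits (x : measurableTypeR R) : seqspace R nat := fun j => bit (iter j dbl x).

Lemma measurable_iter_dbl j : measurable_fun setT (iter j dbl).
Proof.
elim: j => [|j IH]; first exact: measurable_id.
exact: (measurableT_comp measurable_dbl IH).
Qed.

Lemma measurable_bits : measurable_fun setT bits.
Proof.
apply: measurable_into_seqspace => j.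
exact: (measurableT_comp measurable_bit (measurable_iter_dbl j)).
Qed.

Let measurable_biti j (A : set (measurableTypeR R)) : measurable A ->
  measurable ((fun x => bit (iter j dbl x)) @^-1` A).
Proof.
exact: (measurable_preimage (measurableT_comp measurable_bit (measurable_iter_dbl j))).
Qed.

Lemma biti j (A : set (measurableTypeR R)) : measurable A ->
  unif ((fun x => bit (iter j dbl x)) @^-1` A) = unif (bit @^-1` A).
Proof.
move=> mA; elim: j => [//|j IH].
have := bit_dbl measurableT (measurable_biti j mA).
rewrite preimage_setT setTI (@probability_setT _ _ _ unif) mul1e IH => <-.
by congr unif; apply/seteqP; split => x /=; rewrite -iterS iterSr.
Qed.

(** Since [bits x j.+1 = bits (dbl x) j], [bit_dbl] peels off the first digit. *)
Let bits_iota n (A : nat -> set (measurableTypeR R)) : (forall j, measurable (A j)) ->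
  unif [set x | forall j, (j < n)%N -> A j (bits x j)] =
  (\prod_(j < n) unif (bit @^-1` A j))%E.
Proof.
elim: n A => [|n IH] A mA.
  by rewrite big_ord0 -[RHS]unifT; congr unif; apply/seteqP; split.
have mE : measurable
    [set x : measurableTypeR R | forall j, (j < n)%N -> (A \o S) j (bits x j)].
  rewrite [X in measurable X](_ : _ = \bigcap_(j in `I_n) (bits ^~ j @^-1` (A j.+1))).
    by apply: fin_bigcap_measurable => // j _; exact: measurable_biti.
  by apply/seteqP; split => x.
rewrite big_ord_recl -(IH (A \o S)); last by move=> j; exact: mA.
apply: etrans (bit_dbl (mA 0%N) mE).
congr unif; apply/seteqP; split => x /=.
  move=> h; split; first exact: (h 0%N).
  by move=> j jn; have := h j.+1 jn; rewrite /bits iterSr.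
by move=> [h0 h] [//|j] jn; have := h j jn; rewrite /bits -iterSr.
Qed.

Lemma bits_prodlike : prodlike (law unif measurable_bits).
Proof.
move=> S A mA; rewrite lawE.
pose n := (\max_(i <- S) i).+1.
have Sn i : i \in S -> (i < n)%N by move=> iS; rewrite ltnS; exact: leq_bigmax_seq.
(* Trivial constraints outside [S] allow the initial segment below [n] to replace [S]. *)
pose A' i := if i \in S then A i else setT.
have mA' i : measurable (A' i) by rewrite /A'; case: ifP.
transitivity (unif [set x | forall j, (j < n)%N -> A' j (bits x j)]).
  congr unif; apply/seteqP; split => x /= h j.
    by move=> jn; rewrite /A'; case: ifP => // jS; exact: (h j).
  by move=> jS; have := h j (Sn _ jS); rewrite /A' jS.
rewrite bits_iota// -(big_mkord xpredT (fun j => unif (bit @^-1` A' j))).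
set s := index_iota 0 n.
have us : uniq s by exact: iota_uniq.
have ms j : (j \in s) = (j < n)%N by rewrite mem_index_iota.
transitivity (\prod_(j <- s | j \in S) unif (bit @^-1` A j))%E.
  by rewrite [RHS]big_mkcond/=; apply: eq_bigr => j _; rewrite /A'; case: ifP => // _.
rewrite -big_filter; apply/esym.
rewrite (perm_big [seq j <- s | j \in S]); first by apply: eq_bigr => j _; exact: biti.
apply: uniq_perm => //; first by rewrite filter_uniq.
move=> j; rewrite mem_filter ms.
by case: (boolP (j \in S)) => //= /Sn ->.
Qed.

Definition digit_sum (n : nat) (u : seqspace R nat) : R :=
  \sum_(j < n) u j / 2 ^+ j.+1.

Lemma measurable_digit_sum n : measurable_fun setT (digit_sum n).
Proof.
apply: measurable_sum => j; apply: measurable_funM => //; exact: measurable_coord.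
Qed.

Definition undigit : seqspace R nat -> measurableTypeR R := Lsup digit_sum.

Lemma undigit_bits (x : measurableTypeR R) : 0 <= x < 1 -> undigit (bits x) = x.
Proof.
move=> x01; apply: Lsup_cvg.
have dbl01 y : 0 <= y < 1 -> 0 <= dbl y < 1.
  by move=> /andP[? ?]; rewrite /dbl; case: (ltP y) => ?; apply/andP; split; lra.
have it01 j : 0 <= iter j dbl x < 1 by elim: j => //= j; exact: dbl01.
(* The relation [bit y = 2 * y - dbl y] telescopes, leaving an error below [2^-n]. *)
have e n : digit_sum n (bits x) = x - iter n dbl x / 2 ^+ n.
  elim: n => [|n IH]; first by rewrite /digit_sum big_ord0 /= expr0 divr1 subrr.
  rewrite /digit_sum big_ord_recr/= -/(digit_sum n (bits x)) IH /bits.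
  have h y : bit y = 2 * y - dbl y by rewrite /bit /dbl; case: ifP => _; ring.
  rewrite h exprS; field.
  by rewrite expf_neq0.
rewrite (_ : (fun n => _) = (fun n => x - iter n dbl x / 2 ^+ n)); last exact/funext.
suff h0 : iter n dbl x / 2 ^+ n @[n --> \oo] --> (0 : R).
  by have := cvgB (cvg_cst (x : R)) h0; rewrite subr0; exact.
apply: (@squeeze_cvgr _ _ _ _ (fun=> 0) (fun n => 2^-1 ^+ n)).
- near=> n; have /andP[h0 h1] := it01 n; rewrite -exprVn; apply/andP; split.
    by rewrite mulr_ge0// exprn_ge0.
  by rewrite ler_piMl ?exprn_ge0// ltW.
- exact: cvg_cst.
- by apply: cvg_expr; rewrite ger0_norm//; lra.
Unshelve. all: by end_near.
Qed.
End bits.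

(** * Distribution functions, quantiles and the existence of i.i.d. families *)

Lemma cdf_unique (R : realType) (m1 m2 : probability (measurableTypeR R) R) :
  (forall r, m1 `]-oo, r]%classic = m2 `]-oo, r]%classic) -> eqlaw m1 m2.
Proof.
move=> h A mA.
have E (m : probability (measurableTypeR R) R) (a b : R) : a <= b ->
    m `]a, b]%classic = (m `]-oo, b]%classic - m `]-oo, a]%classic)%E.
  move=> ab; have -> : `]a, b]%classic = `]-oo, b]%classic `\` `]-oo, a]%classic :> set R.
    apply/seteqP; split => x /=; rewrite !in_itv/=.
      by move=> /andP[ax ->]; split => //; apply/negP; rewrite -ltNge.
    by move=> [-> /negP]; rewrite -ltNge => ->.
  rewrite measureD ?setIidr//.
    by apply: subset_itvl; rewrite bnd_simp.
  by rewrite (le_lt_trans (probability_le1 m _)) ?ltry.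
apply: (@measure_unique _ R (measurableTypeR R) (@ocitv R) (fun n => `]- n%:R, n%:R]%classic) _ _ _ _ m1 m2) => //.
- exact: ocitvI.
- by move=> i; exact: is_ocitv.
- apply/seteqP; split => // x _; exists (Num.truncn `|x|).+1 => //=.
  have := truncnS_gt `|x|; rewrite ltr_norml in_itv/= => /andP[-> /ltW ->//].
- move=> _ [[a b] _ <-] /=; have [ab|ba] := leP a b; first by rewrite !E// !h.
  by rewrite set_itv_ge ?measure0// -leNgt bnd_simp ltW.
- by move=> n; rewrite (le_lt_trans (probability_le1 m1 _)) ?ltry.
Qed.

Section quantile.
Context (R : realType) (mu : probability (measurableTypeR R) R).

Definition cdfR (x : R) : R := fine (mu `]-oo, x]%classic).

Lemma EFin_cdfR x : (cdfR x)%:E = mu `]-oo, x]%classic.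
Proof. by rewrite /cdfR fineK// fin_num_measure. Qed.

(** The identity as a random variable under [mu], so that the facts on [cdf] apply to [mu]
    itself. *)
Let idTR : measurableTypeR R -> R := idfun.
#[local] HB.instance Definition _ :=
  @isMeasurableFun.Build _ _ _ _ idTR (@measurable_id _ _ setT).
Let X : {RV mu >-> R} := idTR.
Let cdfE x : cdf X x = (cdfR x)%:E.
Proof. by rewrite EFin_cdfR. Qed.

Lemma cdfR_nd x y : x <= y -> cdfR x <= cdfR y.
Proof. by move=> xy; rewrite -lee_fin -!cdfE; exact: cdf_nondecreasing. Qed.

Lemma cdfR_ge0 x : 0 <= cdfR x.
Proof. by rewrite -lee_fin -!cdfE; exact: cdf_ge0. Qed.

Lemma cdfR_le1 x : cdfR x <= 1.
Proof. by rewrite -lee_fin -!cdfE; exact: cdf_le1. Qed.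

Lemma cdfR_rc x : cdfR y @[y --> x^'+] --> cdfR x.
Proof.
by have := @cdf_right_continuous _ _ _ _ X x; rewrite cdfE => /fine_cvg.
Qed.

Let cdfR_small y : 0 < y -> exists x, cdfR x < y.
Proof.
move=> y0; have /fine_cvg h := cvg_cdfNy0 X.
have : \forall x \near -oo, fine (cdf X x) < y.
  exact: (cvgr_lt _ h).
by move=> /filter_ex[x hx]; exists x; move: hx; rewrite cdfE.
Qed.

Let cdfR_large y : y < 1 -> exists x, y < cdfR x.
Proof.
move=> y0; have /fine_cvg h := cvg_cdfy1 X.
have : \forall x \near +oo, y < fine (cdf X x).
  exact: (cvgr_gt _ h).
by move=> /filter_ex[x hx]; exists x; move: hx; rewrite cdfE.
Qed.

(** The generalised inverse of the distribution function. The default value 0 outside []0, 1[] is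
    taken on a [unif]-null set. *)
Definition quantile (y : R) : R :=
  if (0 < y) && (y < 1) then inf [set x | y <= cdfR x] else 0.

(** Right continuity of the distribution function means that the infimum defining [quantile y] still
    satisfies the constraint, which gives this Galois connection. *)
Lemma quantile_le y x : 0 < y < 1 -> (quantile y <= x) = (y <= cdfR x).
Proof.
move=> y01; have /andP[y0 y1] := y01.
have [l hl] := cdfR_small y0.
have hlb : lbound [set x | y <= cdfR x] l.
  move=> z /= yz; rewrite leNgt; apply/negP => /ltW/cdfR_nd zl.
  by have := lt_le_trans hl (le_trans yz zl); rewrite ltxx.
have hE : [set x | y <= cdfR x] !=set0.
  by have [z /ltW hz] := cdfR_large y1; exists z.
rewrite /quantile y01; apply/idP/idP => [qx|yx]; last first.
  by apply: ge_inf => //; exists l.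
apply: (cvgr_to_ge (@cdfR_rc x)).
near=> z; have xz : x < z by near: z; exact: nbhs_right_gt.
have zx0 : 0 < z - x by rewrite subr_gt0.
have [e /= ye ez] := inf_adherent zx0 (conj hE (ex_intro _ l hlb)).
apply: (le_trans ye); apply: cdfR_nd; apply: ltW; apply: (lt_le_trans ez).
by rewrite -lerBrDr opprB addrCA subrr addr0.
Unshelve. all: by end_near.
Qed.

Lemma measurable_quantile : measurable_fun setT (quantile : measurableTypeR R -> measurableTypeR R).
Proof.
apply: (@measurability _ _ _ _ _ _ (@RGenOInfty.G R)); first exact: RGenOInfty.measurableE.
move=> _ /= [_ [r ->] <-]; rewrite setTI.
have -> : quantile @^-1` `]r, +oo[ = (`]0, 1[ `&` `]cdfR r, +oo[) `|`
   (~` `]0, 1[ `&` (if 0 > r then setT else set0)).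
  apply/seteqP; split => y /=; rewrite !in_itv/= !andbT.
    have [y01|y01] := boolP (0 < y < 1).
      by rewrite ltNge quantile_le// -ltNge; left.
    by rewrite /quantile (negbTE y01) => ->; right; split => //; apply/negP.
  move=> [[y01]|[/negP y01]]; first by rewrite ltNge -quantile_le// -ltNge.
  by rewrite /quantile (negbTE y01); case: ifP.
apply: measurableU; apply: measurableI => //; first exact: measurableC.
by case: ifP.
Qed.

(** By [quantile_le], the points of [[0, 1[] with quantile at most [r] lie between []0, cdfR r[] and
    [[0, cdfR r]], two intervals of the same length. *)
Lemma law_quantile : eqlaw (law (@unif R) measurable_quantile) mu.
Proof.
apply: cdf_unique => r; rewrite -EFin_cdfR.
set A := quantile @^-1` `]-oo, r]%classic.
have mA : measurable A.
  exact: (measurable_preimage measurable_quantile (measurable_itv `]-oo, r])).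
have Ft : cdfR r <= 1 by exact: cdfR_le1.
have F0 := cdfR_ge0 r.
have lebF b1 b2 : @lebesgue_measure R [set` Interval (BSide b1 0) (BSide b2 (cdfR r))] = (cdfR r)%:E.
  rewrite lebesgue_measure_itv/= lte_fin; case: ifP => [_|/negbT]; first by rewrite -EFinD oppr0 addr0.
  by rewrite -leNgt => h; have -> : cdfR r = 0 by apply/eqP; rewrite eq_le h F0.
change (@lebesgue_measure R (A `&` `[0, 1[) = (cdfR r)%:E).
apply/eqP; rewrite eq_le; apply/andP; split.
- rewrite -(lebF true false); apply: le_measure; rewrite ?inE//; first exact: measurableI.
  move=> y [/=]; rewrite !in_itv/= => qy /andP[y0 y1]; rewrite y0 /=.
  move: y0; rewrite le_eqVlt => /orP[/eqP <-//|y0].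
  by rewrite -quantile_le// y0.
- rewrite -(lebF false true); apply: le_measure; rewrite ?inE//; first exact: measurableI.
  move=> y /=; rewrite !in_itv/= => /andP[y0 yF].
  have y1 : y < 1 by exact: lt_le_trans yF Ft.
  split; last by rewrite (ltW y0) y1.
  by rewrite /A /= in_itv/= quantile_le ?y0 ?y1// (ltW yF).
Qed.
End quantile.

Lemma iid_exists (R : realType) (I : countType) (mu : probability (measurableTypeR R) R) :
  exists m : probability (seqspace R I) R, prodlike m /\
    forall i (A : set (measurableTypeR R)), measurable A -> m [set u | A (u i)] = mu A.
Proof.
pose b := law (@unif R) (@measurable_bits R).
have pb : prodlike b by exact: bits_prodlike.
(* Encoding pairs injectively gives each index its own infinite stream of digits, and the streams
   are disjoint. *)
pose h (i : I) (j : nat) := choice.pickle ((i, j) : (I * nat)%type).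
have h_inj i : injective (h i) by move=> j k /(pcan_inj choice.pickleK) [].
have mQ : measurable_fun setT (quantile mu \o @undigit R).
  apply: measurableT_comp; first exact: measurable_quantile.
  by apply: measurable_Lsup => n; exact: measurable_digit_sum.
pose F i := (quantile mu \o @undigit R) \o pull (h i).
have mF i : measurable_fun setT (F i).
  by apply: measurableT_comp mQ _; exact: measurable_pull.
pose J i : {pred nat} := [pred n | `[< exists j, n = h i j >]].
exists (law b (measurable_joint mF)); split.
  apply: (joint_prodlike pb mF (J := J)).
    move=> i u; rewrite /F /=; congr (quantile mu (undigit _)).
    apply/funext => j.
    have hJ : h i j \in J i by exact/asboolP/(ex_intro _ j erefl).
    by rewrite /pull /keep /= hJ.
  have Jh k n : n \in J k -> exists j, n = h k j by move=> /asboolP.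
  move=> k l n /Jh[j nj] /Jh[j' nj'].
  have : h k j = h l j' by rewrite -nj -nj'.
  by move=> /(pcan_inj choice.pickleK)[].
move=> i A mA.
have mQA : measurable ((quantile mu \o @undigit R) @^-1` A).
  exact: (measurable_preimage mQ mA).
rewrite -(law_quantile mu mA).
(* Each stream is distributed like the full digit sequence, for which [undigit] returns the uniform
   variable itself. *)
have e : eqlaw (law b (measurable_pull (h i))) b.
  apply: prodlike_eqlaw => //; first exact: pull_prodlike.
  move=> j E mE.
  have bj k : b [set u | E (u k)] = @unif R (@bit R @^-1` E) by exact: biti.
  transitivity (b [set u | E (u (h i j))]) => //.
  by rewrite !bj.
apply: etrans (e _ mQA) _.
change (@unif R (@bits R @^-1` ((quantile mu \o @undigit R) @^-1` A)) =
  @unif R (quantile mu @^-1` A)).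
rewrite !unifE; congr (lebesgue_measure _); apply/seteqP.
by split => x /= [Ax]; rewrite in_itv/= => x01; split; rewrite ?in_itv//;
  move: Ax; rewrite undigit_bits.
Qed.

Lemma law_eqlaw d1 d2 (T1 : measurableType d1) (T2 : measurableType d2) (R : realType)
    (m1 m2 : probability T1 R) (f g : T1 -> T2) (mf : measurable_fun setT f)
    (mg : measurable_fun setT g) : eqlaw m1 m2 -> f =1 g ->
  eqlaw (law m1 mf) (law m2 mg).
Proof.
move=> h /funext fg; subst g => A mA; apply: h.
exact: (measurable_preimage mf mA).
Qed.

Lemma law_comp d1 d2 d3 (T1 : measurableType d1) (T2 : measurableType d2)
    (T3 : measurableType d3) (R : realType) (m : probability T1 R)
    (f : T1 -> T2) (g : T2 -> T3) (h : T1 -> T3) (mf : measurable_fun setT f)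
    (mg : measurable_fun setT g) (mh : measurable_fun setT h) :
  (forall x, h x = g (f x)) -> eqlaw (law m mh) (law (law m mf) mg).
Proof.
move=> hgf A mA; congr (m _).
by apply/seteqP; split => x /=; rewrite hgf.
Qed.

Lemma pprod_eqlaw d1 d2 (T1 : measurableType d1) (T2 : measurableType d2) (R : realType)
    (m1 m1' : probability T1 R) (m2 m2' : probability T2 R) :
  eqlaw m1 m1' -> eqlaw m2 m2' -> eqlaw (pprod m1 m2) (pprod m1' m2').
Proof.
move=> h1 h2 A mA; apply: product_measure_unique => // B C mB mC.
have e : pprod m1' m2' (B `*` C) = (m1' B * m2' C)%E by exact: product_measure1E.
by apply: (etrans e); congr (_ * _)%E; apply/esym; [exact: h1|exact: h2].
Qed.

(** * The recursion map *)

Section convolution.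
Context (R : realType).
Local Notation T := (measurableTypeR R).
Local Notation prob := (probability T R).
Implicit Types m mu nu : prob.

Lemma measurable_add : measurable_fun setT (fun z : T * T => z.1 + z.2 : T).
Proof. by apply: measurable_funD; [exact: measurable_fst|exact: measurable_snd]. Qed.

Lemma measurable_mul : measurable_fun setT (fun z : T * T => z.1 * z.2 : T).
Proof. by apply: measurable_funM; [exact: measurable_fst|exact: measurable_snd]. Qed.

Lemma measurable_scale (c : R) : measurable_fun setT (fun x : T => c * x : T).
Proof. exact: mulrl_measurable. Qed.

Definition convol m1 m2 : prob := law (pprod m1 m2) measurable_add.
(** The multiplicative convolution; [cpow] below is the additive convolution power, starting from
    its unit, the Dirac mass at 0. *)
Definition mulc m1 m2 : prob := law (pprod m1 m2) measurable_mul.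
Definition scalec c m : prob := law m (measurable_scale c).
Fixpoint cpow m k : prob := if k is k'.+1 then convol (cpow m k') m else \d_(0 : T).
Definition Phi (b : nat) mu nu : prob := scalec b%:R^-1 (cpow (mulc mu nu) b).

Lemma convol_eqlaw m1 m1' m2 m2' : eqlaw m1 m1' -> eqlaw m2 m2' ->
  eqlaw (convol m1 m2) (convol m1' m2').
Proof. by move=> h1 h2; apply: law_eqlaw => //; exact: pprod_eqlaw. Qed.

Lemma cpow_eqlaw m m' k : eqlaw m m' -> eqlaw (cpow m k) (cpow m' k).
Proof. by move=> h; elim: k => [//|k IH] /=; exact: convol_eqlaw. Qed.

Lemma Phi_eqlaw b mu mu' nu nu' : eqlaw mu mu' -> eqlaw nu nu' ->
  eqlaw (Phi b mu nu) (Phi b mu' nu').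
Proof.
move=> h1 h2; apply: law_eqlaw => //; apply: cpow_eqlaw.
by apply: law_eqlaw => //; exact: pprod_eqlaw.
Qed.

Lemma measurable_pow k : measurable_fun setT (fun x : T => x ^+ k : R).
Proof. exact: exprn_measurable. Qed.

Lemma measurable_normpow k : measurable_fun setT (fun x : T => `|x| ^+ k : R).
Proof. exact: (measurableT_comp (measurable_pow k) (@normr_measurable R setT)). Qed.

Hint Resolve measurable_pow measurable_normpow : core.

Lemma itg_pow_le m j k : (j <= k)%N -> itg m (fun x => `|x| ^+ k) ->
  itg m (fun x => `|x| ^+ j).
Proof.
move=> jk i; apply: (@itg_le _ _ _ _ _ (fun x : T => 1 + `|x| ^+ k)) => //.
  by apply: itgD => //; exact: itg_cst.
move=> x; rewrite ger0_norm ?exprn_ge0//.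
have [x1|/ltW x1] := leP `|x| 1.
  by rewrite (le_trans (exprn_ile1 j (normr_ge0 x) x1))// lerDl exprn_ge0.
by rewrite (le_trans (ler_weXn2l x1 jk))// lerDr.
Qed.

Lemma itg_norm_pow m k : itg m (fun x => `|x| ^+ k) -> itg m (fun x => x ^+ k).
Proof. by move=> i; apply: (itg_le _ i) => // x; rewrite normrX. Qed.

Lemma itg_pow m j k : (j <= k)%N -> itg m (fun x => `|x| ^+ k) -> itg m (fun x => x ^+ j).
Proof. by move=> jk i; apply: itg_norm_pow; exact: itg_pow_le jk i. Qed.

Section mulc_moments.
Variables (m1 m2 : prob) (k : nat).
Hypotheses (i1 : itg m1 (fun x => `|x| ^+ k)) (i2 : itg m2 (fun x => `|x| ^+ k)).

Lemma itg_mulc : itg (mulc m1 m2) (fun x => `|x| ^+ k).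
Proof.
apply/itg_law => //; have := itg_prodM i1 i2; congr itg.
by apply/funext => z; rewrite normrM exprMn.
Qed.

Lemma Ex_mulc : Ex (mulc m1 m2) (fun x => x ^+ k) =
  Ex m1 (fun x => x ^+ k) * Ex m2 (fun x => x ^+ k).
Proof.
have j1 := itg_norm_pow i1; have j2 := itg_norm_pow i2.
rewrite Ex_law//; last exact: (itg_law (pprod m1 m2) measurable_mul (measurable_pow k)).1 (itg_norm_pow itg_mulc).
by rewrite -Ex_prodM//; congr Ex; apply/funext => z; rewrite exprMn.
Qed.
End mulc_moments.

Lemma normD_pow_le (x y : R) k : `|x + y| ^+ k <= 2 ^+ k * (`|x| ^+ k + `|y| ^+ k).
Proof.
pose M := Num.max `|x| `|y|.
have M0 : 0 <= M by rewrite le_max normr_ge0.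
have h : `|x + y| <= 2 * M.
  rewrite (le_trans (ler_normD _ _))// mulr2n mulrDl mul1r lerD// le_max lexx ?orbT//.
rewrite (le_trans (lerXn2r _ _ _ h)) ?nnegrE ?mulr_ge0// exprMn ler_wpM2l ?exprn_ge0//.
by rewrite /M; case: (leP `|x|) => _; rewrite ?lerDl ?lerDr exprn_ge0.
Qed.

Lemma itg_convol m1 m2 k : itg m1 (fun x => `|x| ^+ k) -> itg m2 (fun x => `|x| ^+ k) ->
  itg (convol m1 m2) (fun x => `|x| ^+ k).
Proof.
move=> i1 i2; apply/itg_law => //.
apply: (@itg_le _ _ _ _ _ (fun z : T * T => 2 ^+ k * (`|z.1| ^+ k + `|z.2| ^+ k))).
- exact: measurableT_comp (measurable_normpow k) measurable_add.
- by apply: itgZ; apply: itgD; [exact: (itg_prod1 m2 i1)|exact: (itg_prod2 m1 i2)].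
- by move=> z; rewrite ger0_norm ?exprn_ge0// normD_pow_le.
Qed.

Lemma measurable_dist_pow (a : R) k : measurable_fun setT (fun x : T => `|x - a| ^+ k).
Proof. by apply: (measurableT_comp (measurable_normpow k)); exact: measurable_funB. Qed.

Lemma itg_dist m (a : R) k j : (j <= k)%N -> itg m (fun x => `|x| ^+ k) ->
  itg m (fun x => `|x - a| ^+ j).
Proof.
move=> jk i; have := itg_pow_le jk i => {}i.
apply: (itg_le (measurable_dist_pow a j) (itgZ (2 ^+ j) (itgD i (itg_cst m (`|a| ^+ j))))) => x.
by rewrite ger0_norm ?exprn_ge0// -(normrN a) normD_pow_le.
Qed.

Lemma itg_dirac (f : T -> R) (a : T) : measurable_fun setT f -> itg (\d_a : prob) f.
Proof.
move=> mf; apply/integrableP; split; first exact/measurable_EFinP.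
rewrite integral_dirac//; first by rewrite diracT mul1e ltry.
by apply: measurableT_comp => //; exact/measurable_EFinP.
Qed.

Lemma itg_cpow m k n : itg m (fun x => `|x| ^+ k) -> itg (cpow m n) (fun x => `|x| ^+ k).
Proof.
move=> i; elim: n => [|n IH] /=; last exact: itg_convol.
exact: itg_dirac.
Qed.

Lemma Ex_dirac (f : T -> R) (a : T) : measurable_fun setT f -> Ex (\d_a : prob) f = f a.
Proof.
move=> mf; rewrite /Ex /Rintegral integral_dirac//; last exact/measurable_EFinP.
by rewrite diracT mul1e.
Qed.

Lemma Ex_mulrn m (f : T -> R) n : itg m f -> Ex m (fun x => f x *+ n) = Ex m f *+ n.
Proof.
move=> i; rewrite -mulr_natl -ExZ//; congr Ex; apply/funext => x.
by rewrite mulr_natl.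
Qed.

(** The binomial formula under a product law. The shape [u + c * v] serves both for sums, with
    [c = 1], and for centred products, through [x * y - 1 = (x - 1) + x * (y - 1)]. *)
Lemma Ex_pprod_pow m1 m2 (u c v : T -> R) (k : nat) :
  (forall j, (j <= k)%N -> itg m1 (fun x => u x ^+ (k - j) * c x ^+ j)) ->
  (forall j, (j <= k)%N -> itg m2 (fun y => v y ^+ j)) ->
  itg (pprod m1 m2) (fun z => (u z.1 + c z.1 * v z.2) ^+ k) /\
  Ex (pprod m1 m2) (fun z => (u z.1 + c z.1 * v z.2) ^+ k) =
  \sum_(j < k.+1) (Ex m1 (fun x => u x ^+ (k - j) * c x ^+ j) * Ex m2 (fun y => v y ^+ j)) *+ 'C(k, j).
Proof.
move=> iu iv.
pose g (j : nat) (x : T) : R := if (j <= k)%N then (u x ^+ (k - j) * c x ^+ j) *+ 'C(k, j) else 0.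
pose w (j : nat) (y : T) : R := if (j <= k)%N then v y ^+ j else 0.
have ig j : itg m1 (g j).
  rewrite /g; case: (boolP (j <= k)%N) => jk; last exact: itg_cst.
  have := itgZ ('C(k, j)%:R) (iu j jk); congr itg.
  by apply/funext => x; rewrite mulr_natl.
have iw j : itg m2 (w j).
  by rewrite /w; case: (boolP (j <= k)%N) => jk; [exact: iv|exact: itg_cst].
have -> : (fun z : T * T => (u z.1 + c z.1 * v z.2) ^+ k) =
    (fun z => \sum_(j < k.+1) g j z.1 * w j z.2).
  apply/funext => z; rewrite exprDn; apply: eq_bigr => j _.
  by rewrite /g /w -ltnS ltn_ord exprMn mulrA mulrnAl.
have igw j : itg (pprod m1 m2) (fun z => g j z.1 * w j z.2) by exact: itg_prodM.
split; first exact: itg_sum.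
rewrite Ex_sum//; apply: eq_bigr => j _; rewrite Ex_prodM// /g /w -ltnS ltn_ord.
by rewrite Ex_mulrn ?mulrnAl//; apply: iu; rewrite -ltnS.
Qed.

Lemma Ex_convol_pow m1 m2 k : itg m1 (fun x => `|x| ^+ k) -> itg m2 (fun x => `|x| ^+ k) ->
  Ex (convol m1 m2) (fun x => x ^+ k) =
  \sum_(j < k.+1) (Ex m1 (fun x => x ^+ (k - j)) * Ex m2 (fun x => x ^+ j)) *+ 'C(k, j).
Proof.
move=> i1 i2.
have e1 j : (fun x : T => x ^+ (k - j)) = (fun x => x ^+ (k - j) * 1 ^+ j).
  by apply/funext => x; rewrite expr1n mulr1.
have [j _|j jk|i e] := @Ex_pprod_pow m1 m2 id (fun=> 1) id k.
- by rewrite -e1; exact: itg_pow (leq_subr j k) i1.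
- exact: itg_pow jk i2.
have e2 : (fun z : T * T => (z.1 + z.2) ^+ k) = (fun z => (z.1 + 1 * z.2) ^+ k).
  by apply/funext => z; rewrite mul1r.
rewrite Ex_law//; last by rewrite e2.
by rewrite e2 e; apply: eq_bigr => j _; rewrite -e1.
Qed.

Lemma Ex_pow0 m : Ex m (fun x => x ^+ 0) = 1.
Proof. by rewrite -[RHS](Ex_cst m 1). Qed.

Lemma cpow_mean m k : itg m (fun x => `|x| ^+ 1) ->
  Ex (cpow m k) (fun x => x ^+ 1) = k%:R * Ex m (fun x => x ^+ 1).
Proof.
move=> i; elim: k => [|k IH] /=; first by rewrite Ex_dirac// expr1 mul0r.
rewrite Ex_convol_pow//; last exact: itg_cpow.
rewrite !big_ord_recr big_ord0 /= subn0 subnn !Ex_pow0 IH.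
by rewrite ?binn ?bin0 ?bin1 -natr1; ring.
Qed.

Lemma cpow_sqr m k : itg m (fun x => `|x| ^+ 2) ->
  Ex (cpow m k) (fun x => x ^+ 2) = k%:R * Ex m (fun x => x ^+ 2) +
    k%:R * (k%:R - 1) * Ex m (fun x => x ^+ 1) ^+ 2.
Proof.
move=> i; have i1 := itg_pow_le (isT : 1 <= 2)%N i.
elim: k => [|k IH] /=; first by rewrite Ex_dirac// expr0n /=; ring.
rewrite Ex_convol_pow//; last exact: itg_cpow.
rewrite !big_ord_recr big_ord0 /= subn0 subnn !Ex_pow0 IH cpow_mean//.
by rewrite ?binn ?bin0 ?bin1 -natr1; ring.
Qed.

(** The three terms sort the triples of summands by their number of distinct indices: one, two or
    three. *)
Lemma cpow_cube m k : itg m (fun x => `|x| ^+ 3) ->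
  Ex (cpow m k) (fun x => x ^+ 3) = k%:R * Ex m (fun x => x ^+ 3) +
    3 * k%:R * (k%:R - 1) * Ex m (fun x => x ^+ 1) * Ex m (fun x => x ^+ 2) +
    k%:R * (k%:R - 1) * (k%:R - 2) * Ex m (fun x => x ^+ 1) ^+ 3.
Proof.
move=> i; have i1 := itg_pow_le (isT : 1 <= 3)%N i.
have i2 := itg_pow_le (isT : 2 <= 3)%N i.
elim: k => [|k IH] /=; first by rewrite Ex_dirac// expr0n /=; ring.
rewrite Ex_convol_pow//; last exact: itg_cpow.
rewrite !big_ord_recr big_ord0 /= subn0 subnn !Ex_pow0 IH cpow_mean// cpow_sqr//.
rewrite ?binn ?bin0 ?bin1 (_ : 'C(3, 2) = 3)%N// -natr1; ring.
Qed.

Section Phi_moments.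
Variables (b : nat) (mu nu : prob).
Hypothesis (b0 : (0 < b)%N).
Let B : R := b%:R.
Let B0 : B != 0. Proof. by rewrite pnatr_eq0 -lt0n. Qed.

Lemma itg_Phi k : itg mu (fun x => `|x| ^+ k) -> itg nu (fun x => `|x| ^+ k) ->
  itg (Phi b mu nu) (fun x => `|x| ^+ k).
Proof.
move=> i j; apply/itg_law => //.
have := itgZ (`|B^-1| ^+ k) (itg_cpow b (itg_mulc i j)); congr itg.
by apply/funext => x; rewrite normrM exprMn.
Qed.

Lemma Ex_Phi k : itg mu (fun x => `|x| ^+ k) -> itg nu (fun x => `|x| ^+ k) ->
  Ex (Phi b mu nu) (fun x => x ^+ k) =
  B ^- k * Ex (cpow (mulc mu nu) b) (fun x => x ^+ k).
Proof.
move=> i j; have ij := itg_cpow b (itg_mulc i j).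
rewrite Ex_law//; last first.
  exact: (itg_law _ (measurable_scale _) (measurable_pow k)).1 (itg_norm_pow (itg_Phi i j)).
rewrite -exprVn -ExZ; last exact: itg_norm_pow.
by congr Ex; apply/funext => x; rewrite exprMn.
Qed.

Lemma Phi_mean : itg mu (fun x => `|x| ^+ 1) -> itg nu (fun x => `|x| ^+ 1) ->
  Ex (Phi b mu nu) (fun x => x ^+ 1) = Ex mu (fun x => x ^+ 1) * Ex nu (fun x => x ^+ 1).
Proof.
move=> i j; rewrite Ex_Phi// cpow_mean; last exact: itg_mulc.
by rewrite Ex_mulc// -/B expr1 mulKf.
Qed.

Lemma Phi_sqr : itg mu (fun x => `|x| ^+ 2) -> itg nu (fun x => `|x| ^+ 2) ->
  Ex (Phi b mu nu) (fun x => x ^+ 2) =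
  (Ex mu (fun x => x ^+ 2) * Ex nu (fun x => x ^+ 2) +
   (B - 1) * (Ex mu (fun x => x ^+ 1) * Ex nu (fun x => x ^+ 1)) ^+ 2) / B.
Proof.
move=> i j; rewrite Ex_Phi// cpow_sqr; last exact: itg_mulc.
rewrite !Ex_mulc// -/B; [by field|exact: itg_pow_le i|exact: itg_pow_le j].
Qed.

Lemma Phi_cube : itg mu (fun x => `|x| ^+ 3) -> itg nu (fun x => `|x| ^+ 3) ->
  Ex (Phi b mu nu) (fun x => x ^+ 3) =
  (Ex mu (fun x => x ^+ 3) * Ex nu (fun x => x ^+ 3) +
   3 * (B - 1) * (Ex mu (fun x => x ^+ 1) * Ex nu (fun x => x ^+ 1)) *
     (Ex mu (fun x => x ^+ 2) * Ex nu (fun x => x ^+ 2)) +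
   (B - 1) * (B - 2) * (Ex mu (fun x => x ^+ 1) * Ex nu (fun x => x ^+ 1)) ^+ 3) / B ^+ 2.
Proof.
move=> i j; rewrite Ex_Phi// cpow_cube; last exact: itg_mulc.
have i1 := itg_pow_le (isT : 1 <= 3)%N i; have i2 := itg_pow_le (isT : 2 <= 3)%N i.
have j1 := itg_pow_le (isT : 1 <= 3)%N j; have j2 := itg_pow_le (isT : 2 <= 3)%N j.
by rewrite !Ex_mulc// -/B; field.
Qed.
End Phi_moments.

Lemma on_Rplus_pprod m1 m2 : on_Rplus m1 -> on_Rplus m2 ->
  pprod m1 m2 (`[0, +oo[%classic `*` `[0, +oo[%classic) = 1%E.
Proof.
rewrite /on_Rplus => h1 h2.
have -> : pprod m1 m2 (`[0, +oo[%classic `*` `[0, +oo[%classic) =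
  (m1 `[0%R, +oo[%classic * m2 `[0%R, +oo[%classic)%E by exact: product_measure1E.
by rewrite h1 h2 mule1.
Qed.

Lemma on_Rplus_law2 m1 m2 (f : T * T -> T) (mf : measurable_fun setT f) :
  on_Rplus m1 -> on_Rplus m2 -> (forall z, 0 <= z.1 -> 0 <= z.2 -> 0 <= f z) ->
  on_Rplus (law (pprod m1 m2) mf).
Proof.
move=> h1 h2 hf; apply/eqP; rewrite eq_le probability_le1//=.
rewrite -(on_Rplus_pprod h1 h2); apply: le_measure; rewrite ?inE.
- exact: measurableX.
- exact: (measurable_preimage mf (measurable_itv `[0, +oo[)).
- by move=> z [/=]; rewrite !in_itv/= !andbT; exact: hf.
Qed.

Lemma on_Rplus_Phi b mu nu : on_Rplus mu -> on_Rplus nu -> on_Rplus (Phi b mu nu).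
Proof.
move=> h1 h2.
have h3 : on_Rplus (mulc mu nu) by apply: on_Rplus_law2 => // z; exact: mulr_ge0.
have : on_Rplus (cpow (mulc mu nu) b).
  elim: b => [|k IH] /=; last by apply: on_Rplus_law2 => // z; exact: addr_ge0.
  by rewrite /on_Rplus /= diracE mem_set//= in_itv/= lexx.
move=> h4; apply/eqP; rewrite eq_le probability_le1//= -h4.
apply: le_measure; rewrite ?inE//.
- exact: (measurable_preimage (measurable_scale _) (measurable_itv `[0, +oo[)).
- by move=> x /=; rewrite !in_itv/= !andbT => x0; rewrite mulr_ge0// invr_ge0.
Qed.

Lemma on_Rplus_ae m : on_Rplus m -> {ae m, forall x, 0 <= x}.
Proof.
move=> h; exists (~` `[0, +oo[%classic); split; first exact: measurableC.
  by rewrite probability_setC// h subee.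
by move=> x /= hx; rewrite in_itv/= andbT.
Qed.

End convolution.

(** * Limits of sequences of random variables *)

Section limit_lemmas.
Context d (T : measurableType d) (R : realType) (m : probability T R).

(** [g] is the sum of the [|f n|]: its integral is at most [a / (1 - q)] by monotone convergence, so
    it is almost everywhere finite, and it dominates all partial sums. *)
Lemma summable_ae (f : nat -> T -> R) (a q : R) : 0 <= q < 1 ->
  (forall n, itg m (f n)) -> (forall n, Ex m (fun x => `|f n x|) <= a * q ^+ n) ->
  exists2 g : T -> R, itg m g & {ae m, forall x,
    (forall n, `|\sum_(0 <= k < n) f k x| <= g x) /\ cvgn (fun n => \sum_(0 <= k < n) f k x)}.
Proof.
move=> /andP[q0 q1] fi fq.
have mf n : measurable_fun setT (fun x => `|f n x|%:E).
  apply/measurable_EFinP; apply: measurableT_comp => //; exact: itg_meas (fi n).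
pose G x := (\sum_(n <oo) `|f n x|%:E)%E.
have G0 x : (0 <= G x)%E by apply: nneseries_ge0 => n _ _; rewrite lee_fin.
have mG : measurable_fun setT G by apply: ge0_emeasurable_sum => // n x _ _; rewrite lee_fin.
have a0 : 0 <= a by have := fq 0%N; rewrite expr0 mulr1; apply: le_trans; exact: Ex_ge0.
have intG : (\int[m]_x G x < +oo)%E.
  rewrite /G integral_nneseries//.
  apply: (@le_lt_trans _ _ (a / (1 - q))%:E); last exact: ltry.
  apply: lime_le.
    by apply: is_cvg_nneseries => n _ _; apply: integral_ge0 => x _; rewrite lee_fin.
  apply: nearW => n.
  rewrite (eq_bigr (fun i => (Ex m (fun x => `|f i x|))%:E)); last first.
    by move=> i _; rewrite EFin_Ex//; exact: itg_norm.
  rewrite sumEFin lee_fin (@le_trans _ _ (\sum_(0 <= i < n) a * q ^+ i))//.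
    by apply: ler_sum => i _; exact: fq.
  have -> : \sum_(0 <= i < n) a * q ^+ i = series (geometric a q) n by [].
  rewrite geometric_seriesE ?lt_eqF// ler_pM2r ?invr_gt0 ?subr_gt0//.
  by rewrite ler_piMr// gerBl exprn_ge0.
have iG : m.-integrable setT G.
  by apply/integrableP; split => //; under eq_integral do rewrite gee0_abs//.
exists (fine \o G).
  apply: (@itg_ge0P _ _ _ m (fine \o G)).
  - by apply: measurableT_comp => //; exact: fine_measurable.
  - by move=> x; exact: fine_ge0.
  - apply: le_lt_trans intG; apply: ge0_le_integral => //.
    + by move=> x _; rewrite lee_fin fine_ge0.
    + apply/measurable_EFinP; apply: measurableT_comp => //; exact: fine_measurable.
    + by move=> x _ /=; have := G0 x; case: (G x) => //= _; rewrite leey.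
have := integrable_ae measurableT iG; apply: filterS => x /(_ I) Gx.
have h n : \sum_(0 <= k < n) `|f k x| <= fine (G x).
  rewrite -lee_fin fineK// -sumEFin; apply: nneseries_lim_ge => k _ _; by rewrite lee_fin.
split => [n|].
  exact: le_trans (ler_norm_sum _ _ _) (h n).
apply: (@normed_cvg R R (fun n => f n x)).
apply: nondecreasing_is_cvgn.
  exact: (@nondecreasing_series R (fun n => `|f n x|) xpredT 0%N (fun n _ _ => normr_ge0 _)).
by exists (fine (G x)) => _ [n _ <-]; exact: h.
Qed.

Lemma fatou_itg (f : nat -> T -> R) (g : T -> R) (K : R) :
  (forall n x, 0 <= f n x) -> (forall n, itg m (f n)) -> (forall n, Ex m (f n) <= K) ->
  measurable_fun setT g -> (forall x, 0 <= g x) ->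
  {ae m, forall x, f n x @[n --> \oo] --> g x} -> itg m g.
Proof.
move=> f0 fi fK mg g0 fg; apply: itg_ge0P => //.
have mf n : measurable_fun setT (EFin \o f n) by apply/measurable_EFinP; exact: itg_meas (fi n).
have e : (\int[m]_x (g x)%:E = \int[m]_x limn_einf (fun n => (f n x)%:E))%E.
  apply: ae_eq_integral => //.
  - exact/measurable_EFinP.
  - apply: (measurableT_comp (@oppe_measurable R setT)).
    apply: measurable_fun_limn_esup => n.
    exact: (measurableT_comp (@oppe_measurable R setT) (mf n)).
  - apply: filterS fg => x fx _.
    have fx' : (f n x)%:E @[n --> \oo] --> (g x)%:E by apply: cvg_EFin fx; exact: nearW.
    by have [->] := cvg_limn_einf_sup fx'.
rewrite e; apply: (@le_lt_trans _ _ K%:E); last exact: ltry.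
apply: le_trans (fatou _ _ _ _) _ => //; first by move=> n x _; rewrite lee_fin.
apply: le_trans (limn_einf_sup _) _; rewrite limn_esup_lim.
apply: lime_le; first exact: is_cvg_esups.
apply: nearW => n; apply: ge_ereal_sup => _ [k _ <-].
by rewrite -EFin_Ex// lee_fin.
Qed.

Lemma dominated_Ex (f : nat -> T -> R) (h g : T -> R) :
  (forall n, measurable_fun setT (f n)) -> measurable_fun setT h -> itg m g ->
  {ae m, forall x, (forall n, `|f n x| <= g x) /\ f n x @[n --> \oo] --> h x} ->
  itg m h /\ Ex m (f n) @[n --> \oo] --> Ex m h.
Proof.
move=> mf mh ig fh.
have [|||||i _ c] := @dominated_convergence _ T R m setT measurableT
   (fun n x => (f n x)%:E) (fun x => (h x)%:E) (fun x => (g x)%:E).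
- by move=> n; exact/measurable_EFinP.
- exact/measurable_EFinP.
- apply: filterS fh => x [_ fx] _; by apply: cvg_EFin fx; exact: nearW.
- exact: ig.
- by apply: filterS fh => x [fx _] n _; rewrite lee_fin.
split; first exact: i.
by move: c; rewrite /= -(EFin_Ex i) => /fine_cvg.
Qed.

Lemma ae_eqlaw d' (T' : measurableType d') (f g : T -> T') (mf : measurable_fun setT f)
    (mg : measurable_fun setT g) : {ae m, forall x, f x = g x} ->
  eqlaw (law m mf) (law m mg).
Proof.
move=> [N [mN N0 fgN]] A mA.
change (m (f @^-1` A) = m (g @^-1` A)).
have mfA := measurable_preimage mf mA; have mgA := measurable_preimage mg mA.
have le_aux (B C : set T) : measurable B -> measurable C ->
    (forall x, f x = g x -> B x -> C x) -> (m B <= m C)%E.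
  move=> mB mC BC; have -> : m C = (m C + m N)%E by rewrite N0 adde0.
  apply: le_trans (measureU2 m mC mN); apply: le_measure; rewrite ?inE//.
    exact: measurableU.
  move=> x Bx; have [Nx|Nx] := pselect (N x); [by right|left].
  apply: BC => //; apply: contrapT => fgx; exact/Nx/fgN.
by apply/eqP; rewrite eq_le !le_aux// => x /= ->.
Qed.
End limit_lemmas.

(** * The cascade *)

Section tree.
Context (R : realType) (b : nat) (b0 : (0 < b)%N).
Local Notation T := (measurableTypeR R).
Local Notation I := (seq 'I_b : choiceType).
Local Notation U := (seqspace R I).
Variables (m : probability U R) (pm : prodlike m) (mu : probability T R).
Hypothesis marg : forall i (A : set T), measurable A -> m [set u | A (u i)] = mu A.

(** Cascade products begin with words of length one, so the root value is never read. This is what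
    makes [u [:: j]], which is the root value of the subtree at [j], independent of a function
    evaluated on that subtree. *)
Definition nonnil : {pred I} := [pred w | w != [::]].
Definition subtree (j : 'I_b) (u : U) : U := pull (cons j : I -> I) u.

Lemma measurable_subtree j : measurable_fun setT (subtree j).
Proof. exact: measurable_pull. Qed.

Lemma subtree_law j : eqlaw (law m (measurable_subtree j)) m.
Proof.
apply: prodlike_eqlaw => //.
  by apply: pull_prodlike => // x y [].
move=> i E mE; apply: etrans (esym _); last exact: marg.
by apply: etrans; first exact: (marg (j :: i) mE).
Qed.

Section bridge.
Variables (F : U -> T) (mF : measurable_fun setT F) (dF : depends nonnil F).

Definition branch (j : 'I_b) (u : U) : T := u [:: j] * F (subtree j u).

Let mFj j : measurable_fun setT (F \o subtree j).
Proof. exact: measurableT_comp mF (measurable_subtree j). Qed.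

Lemma measurable_branch j : measurable_fun setT (branch j).
Proof. by apply: measurable_funM; [exact: measurable_coord|exact: mFj]. Qed.

Let dFj j : depends [pred w : I | (w != [::]) && (behead w != [::]) && (ohead w == Some j)] (F \o subtree j).
Proof.
move=> u; rewrite /= -dF -[RHS]dF; congr F; apply/funext => w.
by rewrite /keep /subtree /pull /= /nonnil !inE; case: ifP => // ->; rewrite eqxx.
Qed.

Let dbranch j : depends [pred w : I | ohead w == Some j] (branch j).
Proof.
move=> u; rewrite /branch; congr (_ * _); first by rewrite /keep inE /= eqxx.
rewrite -dF -[RHS]dF; congr F; apply/funext => w.
by rewrite /keep /subtree /pull /= !inE eqxx.
Qed.

(** The word [[:: j]] and the words of length at least two beginning with [j] are disjoint sets of
    coordinates, so the two factors are independent. *)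
Lemma branch_law j : eqlaw (law m (measurable_branch j)) (mulc mu (law m mF)).
Proof.
have mc : measurable_fun setT (fun u : U => u [:: j] : T) by exact: measurable_coord.
have h := @depends_pair_law R I m pm (pred1 [:: j])
  [pred w : I | (w != [::]) && (behead w != [::]) && (ohead w == Some j)]
  (fun u : U => u [:: j] : T) (F \o subtree j) mc (mFj j).
have {}h : eqlaw (law m (measurable_fun_pair mc (mFj j))) (pprod (law m mc) (law m (mFj j))).
  apply: h; [by move=> w; rewrite !inE => /eqP->| |exact: dFj].
  by move=> u; rewrite /keep inE eqxx.
have h2 : eqlaw (pprod (law m mc) (law m (mFj j))) (pprod mu (law m mF)).
  apply: pprod_eqlaw; first by move=> A mA; exact: marg.
  move=> A mA; apply: etrans (subtree_law j _) => //.
  exact: (measurable_preimage mF mA).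
have h3 : eqlaw (law m (measurable_branch j))
    (law (law m (measurable_fun_pair mc (mFj j))) (@measurable_mul R)) by exact: law_comp.
by apply: (eqlaw_trans h3); apply: law_eqlaw => //; exact: eqlaw_trans h h2.
Qed.

Definition branch_sum (s : seq 'I_b) (u : U) : T := \sum_(j <- s) branch j u.

Lemma measurable_branch_sum s : measurable_fun setT (branch_sum s).
Proof. by apply: measurable_sum => j; exact: measurable_branch. Qed.

Let dbranch_sum s : depends [pred w : I | has (fun j => ohead w == Some j) s] (branch_sum s).
Proof.
move=> u; apply: eq_big_seq => j js; rewrite -(dbranch j u) -[LHS]dbranch; congr branch.
apply/funext => w; rewrite /keep !inE; case: ifP => // wj; case: ifP => // /negP[].
by apply/hasP; exists j.
Qed.

Lemma branch_sum_law s : uniq s ->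
  eqlaw (law m (measurable_branch_sum s)) (cpow (mulc mu (law m mF)) (size s)).
Proof.
elim: s => [_|j s IH /= /andP[js us]].
  move=> A mA /=; rewrite /dirac.
  have [A0|A0] := pselect (A 0).
    rewrite indicE mem_set// [RHS]/=; apply: etrans (probability_setT m).
    by congr (m _); apply/seteqP; split => // u _; rewrite /branch_sum /= big_nil.
  rewrite indicE memNset//; apply: etrans (measure0 m).
  by congr (m _); apply/seteqP; split => // u; rewrite /branch_sum /= big_nil.
have h : eqlaw (law m (measurable_fun_pair (measurable_branch_sum s) (measurable_branch j)))
   (pprod (law m (measurable_branch_sum s)) (law m (measurable_branch j))).
  apply: (depends_pair_law pm); [|exact: dbranch_sum|exact: dbranch].
  move=> w; rewrite !inE => /hasP[i si /eqP->]; apply/negP => /eqP[ij].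
  by move: js; rewrite -ij si.
have h2 := eqlaw_trans h (pprod_eqlaw (IH us) (branch_law j)).
have h3 := law_eqlaw (@measurable_add R) (@measurable_add R) h2 (fun=> erefl).
apply: (eqlaw_trans _ h3); apply: law_comp => u.
by rewrite /= /branch_sum big_cons addrC.
Qed.

Definition branch_mean (u : U) : T := b%:R^-1 * \sum_(j < b) u [:: j] * F (subtree j u).

Lemma measurable_branch_mean : measurable_fun setT branch_mean.
Proof.
apply: measurable_funM => //; apply: measurable_sum => j; exact: measurable_branch.
Qed.

(** Distinct first letters use disjoint sets of words, so the branches are independent. [F] is left
    general because it will be the finite cascade, its increment and its limit in turn. *)
Lemma branch_mean_law : eqlaw (law m measurable_branch_mean) (Phi b mu (law m mF)).
Proof.
have := branch_sum_law (enum_uniq 'I_b); rewrite size_enum_ord => h.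
have h3 := law_eqlaw (measurable_scale b%:R^-1) (measurable_scale b%:R^-1) h (fun=> erefl).
apply: (eqlaw_trans _ h3); by apply: law_comp => u; rewrite /= /branch_sum /branch_mean big_enum.
Qed.

End bridge.
End tree.

#[local] Hint Resolve measurable_pow measurable_normpow : core.

Lemma cvgS (R : realType) (f : nat -> R) (l : R) :
  f n @[n --> \oo] --> l -> f n.+1 @[n --> \oo] --> l.
Proof. by move=> h; have := @cvg_shiftS R f (nbhs l) => ->. Qed.

Lemma cvg_sum_seq (R : realType) (J : Type) (s : seq J) (f : J -> nat -> R) (l : J -> R) :
  (forall j, f j n @[n --> \oo] --> l j) ->
  \sum_(j <- s) f j n @[n --> \oo] --> \sum_(j <- s) l j.
Proof.
move=> h; elim: s => [|j s IH].
  by rewrite big_nil; under eq_fun do rewrite big_nil; exact: cvg_cst.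
by rewrite big_cons; under eq_fun do rewrite big_cons; exact: cvgD.
Qed.

(** * Almost sure convergence of the cascade and the equation for its limit *)

Section cascade_limit.
Context (R : realType) (b : nat) (b0 : (0 < b)%N).
Local Notation T := (measurableTypeR R).
Local Notation I := (seq 'I_b : choiceType).
Local Notation U := (seqspace R I).
Variables (m : probability U R) (pm : prodlike m) (mu : probability T R).
Hypothesis marg : forall i (A : set T), measurable A -> m [set u | A (u i)] = mu A.

Definition casc (n : nat) (u : U) : T := @cascade R b U (fun w u => u w) n u.

Lemma casc0 u : casc 0 u = 1.
Proof.
rewrite /casc /cascade expr0 invr1 mul1r (big_pred1 [tuple]); first by rewrite big_ord0.
by move=> w; apply/esym/eqP; exact: tuple0.
Qed.

(** Words are split at the first letter, whereas the martingale property would split them at the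
    last: the next cascade is then a branch mean of the present one, and the increments inherit this
    form. *)
Lemma cascS n u : casc n.+1 u = branch_mean (casc n) u.
Proof.
rewrite /casc /cascade /branch_mean exprS invfM -mulrA; congr (_ * _).
rewrite mulr_sumr.
transitivity (\sum_(p : 'I_b * n.-tuple 'I_b)
   b%:R ^- n * \prod_(k < n.+1) u (take k.+1 (p.1 :: p.2))); last first.
  rewrite -(pair_bigA _ (fun j (w : n.-tuple 'I_b) =>
    b%:R ^- n * \prod_(k < n.+1) u (take k.+1 (j :: w)))) /=.
  apply: eq_bigr => j _; rewrite mulrCA mulr_sumr mulr_sumr.
  apply: eq_bigr => w _; rewrite big_ord_recl /= take0 mulrCA; congr (_ * (_ * _)).
pose h (p : 'I_b * n.-tuple 'I_b) : n.+1.-tuple 'I_b := [tuple of p.1 :: p.2].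
have hb : bijective h.
  exists (fun w => (thead w, [tuple of behead w])).
    by move=> [j w]; congr (_, _); exact: val_inj.
  by move=> w; rewrite /h /= -tuple_eta.
by rewrite (reindex h) //=; exact: onW_bij.
Qed.

Lemma casc_nonnil n : depends (@nonnil b) (casc n).
Proof.
move=> u; rewrite /casc /cascade; congr (_ * _); apply: eq_bigr => w _.
apply: eq_bigr => k _; rewrite /keep /nonnil inE.
by case: w => -[|x s] //= /eqP sn; move: k; rewrite -sn => -[].
Qed.

Lemma measurable_casc n : measurable_fun setT (casc n).
Proof.
elim: n => [|n IH].
  by rewrite (_ : casc 0 = fun=> 1)//; apply/funext => u; rewrite casc0.
rewrite (_ : casc n.+1 = branch_mean (casc n)); first exact: measurable_branch_mean.
by apply/funext => u; rewrite cascS.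
Qed.

Definition cdiff n u : T := casc n.+1 u - casc n u.

Lemma cdiff_nonnil n : depends (@nonnil b) (cdiff n).
Proof. by move=> u; rewrite /cdiff !casc_nonnil. Qed.

Lemma measurable_cdiff n : measurable_fun setT (cdiff n).
Proof. by apply: measurable_funB; exact: measurable_casc. Qed.

Lemma cdiffS n u : cdiff n.+1 u = branch_mean (cdiff n) u.
Proof.
rewrite /cdiff !cascS /branch_mean -mulrBr -sumrB; congr (_ * _).
by apply: eq_bigr => j _; rewrite -mulrBr cascS.
Qed.

Definition clim : U -> T := Lsup casc.

Lemma measurable_clim : measurable_fun setT clim.
Proof. by apply: measurable_Lsup => n; exact: measurable_casc. Qed.

Lemma clim_nonnil : depends (@nonnil b) clim.
Proof.
move=> u; rewrite /clim /Lsup; congr (fine (limn_esup _)).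
by apply/funext => n; rewrite casc_nonnil.
Qed.

Local Notation cl n := (law m (measurable_casc n)).
Local Notation dl n := (law m (measurable_cdiff n)).
Local Notation yl := (law m measurable_clim).

Lemma cl0 : eqlaw (cl 0) (\d_(1 : T)).
Proof.
move=> A mA; rewrite /= /dirac.
have [A1|A1] := pselect (A 1).
  rewrite indicE mem_set// [RHS]/=; apply: etrans (probability_setT m).
  by congr (m _); apply/seteqP; split => // u _; rewrite /= casc0.
rewrite indicE memNset//; apply: etrans (measure0 m).
by congr (m _); apply/seteqP; split => // u; rewrite /= casc0.
Qed.

Lemma clS n : eqlaw (cl n.+1) (Phi b mu (cl n)).
Proof.
apply: eqlaw_trans (branch_mean_law pm marg (measurable_casc n) (@casc_nonnil n)).
by apply: law_eqlaw => // u; rewrite cascS.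
Qed.

Lemma dlS n : eqlaw (dl n.+1) (Phi b mu (dl n)).
Proof.
apply: eqlaw_trans (branch_mean_law pm marg (measurable_cdiff n) (@cdiff_nonnil n)).
by apply: law_eqlaw => // u; rewrite cdiffS.
Qed.

Hypothesis mu_pos : on_Rplus mu.
Hypothesis mu2 : itg mu (fun x => `|x| ^+ 2).
Hypothesis mu_mean : Ex mu (fun x => x ^+ 1) = 1.
Let m2 : R := Ex mu (fun x => x ^+ 2).
Hypothesis m2b : m2 < b%:R.
Let B : R := b%:R.
Let B0 : 0 < B. Proof. by rewrite ltr0n. Qed.
Let mu1 : itg mu (fun x => `|x| ^+ 1). Proof. exact: itg_pow_le mu2. Qed.
Let m20 : 0 <= m2. Proof. by apply: Ex_ge0 => x; exact: sqr_ge0. Qed.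

Lemma cl_itg k n : itg mu (fun x => `|x| ^+ k) -> itg (cl n) (fun x => `|x| ^+ k).
Proof.
move=> i; elim: n => [|n IH].
  by apply: eqlaw_itg (eqlaw_sym cl0) _; exact: itg_dirac.
by apply: eqlaw_itg (eqlaw_sym (clS n)) _; exact: itg_Phi.
Qed.

Lemma cl_mean n : Ex (cl n) (fun x => x ^+ 1) = 1.
Proof.
elim: n => [|n IH]; first by rewrite (eqlaw_Ex _ cl0) Ex_dirac ?expr1n//; exact: measurable_pow.
by rewrite (eqlaw_Ex _ (clS n)) Phi_mean//; [rewrite mu_mean IH mulr1|exact: cl_itg].
Qed.

Lemma cl_sqrS n : Ex (cl n.+1) (fun x => x ^+ 2) =
  (m2 * Ex (cl n) (fun x => x ^+ 2) + (B - 1)) / B.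
Proof.
rewrite (eqlaw_Ex _ (clS n)) Phi_sqr//; last exact: cl_itg.
by rewrite mu_mean cl_mean !mulr1 expr1n mulr1.
Qed.

Lemma linear_rec_bounded (z : nat -> R) (r c : R) : 0 <= r < 1 ->
  (forall n, z n.+1 <= r * z n + c) -> forall n, z n <= Num.max (z 0%N) (c / (1 - r)).
Proof.
move=> /andP[r0 r1] h; set K := Num.max _ _.
have Kc : c <= (1 - r) * K.
  by rewrite mulrC -ler_pdivrMr ?subr_gt0// le_max lexx orbT.
elim=> [|n IH]; first by rewrite le_max lexx.
apply: (le_trans (h n)); have := ler_wpM2l r0 IH; lra.
Qed.

Lemma cl_sqr_bounded : exists K, forall n, Ex (cl n) (fun x => x ^+ 2) <= K.
Proof.
eexists; apply: (@linear_rec_bounded _ (m2 / B) ((B - 1) / B)).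
  by rewrite divr_ge0 ?(ltW B0)//= ltr_pdivrMr// mul1r.
by move=> n; rewrite cl_sqrS mulrDl mulrAC.
Qed.

(** In [Phi_cube] the next third moment is affine in the present one, with slope
    [Ex mu (x^3) / B^2 < 1]; the second moments in the other terms are already bounded. *)
Lemma cl_cube_bounded : itg mu (fun x => `|x| ^+ 3) ->
  Ex mu (fun x => x ^+ 3) < B ^+ 2 -> 0 <= Ex mu (fun x => x ^+ 3) ->
  exists K, forall n, Ex (cl n) (fun x => x ^+ 3) <= K.
Proof.
move=> i3 h3 h30; have [K hK] := cl_sqr_bounded.
have b1 : 1 <= B by rewrite ler1n.
eexists; apply: (@linear_rec_bounded _ (Ex mu (fun x => x ^+ 3) / B ^+ 2)
   ((3 * (B - 1) * (m2 * K) + (B - 1) * (B - 2)) / B ^+ 2)).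
  by rewrite divr_ge0 ?exprn_ge0 ?(ltW B0)//= ltr_pdivrMr ?exprn_gt0// mul1r.
move=> n; rewrite (eqlaw_Ex _ (clS n)) Phi_cube//; last exact: cl_itg.
rewrite mu_mean cl_mean !mulr1 expr1n mulr1 -/m2 -/B.
set m3 := Ex mu _; set z := Ex (cl n) (fun x => x ^+ 3).
have -> : m3 / B ^+ 2 * z + (3 * (B - 1) * (m2 * K) + (B - 1) * (B - 2)) / B ^+ 2 =
  (m3 * z + (3 * (B - 1) * (m2 * K) + (B - 1) * (B - 2))) / B ^+ 2 by ring.
rewrite ler_pM2r ?invr_gt0 ?exprn_gt0// -addrA lerD2l lerD2r.
by rewrite ler_wpM2l ?ler_wpM2l// mulr_ge0// subr_ge0.
Qed.

Lemma dl_itg n : itg (dl n) (fun x => `|x| ^+ 2).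
Proof.
elim: n => [|n IH]; last by apply: eqlaw_itg (eqlaw_sym (dlS n)) _; exact: itg_Phi.
apply/itg_law; first exact: measurable_normpow.
have h k := (itg_law _ (measurable_casc k) (@measurable_normpow R 2)).1 (cl_itg k mu2).
apply: (@itg_le _ _ _ _ _ (fun u => 2 * (`|casc 1 u| ^+ 2 + `|casc 0 u| ^+ 2))).
- exact: measurableT_comp (@measurable_normpow R 2) (measurable_cdiff 0).
- by apply: itgZ; apply: itgD; exact: h.
- move=> u; rewrite ger0_norm ?exprn_ge0// !real_normK ?num_real// /cdiff.
  by have := sqr_ge0 (casc 1 u + casc 0 u); lra.
Qed.

Lemma dl_mean n : Ex (dl n) (fun x => x ^+ 1) = 0.
Proof.
have h k := (itg_law _ (measurable_casc k) (@measurable_pow R 1)).1 (itg_norm_pow (cl_itg k mu1)).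
have hc k : Ex m (fun u => casc k u ^+ 1) = 1 by rewrite -(cl_mean k) Ex_law.
have i := (itg_law _ (measurable_cdiff n) (@measurable_pow R 1)).1 (itg_norm_pow (itg_pow_le (isT : 1 <= 2)%N (dl_itg n))).
rewrite Ex_law// (_ : (fun x => _) = (fun u => casc n.+1 u ^+ 1 - casc n u ^+ 1))//.
by rewrite ExB// !hc subrr.
Qed.

(** The increments are centred, so the cross terms of [Phi_sqr] vanish and the factor [m2 / B],
    below 1, remains. *)
Lemma dl_sqr n : Ex (dl n) (fun x => x ^+ 2) = Ex (dl 0) (fun x => x ^+ 2) * (m2 / B) ^+ n.
Proof.
elim: n => [|n IH]; first by rewrite expr0 mulr1.
rewrite (eqlaw_Ex _ (dlS n)) Phi_sqr//; last exact: dl_itg.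
by rewrite dl_mean mulr0 expr0n /= mulr0 addr0 IH exprSr -/m2 -/B; ring.
Qed.

Lemma casc_sum n u : casc n u = 1 + \sum_(0 <= k < n) cdiff k u.
Proof. by rewrite telescope_sumr// casc0 addrCA subrr addr0. Qed.

(** Jensen's inequality turns the geometric L2 decay of the increments into L1 decay. The dominating
    function will give convergence of the means as well. *)
Lemma casc_cvg_ae : exists2 g : U -> R, itg m g & {ae m, forall u,
   (forall n, `|casc n u| <= g u) /\ casc n u @[n --> \oo] --> clim u}.
Proof.
pose q := Num.sqrt (m2 / B).
have q0 : 0 <= m2 / B by rewrite divr_ge0 ?(ltW B0).
have q1 : 0 <= q < 1.
  by rewrite sqrtr_ge0/= -sqrtr1 ltr_sqrt ?ltr01// ltr_pdivrMr// mul1r.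
pose a := Num.sqrt (Ex (dl 0) (fun x => x ^+ 2)).
have d2 n : itg m (fun u => `|cdiff n u| ^+ 2).
  exact: (itg_law _ (measurable_cdiff n) (@measurable_normpow R 2)).1 (dl_itg n).
have d1 n : itg m (fun u => `|cdiff n u| ^+ 1).
  exact: (itg_law _ (measurable_cdiff n) (@measurable_normpow R 1)).1 (itg_pow_le _ (dl_itg n)).
have [n|n|g ig hg] := @summable_ae _ U R m cdiff a q q1.
- apply: itg_le (d1 n) _; first exact: measurable_cdiff.
  by move=> u; rewrite expr1.
- have : Ex m (fun x => `|cdiff n x|) ^+ 2 <= Ex m (fun u => `|cdiff n u| ^+ 2).
    by apply: sqr_Ex_le => //; exact: d1.
  have -> : Ex m (fun u => `|cdiff n u| ^+ 2) = Ex (dl n) (fun x => x ^+ 2).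
    have i := (itg_law _ (measurable_cdiff n) (@measurable_pow R 2)).1 (itg_norm_pow (dl_itg n)).
    rewrite Ex_law//.
    by congr Ex; apply/funext => u; rewrite real_normK ?num_real.
  have aq0 : 0 <= a * q ^+ n by rewrite mulr_ge0 ?exprn_ge0 ?sqrtr_ge0.
  rewrite dl_sqr => h; rewrite -(@ler_pXn2r _ 2) ?nnegrE ?Ex_ge0//.
  apply: (le_trans h); rewrite [leRHS]exprMn [q ^+ n ^+ 2]exprAC [q ^+ 2]sqr_sqrtr// [a ^+ 2]sqr_sqrtr//.
  by apply: Ex_ge0 => x; exact: sqr_ge0.
exists (fun u => 1 + g u); first by apply: itgD => //; exact: itg_cst.
apply: filterS hg => u [hb hc]; split => [n|].
  by rewrite casc_sum (le_trans (ler_normD _ _))// normr1 lerD2l.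
move/cvg_ex : hc => [l hl].
have h : casc n u @[n --> \oo] --> 1 + l.
  rewrite (_ : (fun n => casc n u) = (fun n => 1 + \sum_(0 <= k < n) cdiff k u)).
    by apply: cvgD => //; exact: cvg_cst.
  by apply/funext => n; rewrite casc_sum.
by rewrite /clim (Lsup_cvg h).
Qed.

Lemma ae_subtree j (P : U -> Prop) : {ae m, forall u, P u} ->
  {ae m, forall u, P (subtree j u)}.
Proof.
move=> [N [mN N0 PN]]; exists (subtree j @^-1` N); split.
- exact: (measurable_preimage (measurable_subtree j) mN).
- by apply: etrans N0; exact: (subtree_law pm marg j mN).
- by move=> u /= Pu; exact: PN.
Qed.

(** Pass to the limit in [cascS] on the almost sure event that the cascades of the whole tree and of
    its [b] subtrees all converge. *)
Lemma clim_fix : eqlaw yl (Phi b mu yl).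
Proof.
apply: eqlaw_trans (branch_mean_law pm marg measurable_clim clim_nonnil).
apply: ae_eqlaw.
have [g _ h] := casc_cvg_ae.
have h1 : {ae m, forall u, casc n u @[n --> \oo] --> clim u}.
  by apply: filterS h => u [].
have h2 : {ae m, forall u, forall j, casc n (subtree j u) @[n --> \oo] --> clim (subtree j u)}.
  apply: filter_forall => j; exact: (ae_subtree j h1).
apply: filterS2 h1 h2 => u cu cs.
have c1 : casc n.+1 u @[n --> \oo] --> clim u by exact: (@cvgS R (casc ^~ u)).
have c2 : casc n.+1 u @[n --> \oo] --> branch_mean clim u.
  rewrite (_ : (fun n => _) = (fun n => branch_mean (casc n) u)); last first.
    by apply/funext => n; rewrite cascS.
  rewrite /branch_mean; apply: cvgM; first exact: cvg_cst.
  apply: cvg_sum_seq => j; apply: cvgM; first exact: cvg_cst.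
  exact: cs.
exact: (cvg_unique _ c1 c2).
Qed.

Lemma cl_pos n : on_Rplus (cl n).
Proof.
elim: n => [|n IH].
  rewrite /on_Rplus; apply: etrans (cl0 _) _ => //.
  by rewrite /= diracE mem_set//= in_itv/= andbT.
rewrite /on_Rplus; apply: etrans (clS _ _) _ => //.
exact: on_Rplus_Phi.
Qed.

Lemma casc_pos_ae : {ae m, forall u, forall n, 0 <= casc n u}.
Proof.
apply: ae_foralln => n; have [N [mN N0 PN]] := on_Rplus_ae (cl_pos n).
exists (casc n @^-1` N); split => //.
  exact: (measurable_preimage (measurable_casc n) mN).
by move=> u /= Pu; exact: PN.
Qed.

Lemma clim_pos : on_Rplus yl.
Proof.
have [g _ h] := casc_cvg_ae.
have h1 : {ae m, forall u, clim u = Num.max 0 (clim u)}.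
  apply: filterS2 h casc_pos_ae => u [_ cu] pu.
  apply/esym/max_idPr; apply: (cvgr_to_ge cu); exact: nearW.
have mmax : measurable_fun setT (fun u => Num.max 0 (clim u) : T).
  by apply: measurable_maxr => //; exact: measurable_clim.
rewrite /on_Rplus; apply: etrans (ae_eqlaw measurable_clim mmax h1 _) _ => //.
apply: etrans (probability_setT m); congr (m _); apply/seteqP; split => // u _ /=.
by rewrite in_itv/= andbT le_max lexx.
Qed.

Lemma clim_mean : Ex yl (fun x => x ^+ 1) = 1.
Proof.
have [g ig h] := casc_cvg_ae.
have [ic cc] := dominated_Ex measurable_casc measurable_clim ig h.
have e n : Ex m (casc n) = 1.
  rewrite -(cl_mean n) Ex_law//.
  exact: (itg_law _ (measurable_casc n) (@measurable_pow R 1)).1 (itg_norm_pow (cl_itg n mu1)).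
rewrite Ex_law//.
have c1 : Ex m (casc n) @[n --> \oo] --> (1 : R).
  by under eq_fun do rewrite e; exact: cvg_cst.
exact: (cvg_unique _ cc c1).
Qed.

Lemma clim_itg_of_bounded k K : itg mu (fun x => `|x| ^+ k) ->
  (forall n, Ex (cl n) (fun x => x ^+ k) <= K) -> itg yl (fun x => `|x| ^+ k).
Proof.
move=> ik hK; have [g ig h] := casc_cvg_ae.
have i n := (itg_law _ (measurable_casc n) (@measurable_normpow R k)).1 (cl_itg n ik).
have j n := (itg_law _ (measurable_casc n) (@measurable_pow R k)).1 (itg_norm_pow (cl_itg n ik)).
apply/itg_law; first exact: measurable_normpow.
apply: (@fatou_itg _ U R m (fun n u => `|casc n u| ^+ k) _ K) => //.
- move=> n; apply: le_trans (hK n); rewrite Ex_law// le_eqVlt; apply/orP; left; apply/eqP.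
  have H : {ae m, forall u, casc n u ^+ k = `|casc n u| ^+ k}.
    by apply: filterS casc_pos_ae => u pu; rewrite ger0_norm.
  by have [_ ->] := ae_eq_Ex (j n) (itg_meas (i n)) H.
- exact: measurableT_comp (measurable_normpow k) measurable_clim.
- apply: filterS h => u [_ cu].
  apply: (cvg_comp _ (fun x : R => x ^+ k)); first exact: cvg_norm cu.
  exact: exprn_continuous.
Qed.

Lemma clim_itg2 : itg yl (fun x => `|x| ^+ 2).
Proof. by have [K] := cl_sqr_bounded; exact: clim_itg_of_bounded. Qed.

Lemma clim_itg3 : itg mu (fun x => `|x| ^+ 3) ->
  Ex mu (fun x => x ^+ 3) < B ^+ 2 -> 0 <= Ex mu (fun x => x ^+ 3) ->
  itg yl (fun x => `|x| ^+ 3).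
Proof.
by move=> i h1 h2; have [K] := cl_cube_bounded i h1 h2; exact: clim_itg_of_bounded.
Qed.

End cascade_limit.

(** * Existence and properties of the transform *)

Section transform_spec.
Context (R : realType) (b : nat) (b0 : (0 < b)%N).
Local Notation T := (measurableTypeR R).
Variable mu : probability T R.
Hypothesis mu_pos : on_Rplus mu.
Hypothesis mu2 : itg mu (fun x => `|x| ^+ 2).
Hypothesis mu_mean : Ex mu (fun x => x ^+ 1) = 1.
Hypothesis m2b : Ex mu (fun x => x ^+ 2) < b%:R.

Lemma transform_exists : exists nu, is_transform b mu nu.
Proof.
have [m [pm marg]] := iid_exists (seq 'I_b : countType) mu.
have mW w : measurable_fun setT (fun u : seqspace R (seq 'I_b : choiceType) => u w : R).
  exact: measurable_coord.
have mY : measurable_fun setT (@clim R b : _ -> R) by exact: measurable_clim.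
pose W (w : seq 'I_b) : {RV m >-> R} := law_mfun (mW w).
pose Y : {RV m >-> R} := law_mfun mY.
exists (law m (@measurable_clim R b)), _, _, m, W, Y; split.
- by move=> J A mA; exact: (pm J A mA).
- by move=> w A mA; exact: (marg w A mA).
- have [g _ h] := casc_cvg_ae b0 pm marg mu2 mu_mean m2b.
  by apply: filterS h => u [_ cu].
- by [].
Qed.

Lemma is_transform_spec nu : is_transform b mu nu ->
  [/\ on_Rplus nu, itg nu (fun x => `|x| ^+ 2), Ex nu (fun x => x ^+ 1) = 1,
     eqlaw nu (Phi b mu nu) &
     itg mu (fun x => `|x| ^+ 3) -> Ex mu (fun x => x ^+ 3) < b%:R ^+ 2 ->
     0 <= Ex mu (fun x => x ^+ 3) -> itg nu (fun x => `|x| ^+ 3)].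
Proof.
move=> [d [Om [P [W [Y [indep lawW cvgY lawY]]]]]].
pose vec (om : Om) : seqspace R (seq 'I_b : choiceType) := fun w => W w om.
have mvec : measurable_fun setT vec.
  by apply: measurable_into_seqspace => w; exact: (measurable_funPT (W w)).
pose m := law P mvec.
have pm : prodlike m by move=> S A mA; exact: (indep S A mA).
have marg i (A : set T) : measurable A -> m [set u | A (u i)] = mu A.
  by move=> mA; exact: (lawW i A mA).
pose yl := law m (@measurable_clim R b).
have e : eqlaw nu yl.
  have mY : measurable_fun setT (Y : Om -> T) by exact: (measurable_funPT Y).
  have mc : measurable_fun setT (@clim R b \o vec : Om -> T).
    exact: (measurableT_comp (@measurable_clim R b) mvec).
  apply: (@eqlaw_trans _ _ _ _ (law P mY)); first by move=> A mA; rewrite -lawY.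
  apply: (@eqlaw_trans _ _ _ _ (law P mc)); last exact: law_comp.
  apply: ae_eqlaw; apply: filterS cvgY => om c.
  by apply/esym; exact: (Lsup_cvg c).
have yfix := clim_fix b0 pm marg mu2 mu_mean m2b.
have ypos := clim_pos b0 pm marg mu_pos mu2 mu_mean m2b.
have ymean := clim_mean b0 pm marg mu2 mu_mean m2b.
have y2 := clim_itg2 b0 pm marg mu_pos mu2 mu_mean m2b.
have y3 := clim_itg3 b0 pm marg mu_pos mu2 mu_mean m2b.
split.
- by rewrite /on_Rplus e.
- exact: eqlaw_itg (eqlaw_sym e) y2.
- by rewrite (eqlaw_Ex _ e).
- apply: (eqlaw_trans e); apply: (eqlaw_trans yfix); apply: Phi_eqlaw => //.
  exact: eqlaw_sym.
- by move=> h1 h2 h3; apply: eqlaw_itg (eqlaw_sym e) (y3 h1 h2 h3).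
Qed.

Lemma transform_spec : let nu := transform b mu in
  [/\ on_Rplus nu, itg nu (fun x => `|x| ^+ 2), Ex nu (fun x => x ^+ 1) = 1,
     eqlaw nu (Phi b mu nu) &
     itg mu (fun x => `|x| ^+ 3) -> Ex mu (fun x => x ^+ 3) < b%:R ^+ 2 ->
     0 <= Ex mu (fun x => x ^+ 3) -> itg nu (fun x => `|x| ^+ 3)].
Proof.
apply: is_transform_spec; rewrite /transform.
by have [nu hnu] := transform_exists; exact: (xgetPex mu (ex_intro _ nu hnu)).
Qed.
End transform_spec.

(** * Variances along the orbit *)

Section variance.
Context (R : realType).
Local Notation T := (measurableTypeR R).
Local Notation prob := (probability T R).
Implicit Types m mu nu : prob.

Lemma moment_integral m (k : nat) : on_Rplus m ->
  moment k%:R m = (\int[m]_x (`|x| ^+ k)%:E)%E.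
Proof.
move=> mp; rewrite /moment integral_mkcond.
have mk : measurable_fun setT (fun x : T => (x `^ k%:R)%:E).
  by apply/measurable_EFinP; exact: measurable_powR.
apply: ae_eq_integral => //.
- apply/(measurable_restrictT _ _).1 => //; exact: measurable_funTS.
- by apply/measurable_EFinP; exact: measurable_normpow.
- have [N [mN N0 hN]] := on_Rplus_ae mp; exists N; split => //.
  move=> x /= h; apply: hN => /= x0; apply: h => _.
  rewrite patchE mem_set; last by rewrite /= in_itv/= x0.
  by rewrite powR_mulrn// ger0_norm.
Qed.

Lemma moment_itg m (k : nat) : on_Rplus m -> (moment k%:R m < +oo)%E ->
  itg m (fun x => `|x| ^+ k) /\ moment k%:R m = (Ex m (fun x => x ^+ k))%:E.
Proof.
move=> mp; rewrite (moment_integral k mp) => h.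
have i : itg m (fun x => `|x| ^+ k).
  by apply: itg_ge0P => //; exact: measurable_normpow.
split => //; rewrite -EFin_Ex//; congr EFin.
apply: (ae_eq_Ex _ _ _).2 => //; first exact: itg_norm_pow.
have [N [mN N0 hN]] := on_Rplus_ae mp; exists N; split => //.
by move=> x /= hx; apply: hN => /= x0; apply: hx; rewrite ger0_norm.
Qed.

Definition var1 m : R := Ex m (fun x => (x - 1) ^+ 2).

Lemma sigma_var1 m : sigma m = Num.sqrt (var1 m).
Proof. by []. Qed.

(** [Pb] in terms of real expectations: with mean 1, the bounds on the second moment are those on
    the variance shifted by 1. This is the invariant carried along the orbit. *)
Definition good (b : nat) m := [/\ on_Rplus m, itg m (fun x => `|x| ^+ 2),
  Ex m (fun x => x ^+ 1) = 1 & 0 < var1 m < b%:R - 2].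

Lemma itg_sub1_pow m k : itg m (fun x => `|x| ^+ k) -> itg m (fun x => (x - 1) ^+ k).
Proof.
move=> i; apply: (itg_le _ (itg_dist 1 (leqnn k) i)) => [|x]; last by rewrite normrX.
apply: (measurableT_comp (measurable_pow k)); exact: measurable_funB.
Qed.

Lemma var1E m : itg m (fun x => `|x| ^+ 2) -> Ex m (fun x => x ^+ 1) = 1 ->
  var1 m = Ex m (fun x => x ^+ 2) - 1.
Proof.
move=> i h1; have i1 : itg m (fun x => x ^+ 1) by exact: itg_pow i.
have i2 : itg m (fun x => x ^+ 2) by exact: itg_pow i.
rewrite /var1 (_ : (fun x => _) = (fun x : T => x ^+ 2 - 2 * x ^+ 1 + 1)).
  rewrite ExD; [|by apply: itgB => //; exact: itgZ|exact: itg_cst].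
  by rewrite ExB// ?ExZ// ?h1 ?Ex_cst; [lra|exact: itgZ].
by apply/funext => x; ring.
Qed.

Lemma good_Pb b m : Pb b m -> good b m.
Proof.
move=> [mp m1 /andP[m2l m2u]].
have [i1 e1] : itg m (fun x => `|x| ^+ 1) /\ moment 1%:R m = (Ex m (fun x => x ^+ 1))%:E.
  by apply: moment_itg => //; rewrite m1 ltry.
have [i2 e2] : itg m (fun x => `|x| ^+ 2) /\ moment 2%:R m = (Ex m (fun x => x ^+ 2))%:E.
  by apply: moment_itg => //; exact: lt_trans m2u (ltry _).
have h1 : Ex m (fun x => x ^+ 1) = 1 by apply: EFin_inj; rewrite -e1.
split => //; rewrite var1E//; move: m2l m2u; rewrite e2 !lte_fin => *.
by apply/andP; split; lra.
Qed.

Variables (b : nat) (hb : (3 <= b)%N).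
Let B : R := b%:R.
Let B3 : 3 <= B. Proof. by rewrite ler_nat. Qed.
Let b0 : (0 < b)%N. Proof. by case: b hb. Qed.

(** With both means equal to 1, [Phi_sqr] reads [m2' * B = m2 * m2' + (B - 1)]; subtracting 1 from
    each second moment gives the relation between the variances. *)
Lemma good_transform m : good b m -> let nu := transform b m in
  [/\ good b nu, eqlaw nu (Phi b m nu), var1 nu * (B - 1 - var1 m) = var1 m &
     itg m (fun x => `|x| ^+ 3) -> Ex m (fun x => x ^+ 3) < B ^+ 2 ->
     0 <= Ex m (fun x => x ^+ 3) -> itg nu (fun x => `|x| ^+ 3)].
Proof.
move=> [mp i2 h1 /andP[v0 vu]] nu.
have ve := var1E i2 h1.
have m2b : Ex m (fun x => x ^+ 2) < B by rewrite -/B in vu *; lra.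
have [np j2 g1 fx g3] := transform_spec b0 mp i2 h1 m2b.
have we := var1E j2 g1.
have e : var1 nu * (B - 1 - var1 m) = var1 m.
  have := Phi_sqr b0 i2 j2; rewrite -(eqlaw_Ex _ fx) h1 g1 !mulr1 expr1n mulr1 -/B -/nu.
  move=> e; have {}e : Ex nu (fun x => x ^+ 2) * B =
    Ex m (fun x => x ^+ 2) * Ex nu (fun x => x ^+ 2) + (B - 1).
    by rewrite {1}e mulfVK// gt_eqF// ltr0n.
  by rewrite ve we; lra.
split => //; split => //.
have w : 0 < B - 1 - var1 m by rewrite -/B in vu; lra.
have w0 : B - 1 - var1 m != 0 by rewrite gt_eqF.
have -> : var1 nu = var1 m / (B - 1 - var1 m) by apply: (mulIf w0); rewrite e divfK.
rewrite divr_gt0//= ltr_pdivrMr//.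
rewrite -/B in vu *.
(* Cleared of denominators, the bound [var1 nu < B - 2] becomes
   [var1 m * (B - 1) < (B - 2) * (B - 1)]. *)
have := mulr_gt0 (_ : 0 < B - 2 - var1 m) (_ : 0 < B - 1); nra.
Qed.

Variables (mu : prob) (mu_good : good b mu).
Definition orbitT n : prob := iter n (@transform R b) mu.

Lemma orbit_good n : good b (orbitT n).
Proof. by elim: n => [//|n IH]; have [] := good_transform IH. Qed.

Let V n := var1 (orbitT n).

Lemma orbit_var_gt0 n : 0 < V n.
Proof. by have [_ _ _ /andP[]] := orbit_good n. Qed.

Lemma orbit_var_lt n : V n < B - 2.
Proof. by have [_ _ _ /andP[]] := orbit_good n. Qed.

Lemma orbit_varS n : V n.+1 * (B - 1 - V n) = V n.
Proof. by have [] := good_transform (orbit_good n). Qed.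

(** The inverse variance obeys [y' = (B - 1) * y - 1], whose fixed point is [(B - 2)^-1]. *)
Lemma orbit_varE n : (V n)^-1 = (B - 1) ^+ n * ((V 0)^-1 - (B - 2)^-1) + (B - 2)^-1.
Proof.
elim: n => [|n IH]; first by rewrite expr0; ring.
have v0 := orbit_var_gt0 n; have v1 := orbit_var_gt0 n.+1.
have e : (V n.+1)^-1 = (B - 1) / V n - 1.
  have h := orbit_varS n.
  apply/eqP; rewrite -subr_eq0.
  have -> : (V n.+1)^-1 - ((B - 1) / V n - 1) =
      (V n - V n.+1 * (B - 1 - V n)) / (V n * V n.+1).
    by field; rewrite !gt_eqF.
  by rewrite h subrr mul0r.
have k1 : (B - 2) * (B - 2)^-1 = 1 by rewrite divff// gt_eqF//; have := B3; lra.
rewrite e IH.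
have -> : (B - 1) * ((B - 1) ^+ n * ((V 0)^-1 - (B - 2)^-1) + (B - 2)^-1) - 1 =
  (B - 1) ^+ n.+1 * ((V 0)^-1 - (B - 2)^-1) + (B - 2)^-1 + ((B - 2) * (B - 2)^-1 - 1).
  by rewrite exprS; ring.
by rewrite k1 subrr addr0.
Qed.

(** Inverse of the initial gap between [(V 0)^-1] and the fixed point [(B - 2)^-1]. The gap grows
    exactly by the factor [B - 1] at each step, and it is positive because [V 0 < B - 2]. *)
Definition var_lim : R := ((V 0)^-1 - (B - 2)^-1)^-1.

Lemma var_lim_gt0 : 0 < var_lim.
Proof.
have := orbit_var_lt 0; have := orbit_var_gt0 0; have := B3 => *.
by rewrite invr_gt0 subr_gt0 ltf_pV2// posrE; lra.
Qed.

Lemma geom_cvg0 : (B - 1)^-1 ^+ n @[n --> \oo] --> (0 : R).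
Proof.
by apply: cvg_expr; have := B3 => *; rewrite ger0_norm ?invr_ge0 ?invf_lt1//; lra.
Qed.

Lemma orbit_var_cvg : (B - 1) ^+ n * V n @[n --> \oo] --> var_lim.
Proof.
have A0 : (V 0)^-1 - (B - 2)^-1 != 0 by rewrite -invr_eq0 gt_eqF// var_lim_gt0.
have e n : (B - 1) ^+ n * V n =
  (((V 0)^-1 - (B - 2)^-1) + (B - 1)^-1 ^+ n * (B - 2)^-1)^-1.
  have B1 : (B - 1) ^+ n != 0 by rewrite expf_neq0// gt_eqF//; have := B3; lra.
  rewrite -[V n]invrK orbit_varE -[X in X * _]invrK -invfM; congr (_^-1).
  by rewrite mulrDr mulKf// exprVn.
have h : ((V 0)^-1 - (B - 2)^-1) + (B - 1)^-1 ^+ n * (B - 2)^-1 @[n --> \oo] -->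
    ((V 0)^-1 - (B - 2)^-1) + 0 * (B - 2)^-1.
  apply: cvgD; first exact: cvg_cst.
  by apply: cvgM; [exact: geom_cvg0|exact: cvg_cst].
rewrite mul0r addr0 in h.
by under eq_fun do rewrite e; exact: cvgV.
Qed.

Lemma orbit_var_cvg0 : V n @[n --> \oo] --> (0 : R).
Proof.
have e n : V n = (B - 1)^-1 ^+ n * ((B - 1) ^+ n * V n).
  by rewrite exprVn mulKf// expf_neq0// gt_eqF//; have := B3; lra.
have h : (B - 1)^-1 ^+ n * ((B - 1) ^+ n * V n) @[n --> \oo] --> 0 * var_lim.
  by apply: cvgM; [exact: geom_cvg0|exact: orbit_var_cvg].
by under eq_fun do rewrite e; rewrite mul0r in h.
Qed.

Definition sd n : R := Num.sqrt (V n).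

Lemma sd_gt0 n : 0 < sd n.
Proof. by rewrite sqrtr_gt0 orbit_var_gt0. Qed.

Lemma sd_sqr n : sd n ^+ 2 = V n.
Proof. by rewrite sqr_sqrtr// ltW// orbit_var_gt0. Qed.

Lemma sd_cvg0 : sd n @[n --> \oo] --> (0 : R).
Proof.
rewrite -[X in _ --> X]sqrtr0; apply: (cvg_comp _ _ orbit_var_cvg0).
exact: sqrt_continuous.
Qed.

Lemma sigma_cvg : (B - 1) `^ (n%:R / 2) * sigma (orbitT n) @[n --> \oo] --> Num.sqrt var_lim.
Proof.
have e n : (B - 1) `^ (n%:R / 2) * sigma (orbitT n) = Num.sqrt ((B - 1) ^+ n * V n).
  have B1 : 0 <= B - 1 by have := B3; lra.
  rewrite sqrtrM ?exprn_ge0// sigma_var1; congr (_ * _).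
  by rewrite powRrM powR_mulrn// powR12_sqrt// exprn_ge0.
under eq_fun do rewrite e.
apply: (cvg_comp _ (fun x : R => Num.sqrt x)); first exact: orbit_var_cvg.
exact: sqrt_continuous.
Qed.

Lemma bounded_fun_gt0 (f : R -> R) : bounded_fun f -> exists2 M, 0 < M & forall x, `|f x| <= M.
Proof.
move=> [M [_ hM]]; exists (Num.max (M + 1) 1); first by rewrite lt_max ltr01 orbT.
by move=> x; apply: hM => //; rewrite lt_max ltrDl ltr01.
Qed.

(** Chebyshev in integrated form: [|f 1 - f x| <= e / 2 + (2 * M / d^2) * (x - 1)^2] for all [x], by
    continuity at 1 when [|1 - x| < d] and by boundedness otherwise. *)
Lemma orbit_weak (f : R -> R) : continuous f -> bounded_fun f ->
  Ex (orbitT n) f @[n --> \oo] --> f 1.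
Proof.
move=> cf /bounded_fun_gt0[M M0 fM].
have mf : measurable_fun setT (f : T -> R) by exact: continuous_measurable_fun.
apply/cvgrPdist_le => e e0.
have e2 : 0 < e / 2 by rewrite divr_gt0.
have /cvgrPdist_le /(_ _ e2) [d /= d0 hd] := cf (1 : R).
(* [C] is the variance for which the quadratic term contributes exactly [e / 2]. *)
have [_/posnumP[C] hC] : exists2 C : R, 0 < C & C * (2 * M) = d ^+ 2 * (e / 2).
  by exists (d ^+ 2 * (e / 2) / (2 * M)); [rewrite divr_gt0 ?mulr_gt0 ?exprn_gt0|rewrite divfK// gt_eqF// mulr_gt0].
have /cvgrPdist_le /(_ _ (gt0 C)) := orbit_var_cvg0.
apply: filterS => n; rewrite sub0r normrN ger0_norm ?(ltW (orbit_var_gt0 n))// => Vn.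
have [_ i2 _ _] := orbit_good n.
have i := itg_sub1_pow i2.
have fi : itg (orbitT n) f by exact: (itg_bounded _ mf fM).
rewrite -{1}(Ex_cst (orbitT n) (f 1)) -ExB//; last exact: itg_cst.
apply: le_trans (Ex_norm_le _) _; first by apply: itgB => //; exact: itg_cst.
apply: (@le_trans _ _ (Ex (orbitT n) (fun x => e / 2 + (2 * M / d ^+ 2) * (x - 1) ^+ 2))).
  apply: Ex_le.
  - by apply: itg_norm; apply: itgB => //; exact: itg_cst.
  - by apply: itgD; [exact: itg_cst|exact: itgZ].
  - move=> x; have [xd|xd] := ltP `|1 - x| d.
      by rewrite (le_trans (hd x xd))// lerDl mulr_ge0 ?sqr_ge0// divr_ge0 ?exprn_ge0 ?mulr_ge0// ltW.
    have hM : `|f 1 - f x| <= 2 * M.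
      by rewrite (le_trans (ler_normB _ _))// mulr2n mulrDl mul1r lerD.
    rewrite (le_trans hM)// -[leLHS]add0r lerD ?(ltW e2)//.
    rewrite mulrAC ler_pdivlMr ?exprn_gt0// ler_wpM2l ?mulr_ge0 ?(ltW M0)//.
    by rewrite -[(x - 1) ^+ 2]sqrrN opprB -[leRHS]real_normK ?num_real// ler_pXn2r ?nnegrE ?(ltW d0).
rewrite ExD; [|exact: itg_cst|exact: itgZ].
rewrite Ex_cst ExZ//.
rewrite [leRHS](splitr e) lerD2l mulrAC ler_pdivrMr ?exprn_gt0//.
by rewrite [leRHS]mulrC -hC mulrC ler_wpM2r// mulr_ge0// ltW.
Qed.

Lemma orbit_weak_cvg : weak_cvg orbitT (dirac (1 : T)).
Proof.
move=> f cf bf; have [M M0 fM] := bounded_fun_gt0 bf.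
have mf : measurable_fun setT (f : T -> R) by exact: continuous_measurable_fun.
have e n : (\int[orbitT n]_x (f x)%:E)%E = (Ex (orbitT n) f)%:E.
  by rewrite EFin_Ex//; exact: (itg_bounded _ mf fM).
under eq_fun do rewrite e.
rewrite integral_dirac//; last exact/measurable_EFinP.
rewrite diracT mul1e; apply: cvg_EFin; first exact: nearW.
exact: orbit_weak.
Qed.
End variance.

(** * Third moments *)

Section third_abs.
Context (R : realType).
Local Notation T := (measurableTypeR R).
Local Notation prob := (probability T R).
Implicit Types m mu nu : prob.

(** Dominated form of [Ex_pprod_pow]: for absolute values of centred sums and products the binomial
    is only an upper bound, by the triangle inequality. *)
Lemma Ex_law2_pow_le m1 m2 (phi : T * T -> T) (mphi : measurable_fun setT phi)
    (f u c v : T -> R) (k : nat) : measurable_fun setT f ->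
  (forall x, 0 <= f x) ->
  (forall j, (j <= k)%N -> itg m1 (fun x => u x ^+ (k - j) * c x ^+ j)) ->
  (forall j, (j <= k)%N -> itg m2 (fun y => v y ^+ j)) ->
  (forall x y, f (phi (x, y)) <= (u x + c x * v y) ^+ k) ->
  itg (law (pprod m1 m2) mphi) f /\ Ex (law (pprod m1 m2) mphi) f <=
  \sum_(j < k.+1) (Ex m1 (fun x => u x ^+ (k - j) * c x ^+ j) * Ex m2 (fun y => v y ^+ j)) *+ 'C(k, j).
Proof.
move=> mf f0 iu iv h; have [isum e] := Ex_pprod_pow iu iv.
have iphi : itg (pprod m1 m2) (fun z => f (phi z)).
  apply: itg_le isum _; first exact: measurableT_comp.
  by move=> [x y]; rewrite ger0_norm.
split; first by apply/itg_law.
by rewrite Ex_law// -e; apply: Ex_le => // -[x y].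
Qed.

Definition absm m (a : R) (j : nat) : R := Ex m (fun x => `|x - a| ^+ j).

Lemma absm_ge0 m a j : 0 <= absm m a j.
Proof. by apply: Ex_ge0 => x; rewrite exprn_ge0. Qed.

Lemma absm0 m a : absm m a 0 = 1.
Proof. by rewrite -[RHS](Ex_cst m 1). Qed.

Lemma absm_cpowS m k n l : itg m (fun x => `|x| ^+ k) -> (l <= k)%N ->
  absm (cpow m n.+1) n.+1%:R l <=
  \sum_(j < l.+1) (absm (cpow m n) n%:R (l - j) * absm m 1 j) *+ 'C(l, j).
Proof.
move=> i lk; have ic := itg_cpow n i.
have [||||_ h] := @Ex_law2_pow_le (cpow m n) m (fun z : T * T => z.1 + z.2 : T) (@measurable_add R)
   (fun x => `|x - n.+1%:R| ^+ l) (fun x => `|x - n%:R|) (fun=> 1) (fun y => `|y - 1|) l (measurable_dist_pow _ _).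
- by move=> x; rewrite exprn_ge0.
- move=> j jl; have := itg_dist n%:R (leq_trans (leq_subr j l) lk) ic; congr itg.
  by apply/funext => x; rewrite expr1n mulr1.
- by move=> j jl; exact: itg_dist (leq_trans jl lk) i.
- move=> x y /=; rewrite mul1r lerXn2r ?nnegrE ?addr_ge0//.
  by rewrite -natr1 opprD addrACA ler_normD.
apply: (le_trans h); apply: ler_sum => j _; rewrite le_eqVlt; apply/orP; left; apply/eqP.
congr (_ * _ *+ _); congr Ex; apply/funext => x; by rewrite expr1n mulr1.
Qed.

Section cpow_bounds.
Variables (m : prob) (tau : R).
Hypotheses (i3 : itg m (fun x => `|x| ^+ 3)) (tau0 : 0 <= tau).
Hypothesis tau2 : absm m 1 2 <= tau ^+ 2.

Lemma absm1_le : absm m 1 1 <= tau.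
Proof.
have i1 := itg_dist 1 (isT : 1 <= 3)%N i3; have i2 := itg_dist 1 (isT : 2 <= 3)%N i3.
rewrite -(@ler_pXn2r _ 2) ?nnegrE ?absm_ge0//.
by apply: le_trans tau2; exact: (sqr_Ex_le i1 i2).
Qed.

(** Only the coefficient [n] of the third moment has to be sharp: divided by [b^3] it becomes the
    [1 / b^2] of [absm_Phi3]. All the rest is of order [tau^3], and a crude constant is enough
    there. *)
Lemma cpow_absm n :
  [/\ absm (cpow m n) n%:R 1 <= n%:R * tau,
      absm (cpow m n) n%:R 2 <= n%:R ^+ 2 * tau ^+ 2 &
      absm (cpow m n) n%:R 3 <= n%:R * absm m 1 3 + n%:R ^+ 3 * tau ^+ 3].
Proof.
elim: n => [|n [h1 h2 h3]].
  by split; rewrite /= /absm Ex_dirac ?subrr ?normr0 ?expr0n ?mul0r ?add0r//; exact: measurable_dist_pow.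
have d1 := absm1_le.
have n0 : 0 <= n%:R :> R by [].
have k1 := absm_cpowS n i3 (isT : 1 <= 3)%N.
have k2 := absm_cpowS n i3 (isT : 2 <= 3)%N.
have k3 := absm_cpowS n i3 (isT : 3 <= 3)%N.
rewrite !big_ord_recr big_ord0 /= !absm0 ?binn ?bin0 ?bin1 in k1.
rewrite !big_ord_recr big_ord0 /= !absm0 ?binn ?bin0 ?bin1 in k2.
rewrite !big_ord_recr big_ord0 /= !absm0 ?binn ?bin0 ?bin1 (_ : 'C(3, 2) = 3)%N// in k3.
rewrite ?subSS ?subn0 in k1 k2 k3.
have p11 := ler_pM (absm_ge0 _ _ _) (absm_ge0 _ _ _) h1 d1.
have p21 := ler_pM (absm_ge0 _ _ _) (absm_ge0 _ _ _) h2 d1.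
have p12 := ler_pM (absm_ge0 _ _ _) (absm_ge0 _ _ _) h1 tau2.
split.
- apply: (le_trans k1); rewrite -natr1; lra.
- apply: (le_trans k2); rewrite -natr1; have := tau2; lra.
- apply: (le_trans k3); rewrite -natr1.
  have := mulr_ge0 n0 (exprn_ge0 3 tau0); have := exprn_ge0 3 tau0; lra.
Qed.
End cpow_bounds.

Section Phi_third.
Variables (b : nat) (mu nu : prob).
Hypotheses (b0 : (0 < b)%N).
Let B : R := b%:R.
Let B0 : 0 < B. Proof. by rewrite ltr0n. Qed.
Hypotheses (i3 : itg mu (fun x => `|x| ^+ 3)) (j3 : itg nu (fun x => `|x| ^+ 3)).

Lemma absm_Phi3 (tau : R) : 0 <= tau -> absm (mulc mu nu) 1 2 <= tau ^+ 2 ->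
  absm (Phi b mu nu) 1 3 <= absm (mulc mu nu) 1 3 / B ^+ 2 + tau ^+ 3.
Proof.
move=> t0 ht; have k3 := itg_mulc i3 j3.
have [_ _ h] := cpow_absm k3 t0 ht b.
have e x : `|B^-1 * x - 1| ^+ 3 = B^-1 ^+ 3 * `|x - B| ^+ 3.
  rewrite -exprMn -[X in X * `|_|](ger0_norm (_ : 0 <= B^-1)) ?invr_ge0 ?(ltW B0)// -normrM mulrBr mulVf ?gt_eqF//.
have ic := itg_dist B (isT : 3 <= 3)%N (itg_cpow b k3).
have e2 : absm (Phi b mu nu) 1 3 = B^-1 ^+ 3 * absm (cpow (mulc mu nu) b) B 3.
  rewrite /absm Ex_law; [|by under eq_fun do rewrite e; exact: itgZ|exact: measurable_dist_pow].
  by under eq_fun do rewrite e; rewrite ExZ.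
rewrite e2; apply: (le_trans (ler_wpM2l _ h)); first by rewrite exprn_ge0// invr_ge0 ltW.
rewrite -/B le_eqVlt; apply/orP; left; apply/eqP; field.
by rewrite gt_eqF.
Qed.

(** Expand [x * y - 1 = (x - 1) + x * (y - 1)] and replace [|x|] by [|x - 1| + 1] in the mixed
    terms. The pure term keeps the factor [M] in front of the third moment of [nu], so that it can
    be moved to the left side of the recursion. *)
Lemma absm_mulc3 (sg s' M : R) : 0 <= s' -> absm nu 1 2 <= s' ^+ 2 -> absm mu 1 2 <= sg ^+ 2 -> 0 <= sg ->
  Ex mu (fun x => `|x| ^+ 3) <= M ->
  absm (mulc mu nu) 1 3 <= absm mu 1 3 * (1 + 3 * s' + 3 * s' ^+ 2) +
    3 * sg ^+ 2 * s' + 6 * sg ^+ 2 * s' ^+ 2 + 3 * sg * s' ^+ 2 + M * absm nu 1 3.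
Proof.
move=> s0 hs hg g0 hM.
have [i1 i2] := (itg_dist 1 (isT : 1 <= 3)%N i3, itg_dist 1 (isT : 2 <= 3)%N i3).
have i33 := itg_dist 1 (isT : 3 <= 3)%N i3.
have n1 x : `|x : R| <= `|x - 1| + 1 by rewrite -{1}(subrK 1 x) (le_trans (ler_normD _ _))// normr1.
have q1 x : `|x - 1| ^+ 2 * `|x : R| ^+ 1 <= `|x - 1| ^+ 3 + `|x - 1| ^+ 2.
  have := ler_wpM2l (exprn_ge0 2 (normr_ge0 (x - 1))) (n1 x); rewrite expr1; lra.
have q2 x : `|x - 1| ^+ 1 * `|x : R| ^+ 2 <= `|x - 1| ^+ 3 + 2 * `|x - 1| ^+ 2 + `|x - 1| ^+ 1.
  have h : `|x : R| ^+ 2 <= (`|x - 1| + 1) ^+ 2 by rewrite lerXn2r ?nnegrE ?addr_ge0.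
  have := ler_wpM2l (normr_ge0 (x - 1)) h; rewrite expr1; lra.
have mm j k : measurable_fun setT (fun x : T => `|x - 1| ^+ j * `|x| ^+ k : R).
  by apply: measurable_funM; [exact: measurable_dist_pow|exact: measurable_normpow].
have I1 : itg mu (fun x => `|x - 1| ^+ 2 * `|x| ^+ 1).
  apply: (itg_le (mm _ _) (itgD i33 i2)) => x.
  by rewrite ger0_norm ?mulr_ge0// ?exprn_ge0.
have I2 : itg mu (fun x => `|x - 1| ^+ 1 * `|x| ^+ 2).
  apply: (itg_le (mm _ _) (itgD (itgD i33 (itgZ 2 i2)) i1)) => x.
  by rewrite ger0_norm ?mulr_ge0// ?exprn_ge0.
have [|||||_ h] := @Ex_law2_pow_le mu nu (fun z : T * T => z.1 * z.2 : T) (@measurable_mul R)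
   (fun x => `|x - 1| ^+ 3) (fun x => `|x - 1|) (fun x => `|x|) (fun y => `|y - 1|) 3.
- exact: measurable_dist_pow.
- by move=> x; rewrite exprn_ge0.
- move=> [|[|[|[|//]]]] _ //=.
  + by have := i33; congr itg; apply/funext => x; rewrite expr0 mulr1.
  + by have := i3; congr itg; apply/funext => x; rewrite expr0 mul1r.
- by move=> j jl; exact: itg_dist jl j3.
- move=> x y /=; rewrite lerXn2r ?nnegrE ?addr_ge0// ?mulr_ge0//.
  have -> : x * y - 1 = (x - 1) + x * (y - 1) by ring.
  by rewrite (le_trans (ler_normD _ _))// normrM.
rewrite -/(absm _ _ _) in h.
apply: (le_trans h); rewrite !big_ord_recr big_ord0 /=.
have -> : Ex mu (fun x => `|x - 1| ^+ (3 - 0) * `|x| ^+ 0) = absm mu 1 3.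
  by congr Ex; apply/funext => x; rewrite expr0 mulr1.
have -> : Ex mu (fun x => `|x - 1| ^+ (3 - 3) * `|x| ^+ 3) = Ex mu (fun x => `|x| ^+ 3).
  by congr Ex; apply/funext => x; rewrite expr0 mul1r.
rewrite -!/(absm _ _ _) absm0 ?binn ?bin0 ?bin1 (_ : 'C(3, 2) = 3)%N//.
rewrite ?subSS ?subn0.
have e1 : Ex mu (fun x => `|x - 1| ^+ 2 * `|x| ^+ 1) <= absm mu 1 3 + absm mu 1 2.
  by rewrite /absm -ExD//; apply: Ex_le => //; exact: itgD.
have e2 : Ex mu (fun x => `|x - 1| ^+ 1 * `|x| ^+ 2) <= absm mu 1 3 + 2 * absm mu 1 2 + absm mu 1 1.
  rewrite /absm -ExZ// -ExD//; last exact: itgZ.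
  rewrite -ExD//; last by apply: itgD => //; exact: itgZ.
  by apply: Ex_le => //; apply: itgD => //; apply: itgD => //; exact: itgZ.
have g1 : absm mu 1 1 <= sg := absm1_le i3 g0 hg.
have s1 : absm nu 1 1 <= s' := absm1_le j3 s0 hs.
set E1 := Ex mu _ in e1 *; set E2 := Ex mu _ in e2 *.
have E10 : 0 <= E1 by apply: Ex_ge0 => x; rewrite mulr_ge0 ?exprn_ge0.
have E20 : 0 <= E2 by apply: Ex_ge0 => x; rewrite mulr_ge0 ?exprn_ge0.
have p1 := ler_pM E10 (absm_ge0 nu 1 1) (le_trans e1 (lerD (lexx _) hg)) s1.
have p2 := ler_pM E20 (absm_ge0 nu 1 2) (le_trans e2 (lerD (lerD (lexx _) (ler_wpM2l (ler0n R 2) hg)) g1)) hs.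
have p3 := ler_wpM2r (absm_ge0 nu 1 3) hM.
lra.
Qed.
End Phi_third.

End third_abs.

Lemma eventually_contracting_bounded (R : realType) (x : nat -> R) (r c : R) (N : nat) :
  0 <= r < 1 -> (forall n, 0 <= x n) ->
  (forall n, (N <= n)%N -> x n.+1 <= r * x n + c) -> exists K, forall n, x n <= K.
Proof.
move=> r01 x0 h.
have := @linear_rec_bounded R (fun n => x (n + N)%N) r c r01.
set K := Num.max _ _ => hK.
exists (\sum_(k < N) x k + Num.max 0 K) => n.
have [nN|Nn] := ltnP n N.
  rewrite (bigD1 (Ordinal nN)) //= -addrA lerDl addr_ge0 ?sumr_ge0//.
  by rewrite le_max lexx.
have := hK _ (n - N)%N; rewrite subnK// => {}hK.
have {}hK : x n <= K by apply: hK => k; rewrite addSn; apply: h; rewrite leq_addl.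
by rewrite (le_trans hK)// -[leLHS]add0r lerD ?sumr_ge0// le_max lexx orbT.
Qed.

(** * Boundedness of the normalised third absolute moments *)

Section third_orbit.
Context (R : realType) (b : nat) (hb : (3 <= b)%N).
Local Notation T := (measurableTypeR R).
Variable mu : probability T R.
Hypothesis mu_D : Db b mu.
Let B : R := b%:R.
Let B3 : 3 <= B. Proof. by rewrite ler_nat. Qed.
Let b0 : (0 < b)%N. Proof. by case: b hb. Qed.

Let mu_P : Pb b mu.
Proof.
have [h1 h2 /andP[h3 h4] _] := mu_D; split => //; rewrite h3 /=.
by apply: (lt_le_trans h4); rewrite lee_fin /w2 ge_min lexx.
Qed.
Let mu_good : good b mu. Proof. exact: good_Pb. Qed.
Local Notation nu := (orbitT b mu).
Local Notation V n := (var1 (nu n)).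
Let t0 : R := Ex mu (fun x => x ^+ 2).
Let M n : R := Ex (nu n) (fun x => x ^+ 3).
Let nug n : good b (nu n). Proof. exact: orbit_good. Qed.

Let t0_spec : [/\ 1 < t0, t0 < w2 R b, itg mu (fun x => `|x| ^+ 3) & M 0 < w3 b t0].
Proof.
have [mp _ /andP[h3 h4] h5] := mu_D.
have [i2 e2] : itg mu (fun x => `|x| ^+ 2) /\ moment 2%:R mu = (Ex mu (fun x => x ^+ 2))%:E.
  by apply: moment_itg => //; exact: lt_trans h4 (ltry _).
have [i3 e3] : itg mu (fun x => `|x| ^+ 3) /\ moment 3%:R mu = (Ex mu (fun x => x ^+ 3))%:E.
  by apply: moment_itg => //; exact: lt_trans h5 (ltry _).
by rewrite e2 !lte_fin e3 in h3 h4 h5 *; rewrite lte_fin in h5.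
Qed.

(* [g0] bounds the terms of the third-moment identity that do not involve third moments,
   uniformly along the orbit; [rm] and [rp] are the roots of [r ^ 2 - B ^ 2 * r + g0]. *)
Let g0 : R := 3 * (B - 1) * t0 * ((B - 1) / (B - t0)) + (B - 1) * (B - 2).
Let D : R := B ^+ 4 - 4 * g0.

Let t0B : t0 < B - 1.
Proof. by have [_ h _ _] := t0_spec; move: h; rewrite /w2 lt_min => /andP[]. Qed.

(** The discriminant of the quadratic is the radicand of [w3], and for [t0 < B] the second bound in
    [w2] is the condition that it be positive. *)
Let DE : D = (B * (B ^+ 4 - 4 * B ^+ 2 + 12 * B - 8) -
      t0 * (B ^+ 4 + 8 * B ^+ 2 - 12 * B + 4)) / (B - t0).
Proof.
rewrite /D /g0; field.
by rewrite subr_eq0 gt_eqF//; have := t0B; lra.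
Qed.

Let D_gt0 : 0 < D.
Proof.
have [_ h _ _] := t0_spec; move: h; rewrite /w2 lt_min => /andP[_].
have P : 0 < B ^+ 4 + 8 * B ^+ 2 - 12 * B + 4.
  have h := B3; have : 0 <= B ^+ 4 by rewrite exprn_ge0//; lra.
  nra.
rewrite mulrA ltr_pdivlMr// => h.
by rewrite DE divr_gt0 ?subr_gt0//; have := t0B; lra.
Qed.

Let rm : R := B ^+ 2 / 2 - Num.sqrt D / 2.
Let rp : R := B ^+ 2 / 2 + Num.sqrt D / 2.

Let w3E : w3 b t0 = rp.
Proof. by rewrite /w3 -/B -DE /rp; ring. Qed.

Let sqD : Num.sqrt D ^+ 2 = D. Proof. by rewrite sqr_sqrtr// ltW. Qed.

Let rmp : rm * rp = g0.
Proof. by rewrite /rm /rp; have := sqD; rewrite /D; set q := Num.sqrt _ => h; lra. Qed.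

Let g0_gt0 : 0 < g0.
Proof.
have [h _ _ _] := t0_spec; have h1 := t0B; have h3 := B3.
have h2 : 0 < (B - 1) / (B - t0) by rewrite divr_gt0; lra.
have p1 : 0 < B - 1 by lra.
have p2 : 0 < B - 2 by lra.
have p3 : 0 < t0 by lra.
by apply: addr_gt0; do ?apply: mulr_gt0 => //.
Qed.

Let rp_gt0 : 0 < rp.
Proof. by rewrite /rp; have := sqrtr_ge0 D; have := B3; nra. Qed.

Let rm_gt0 : 0 < rm.
Proof. by have := g0_gt0; rewrite -rmp pmulr_lgt0. Qed.

Let rm_half : rm < B ^+ 2 / 2.
Proof. by rewrite /rm; have := D_gt0; rewrite -sqrtr_gt0; lra. Qed.

Let rm_rp : rm < rp.
Proof. by rewrite /rm /rp; have := D_gt0; rewrite -sqrtr_gt0; lra. Qed.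

Let rp_rm : B ^+ 2 - rp = rm. Proof. by rewrite /rm /rp; lra. Qed.

Let tE n : Ex (nu n) (fun x => x ^+ 2) = 1 + V n.
Proof. by have [_ i2 h1 _] := nug n; rewrite var1E//; lra. Qed.

Let V_ni n : V n <= V 0.
Proof.
elim: n => [//|n IH]; apply: (le_trans _ IH).
have := orbit_varS hb mu_good n; have := orbit_var_gt0 hb mu_good n.
have := orbit_var_lt hb mu_good n; have := orbit_var_gt0 hb mu_good n.+1.
rewrite -/B => h1 h2 h3 h4; rewrite -[leRHS]h4 ler_peMr ?(ltW h1)//; lra.
Qed.

Let M_abs n : M n = Ex (nu n) (fun x => `|x| ^+ 3).
Proof.
have [np _ _ _] := nug n.
rewrite /M /Ex /Rintegral; congr fine; apply: ae_eq_integral => //.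
- by apply/measurable_EFinP; exact: measurable_pow.
- by apply/measurable_EFinP; exact: measurable_normpow.
- have [N [mN N0 hN]] := on_Rplus_ae np; exists N; split => //.
  by move=> x /= h; apply: hN => /= x0; apply: h => _; rewrite ger0_norm.
Qed.

Let M_ge0 n : 0 <= M n.
Proof. by rewrite M_abs; apply: Ex_ge0 => x; rewrite exprn_ge0. Qed.

(** Consecutive second moments have product [t * ((B - 1) / (B - t))] with [t = 1 + V n]. This
    increases with [t], and [V] is nonincreasing, so the initial value [t0] gives the largest
    product. *)
Let M_rec n : itg (nu n) (fun x => `|x| ^+ 3) -> itg (nu n.+1) (fun x => `|x| ^+ 3) ->
  M n.+1 * (B ^+ 2 - M n) <= g0.
Proof.
move=> i j; have [_ fx _ _] := good_transform hb (nug n).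
have [_ i2 h1 _] := nug n; have [_ j2 h1' _] := nug n.+1.
have B2 : B ^+ 2 != 0 by rewrite expf_neq0// gt_eqF//; have := B3; lra.
have e : M n.+1 * B ^+ 2 = M n * M n.+1 + 3 * (B - 1) * (Ex (nu n) (fun x => x ^+ 2) *
   Ex (nu n.+1) (fun x => x ^+ 2)) + (B - 1) * (B - 2).
  have := Phi_cube b0 i j; rewrite -(eqlaw_Ex _ fx) -/(M n.+1) h1 h1' !mulr1 expr1n mulr1 -/B => h.
  by rewrite {1}h mulfVK.
have h : Ex (nu n) (fun x => x ^+ 2) * Ex (nu n.+1) (fun x => x ^+ 2) <= t0 * ((B - 1) / (B - t0)).
  have e1 : (1 + V n.+1) * (B - (1 + V n)) = B - 1.
    by have := orbit_varS hb mu_good n; rewrite -/B => h; lra.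
  have tV : t0 = 1 + V 0 by exact: (tE 0).
  have v0 := orbit_var_gt0 hb mu_good n.
  have w : 0 < B - (1 + V n) by have := orbit_var_lt hb mu_good n; rewrite -/B; lra.
  have w0 : 0 < B - t0 by have := t0B; lra.
  rewrite !tE; have -> : 1 + V n.+1 = (B - 1) / (B - (1 + V n)).
    by rewrite -e1 mulfK// gt_eqF.
  have B1 : 0 <= B - 1 by have := B3; lra.
  apply: ler_pM.
  - by rewrite addr_ge0// ltW.
  - by rewrite divr_ge0// ltW.
  - by rewrite tV lerD2l V_ni.
  - by rewrite ler_wpM2l// lef_pV2// ?posrE// tV lerD2l lerN2 lerD2l V_ni.
have := ler_wpM2l (_ : 0 <= 3 * (B - 1)) h; rewrite /g0.
have B1 : 0 <= 3 * (B - 1) by have := B3; lra.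
move=> /(_ B1); lra.
Qed.

Let x0 : R := Num.max (M 0) rm.
(** The map [y -> g0 / (B^2 - y)] fixes [rm], and [g0 / (B^2 - y) - rm = rm * (y - rm) / (B^2 - y)].
    The ratio [rm / (B^2 - y)] is largest at [y = x0], where [x0 < rp = B^2 - rm] makes it less than
    1. *)
Let q : R := rm / (B ^+ 2 - x0).

Let x0_rp : x0 < rp.
Proof. by have [_ _ _ h] := t0_spec; rewrite gt_max rm_rp andbT -w3E. Qed.

Let q01 : 0 <= q < 1.
Proof.
have h : rm < B ^+ 2 - x0 by have := x0_rp; have := rp_rm; lra.
have h0 : 0 < B ^+ 2 - x0 by apply: lt_trans h; exact: rm_gt0.
by rewrite divr_ge0 ?(ltW h0) ?(ltW rm_gt0)//= ltr_pdivrMr// mul1r.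
Qed.

(** Finiteness and bound are proved together: [M n <= x0 < B^2] is what makes the third moment at
    [n.+1] finite, and [M_rec] can be used only then. *)
Let M_bound n : itg (nu n) (fun x => `|x| ^+ 3) /\ M n <= rm + q ^+ n * (x0 - rm).
Proof.
have x0rm : rm <= x0 by rewrite le_max lexx orbT.
have /andP[q0 q1] := q01.
elim: n => [|n [i IH]].
  have [_ _ i _] := t0_spec; split => //.
  by rewrite expr0 mul1r addrC subrK le_max lexx.
have y0 : rm + q ^+ n * (x0 - rm) <= x0.
  have : q ^+ n * (x0 - rm) <= 1 * (x0 - rm).
    by rewrite ler_wpM2r ?subr_ge0// exprn_ile1// ltW.
  lra.
have Mx0 : M n <= x0 by exact: le_trans IH y0.
have pos : 0 < B ^+ 2 - M n.
  by have := x0_rp; have := rp_rm; have := rm_gt0; lra.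
have [_ _ _ h3] := good_transform hb (nug n).
have j : itg (nu n.+1) (fun x => `|x| ^+ 3).
  by apply: h3 => //; [rewrite -/B -subr_gt0|exact: M_ge0].
split => //.
set y := rm + q ^+ n * (x0 - rm) in IH y0.
have posx : 0 < B ^+ 2 - x0 by have := x0_rp; have := rp_rm; have := rm_gt0; lra.
have posy : 0 < B ^+ 2 - y by lra.
have h : M n.+1 <= g0 / (B ^+ 2 - y).
  rewrite ler_pdivlMr//; apply: le_trans (M_rec i j).
  by rewrite ler_wpM2l ?M_ge0//; lra.
apply: (le_trans h).
have -> : g0 / (B ^+ 2 - y) = rm + rm * (y - rm) / (B ^+ 2 - y).
  rewrite -rmp (_ : rp = B ^+ 2 - rm); last by have := rp_rm; lra.
  by field; rewrite gt_eqF.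
have -> : q ^+ n.+1 * (x0 - rm) = q * (y - rm) by rewrite /y exprS; ring.
rewrite lerD2l /q mulrAC ler_wpM2r//.
  rewrite /y addrC addKr mulr_ge0 ?exprn_ge0 ?subr_ge0//.
rewrite ler_wpM2l ?(ltW rm_gt0)// lef_pV2 ?posrE//; lra.
Qed.

Let M_small : \forall n \near \oo, M n <= B ^+ 2 / 2.
Proof.
have h : rm + q ^+ n * (x0 - rm) @[n --> \oo] --> rm + 0 * (x0 - rm).
  apply: cvgD; first exact: cvg_cst.
  apply: cvgM; last exact: cvg_cst.
  by have /andP[h0 h1] := q01; apply: cvg_expr; rewrite ger0_norm//.
rewrite mul0r addr0 in h.
have hh : \forall n \near \oo, rm + q ^+ n * (x0 - rm) < B ^+ 2 / 2 by exact: (cvgr_lt _ h).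
apply: filterS hh => n hn.
by apply: ltW; apply: le_lt_trans hn; have [] := M_bound n.
Qed.
Local Notation sg := (sd b mu).
Let sg_gt0 n : 0 < sg n. Proof. exact: (sd_gt0 hb mu_good). Qed.
Let sg2 n : sg n ^+ 2 = V n. Proof. exact: (sd_sqr hb mu_good). Qed.
Let w n : R := Num.sqrt (B - 1 - V n).
Let w2E n : w n ^+ 2 = B - 1 - V n.
Proof.
rewrite sqr_sqrtr//; have := orbit_var_lt hb mu_good n; rewrite -/B => h; lra.
Qed.
Let sgS n : sg n = sg n.+1 * w n.
Proof.
rewrite /sd /w -sqrtrM ?(ltW (orbit_var_gt0 hb mu_good n.+1))//.
by rewrite orbit_varS.
Qed.
Let w1 : R := Num.sqrt (B - 1).
Let w_le n : w n <= w1.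
Proof.
rewrite ler_sqrt; last by have := B3; lra.
by rewrite gerBl ltW//; exact: orbit_var_gt0.
Qed.
Let w1B : w1 <= B.
Proof.
rewrite -(@ler_pXn2r _ 2) ?nnegrE ?sqrtr_ge0 ?ler0n//.
by rewrite sqr_sqrtr; have := B3; nra.
Qed.
Let sgB n : sg n <= B.
Proof.
rewrite -(@ler_pXn2r _ 2) ?nnegrE ?sqrtr_ge0 ?ler0n// sg2.
have := orbit_var_lt hb mu_good n; rewrite -/B => h.
by have := B3; nra.
Qed.

Let a n : R := absm (nu n) 1 3.
(** Collects the lower-order terms of [absm_mulc3] and the cubic term of [absm_Phi3], after
    [sg n = sg n.+1 * w n] and with [w n], [w n ^ 2] and [sg n.+1] bounded by [B]. *)
Let K : R := 3 * B + 6 * B ^+ 2 + 3 * B + B ^+ 2 * Num.sqrt B ^+ 3.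

Let absm2_var n : absm (nu n) 1 2 = V n.
Proof. by congr Ex; apply/funext => x; rewrite real_normK ?num_real. Qed.

Let absm_rec n :
  a n.+1 * (B ^+ 2 - M n) <= a n * (1 + 3 * sg n.+1 + 3 * sg n.+1 ^+ 2) + K * sg n.+1 ^+ 3.
Proof.
have [i _] := M_bound n; have [j _] := M_bound n.+1.
have [_ fx _ _] := good_transform hb (nug n).
have [_ i2 h1 _] := nug n; have [_ j2 h1' _] := nug n.+1.
have B0 : 0 < B by rewrite ltr0n.
have i1 := itg_pow_le (isT : 1 <= 2)%N i2; have j1 := itg_pow_le (isT : 1 <= 2)%N j2.
(* In fact an equality: the variance recursion gives [V n + V n.+1 + V n * V n.+1 = B * V n.+1], as
   it must for a mean of [B] independent products to have variance [V n.+1]. *)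
have vm : absm (mulc (nu n) (nu n.+1)) 1 2 <= (Num.sqrt B * sg n.+1) ^+ 2.
  rewrite exprMn sg2 sqr_sqrtr ?ler0n//.
  have -> : absm (mulc (nu n) (nu n.+1)) 1 2 = var1 (mulc (nu n) (nu n.+1)).
    by congr Ex; apply/funext => x; rewrite real_normK ?num_real.
  rewrite var1E; [|exact: itg_mulc|by rewrite Ex_mulc// h1 h1' mulr1].
  rewrite Ex_mulc// !tE; have := orbit_varS hb mu_good n; rewrite -/B => h.
  rewrite le_eqVlt; apply/orP; left; apply/eqP; lra.
have ts0 : 0 <= Num.sqrt B * sg n.+1 by rewrite mulr_ge0 ?sqrtr_ge0.
have s0 := ltW (sg_gt0 n.+1).
have k1 := absm_Phi3 b0 i j ts0 vm.
have k2 := @absm_mulc3 _ (nu n) (nu n.+1) i j (sg n) (sg n.+1) (M n) s0.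
have {k2} := k2 _ _ (ltW (sg_gt0 n)) _; rewrite !absm2_var !sg2 => /(_ (lexx _) (lexx _)).
rewrite M_abs => /(_ (lexx _)); rewrite -M_abs => k2.
have e : absm (Phi b (nu n) (nu n.+1)) 1 3 = a n.+1.
  by apply/esym; exact: (eqlaw_Ex _ fx).
rewrite e -/B in k1.
have {}k1 : a n.+1 * B ^+ 2 <= absm (mulc (nu n) (nu n.+1)) 1 3 + B ^+ 2 * (Num.sqrt B * sg n.+1) ^+ 3.
  have := ler_wpM2r (exprn_ge0 2 (ltW B0)) k1; rewrite mulrDl mulfVK ?expf_neq0 ?gt_eqF//.
  by rewrite [_ ^+ 3 * _]mulrC.
rewrite -!sg2 -/(a n) -/(a n.+1) in k2.
have s3 : 0 <= sg n.+1 ^+ 3 by rewrite exprn_ge0.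
have wB : w n <= B := le_trans (w_le n) w1B.
have w2B : w n ^+ 2 <= B.
  rewrite w2E; have := orbit_var_gt0 hb mu_good n; lra.
have p1 : sg n ^+ 2 * sg n.+1 <= B * sg n.+1 ^+ 3.
  rewrite (sgS n) (_ : _ * _ = w n ^+ 2 * sg n.+1 ^+ 3); last by ring.
  exact: ler_wpM2r.
have p2 : sg n ^+ 2 * sg n.+1 ^+ 2 <= B ^+ 2 * sg n.+1 ^+ 3.
  rewrite (_ : _ * _ = (sg n ^+ 2 * sg n.+1) * sg n.+1); last by ring.
  apply: le_trans (ler_pM _ s0 p1 (sgB n.+1)) _; first by rewrite mulr_ge0 ?exprn_ge0 ?sqrtr_ge0.
  by rewrite le_eqVlt; apply/orP; left; apply/eqP; ring.
have p3 : sg n * sg n.+1 ^+ 2 <= B * sg n.+1 ^+ 3.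
  rewrite (sgS n) (_ : _ * _ = w n * sg n.+1 ^+ 3); last by ring.
  exact: ler_wpM2r.
rewrite mulrBr lerBlDr; apply: (le_trans k1); rewrite exprMn /K -sg2; lra.
Qed.

Let x n : R := a n / sg n ^+ 3.
Let x_ge0 n : 0 <= x n.
Proof. by rewrite divr_ge0 ?absm_ge0// exprn_ge0 ?sqrtr_ge0. Qed.

(** Renormalising from index [n] to [n.+1] multiplies [x n] by [w n ^ 3], which is at most
    [w1 ^ 3]. *)
Let x_rec n : x n.+1 * (B ^+ 2 - M n) <=
  x n * (w1 ^+ 3 * (1 + 3 * sg n.+1 + 3 * sg n.+1 ^+ 2)) + K.
Proof.
have s3 : 0 < sg n.+1 ^+ 3 by rewrite exprn_gt0.
have c0 : 0 <= 1 + 3 * sg n.+1 + 3 * sg n.+1 ^+ 2.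
  by rewrite !addr_ge0// mulr_ge0 ?exprn_ge0 ?sqrtr_ge0.
rewrite /x mulrAC ler_pdivrMr//; apply: (le_trans (absm_rec n)).
rewrite [leRHS]mulrDl lerD2r.
have ea : a n = x n * (sg n.+1 ^+ 3 * w n ^+ 3).
  by rewrite -exprMn -sgS /x divfK// expf_neq0// gt_eqF.
set c := 1 + _ + _ in c0 *.
have -> : a n / sg n ^+ 3 * (w1 ^+ 3 * c) * sg n.+1 ^+ 3 =
  x n * (sg n.+1 ^+ 3 * w1 ^+ 3) * c by rewrite -/(x n); ring.
rewrite ea ler_wpM2r// ler_wpM2l ?x_ge0// ler_wpM2l ?(ltW s3)//.
by rewrite lerXn2r ?nnegrE ?sqrtr_ge0.
Qed.

(** This makes [x_rec] contracting as soon as [M n <= B^2 / 2] and [sg n.+1] is small. *)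
Let w1_small : w1 ^+ 3 < B ^+ 2 / 2.
Proof.
rewrite -(@ltr_pXn2r _ 2) ?nnegrE ?exprn_ge0 ?sqrtr_ge0 ?divr_ge0 ?exprn_ge0//.
have e : w1 ^+ 2 = B - 1 by rewrite sqr_sqrtr//; have := B3; lra.
rewrite exprAC e.
(* A quarter of [B^4 - 4 * (B - 1)^3] is written as a square plus a quadratic that is positive for
   [B >= 3]. *)
have -> : (B ^+ 2 / 2) ^+ 2 = (B - 1) ^+ 3 + ((B ^+ 2 - 2 * B) ^+ 2 + 8 * B ^+ 2 - 12 * B + 4) / 4 by field.
rewrite ltrDl divr_gt0//.
have := sqr_ge0 (B ^+ 2 - 2 * B); have := B3; nra.
Qed.

Let x_bounded : exists C, forall n, x n <= C.
Proof.
(* Midpoint between the limiting ratio and 1: it leaves room for the factor [1 + 3 * sg + 3 * sg^2],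
   which tends to 1. *)
pose r : R := (1 + w1 ^+ 3 / (B ^+ 2 / 2)) / 2.
have B2 : 0 < B ^+ 2 / 2 by rewrite divr_gt0// exprn_gt0// ltr0n.
have wq : w1 ^+ 3 / (B ^+ 2 / 2) < 1 by rewrite ltr_pdivrMr// mul1r.
have wq0 : 0 <= w1 ^+ 3 / (B ^+ 2 / 2) by rewrite divr_ge0 ?(ltW B2)// exprn_ge0// sqrtr_ge0.
have r01 : 0 <= r < 1 by rewrite /r; apply/andP; split; lra.
have wr : w1 ^+ 3 < r * (B ^+ 2 / 2).
  by rewrite -ltr_pdivrMr// /r; lra.
have h : w1 ^+ 3 * (1 + 3 * sg n.+1 + 3 * sg n.+1 ^+ 2) @[n --> \oo] -->
    w1 ^+ 3 * (1 + 3 * 0 + 3 * (0 * 0)).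
  have h := cvgS (sd_cvg0 hb mu_good).
  apply: cvgM; first exact: cvg_cst.
  apply: cvgD.
    by apply: cvgD; [exact: cvg_cst|apply: cvgM => //; exact: cvg_cst].
  by apply: cvgM; [exact: cvg_cst|exact: (cvgM h h)].
rewrite !mulr0 !addr0 mulr1 in h.
have h1 : \forall n \near \oo, w1 ^+ 3 * (1 + 3 * sg n.+1 + 3 * sg n.+1 ^+ 2) < r * (B ^+ 2 / 2).
  exact: (cvgr_lt _ h).
have [N _ hN] : \forall n \near \oo, x n.+1 <= r * x n + K / (B ^+ 2 / 2).
  near=> n.
  have m2 : M n <= B ^+ 2 / 2 by near: n; exact: M_small.
  have m1 : w1 ^+ 3 * (1 + 3 * sg n.+1 + 3 * sg n.+1 ^+ 2) < r * (B ^+ 2 / 2) by near: n; exact: h1.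
  have -> : r * x n + K / (B ^+ 2 / 2) = (x n * (r * (B ^+ 2 / 2)) + K) / (B ^+ 2 / 2).
    by field; rewrite gt_eqF// ltr0n.
  rewrite ler_pdivlMr//; apply: le_trans (le_trans (x_rec n) _).
    by rewrite ler_wpM2l ?x_ge0//; lra.
  by rewrite lerD2r ler_wpM2l ?x_ge0// ltW.
apply: (eventually_contracting_bounded r01 x_ge0 (N := N)) => n nN.
exact: hN.
Unshelve. all: by end_near.
Qed.

Lemma std_third_bounded :
  (ereal_sup [set std_abs_moment 3 (nu n) | n in [set n | (1 <= n)%N]] < +oo)%E.
Proof.
have [C hC] := x_bounded.
apply: (@le_lt_trans _ _ C%:E); last exact: ltry.
apply: ge_ereal_sup => _ [n _ <-].
have [i3 _] := M_bound n.
have i := itg_dist 1 (isT : 3 <= 3)%N i3.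
rewrite /std_abs_moment sigma_var1 -/(sd b mu n).
have e y : (`|y - 1| / sg n) `^ 3 = (sg n ^+ 3)^-1 * `|y - 1| ^+ 3.
  by rewrite (powR_mulrn 3) ?divr_ge0 ?sqrtr_ge0// exprMn exprVn mulrC.
under eq_integral do rewrite e.
rewrite -EFin_Ex; last exact: itgZ.
by rewrite lee_fin ExZ// mulrC; exact: hC.
Qed.
End third_orbit.

(** * Gaussian laws *)

Section gauss.
Context (R : realType).
Local Notation T := (measurableTypeR R).
Local Notation leb := (@lebesgue_measure R).
Local Notation prob := (probability T R).
Local Notation N := (normal_prob (0 : R) 1 : prob).

(** The Radon-Nikodym derivative agrees almost everywhere with [normal_pdf], since both have the
    same integral over every measurable set. *)
Lemma ge0_integral_normal_prob (m s : R) (f : T -> \bar R) : measurable_fun setT f ->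
  (forall x, 0 <= f x)%E ->
  (\int[normal_prob m s]_x f x = \int[leb]_x (f x * (normal_pdf m s x)%:E))%E.
Proof.
move=> mf f0.
have dom := normal_prob_dominates m s.
have mp : measurable_fun setT (EFin \o normal_pdf m s).
  by apply/measurable_EFinP; exact: measurable_normal_pdf.
have ri := Radon_Nikodym_SigmaFinite.f_integrable dom.
rewrite -(Radon_Nikodym_SigmaFinite.change_of_variables dom)//.
apply: ae_eq_integral => //.
- by apply: emeasurable_funM => //; exact: measurable_int ri.
- exact: emeasurable_funM.
- have h : ae_eq leb setT (Radon_Nikodym_SigmaFinite.f (normal_prob m s) leb)
      (EFin \o normal_pdf m s).
    apply: integral_ae_eq => //.
    by move=> E _ mE'; rewrite -Radon_Nikodym_SigmaFinite.f_integral.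
  by apply: filterS h => x /= h _; rewrite h.
Qed.

Lemma integral_normal_prob (m s : R) (f : T -> R) : measurable_fun setT f ->
  (forall x, 0 <= f x) ->
  (\int[normal_prob m s]_x (f x)%:E = \int[leb]_x (f x * normal_pdf m s x)%:E)%E.
Proof.
move=> mf f0; rewrite ge0_integral_normal_prob//; last exact/measurable_EFinP.
Qed.

Lemma integral_affine (a c : R) (g : T -> \bar R) : 0 < a -> measurable_fun setT g ->
  (forall x, 0 <= g x)%E ->
  (\int[leb]_x g (a * x + c)%R = a^-1%:E * \int[leb]_x g x)%E.
Proof.
move=> a0 mg g0; have a1 : 0 <= a^-1 by rewrite invr_ge0 ltW.
have e := ge0_integral_pushforward (@measurable_affine R a c) leb (f := g) measurableT mg
  (fun x _ => g0 x).
rewrite preimage_setT /= in e; rewrite -[LHS]e.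
rewrite -(ge0_integral_mscale leb measurableT (NngNum a1) mg (fun x _ => g0 x)).
apply: eq_measure_integral => [|mf A mA _]; first exact: measurable_affine.
exact: lebesgue_affine.
Qed.

Lemma normal_peakE (s : R) : 0 < s -> normal_peak s = s^-1 * normal_peak 1.
Proof.
move=> s0; rewrite /normal_peak expr1n mul1r -mulrnAr sqrtrM ?sqr_ge0//.
by rewrite sqrtr_sqr gtr0_norm// invfM.
Qed.

Lemma normal_affine (m s : R) : 0 < s ->
  eqlaw (law N (measurable_affine s m)) (normal_prob m s : prob).
Proof.
move=> s0 A mA.
have mB : measurable ((fun x : T => s * x + m : T) @^-1` A).
  by rewrite -[X in measurable X]setTI; exact: (@measurable_affine R s m).
set B := (X in measurable X) in mB; transitivity (N B); first exact: lawE.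
transitivity (\int[N]_x (\1_B x)%:E)%E.
  by rewrite integral_indic// setIT.
rewrite integral_normal_prob//.
pose g (x : R) := (s * (\1_A x * normal_pdf m s x))%R.
have mg : measurable_fun setT g.
  apply: measurable_funM => //; apply: measurable_funM => //; exact: measurable_normal_pdf.
have g0 x : 0 <= g x.
  by apply: mulr_ge0; [exact: ltW|apply: mulr_ge0 => //; exact: normal_pdf_ge0].
transitivity (\int[leb]_x (g (s * x + m)%R)%:E)%E.
  apply: eq_integral => x _; congr EFin; rewrite /g.
  rewrite !normal_pdfE ?oner_neq0 ?gt_eqF// [RHS]mulrCA.
  rewrite [\1_A (s * x + m)](_ : _ = \1_B x)//.
  congr (_ * _); rewrite mulrA; congr (_ * _).
    by rewrite (normal_peakE s0) mulrA mulfV ?mul1r// gt_eqF.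
  rewrite /normal_fun subr0 addrK expr1n; congr expR.
  by rewrite exprMn; field; rewrite gt_eqF.
have mg' : measurable_fun setT (EFin \o g) by exact/measurable_EFinP.
rewrite (@integral_affine s m (EFin \o g) s0 mg'); last by move=> x; rewrite lee_fin.
rewrite /= /g; under eq_integral do rewrite EFinM.
rewrite ge0_integralZl//; last 3 first.
- apply/measurable_EFinP; apply: measurable_funM => //; exact: measurable_normal_pdf.
- by move=> x _; rewrite lee_fin mulr_ge0// normal_pdf_ge0.
- by rewrite lee_fin ltW.
rewrite muleA -EFinM mulVf ?gt_eqF// mul1e /normal_prob [RHS]integral_mkcond.
apply: eq_integral => x _; rewrite patchE indicE; case: (x \in A); first by rewrite mul1r.
by rewrite mul0r.
Qed.


Let r (s t : R) := Num.sqrt (s ^+ 2 + t ^+ 2).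

(** Both sides are the joint density of [u] and [z = s * u + t * v], for independent standard [u]
    and [v]: on the left [z] is conditioned on [u], on the right [u] on [z]. The exponents agree by
    completing the square. *)
Lemma normal_pdf_mix (s t u z : R) : 0 < s -> 0 < t ->
  normal_pdf (s * u) t z * normal_pdf 0 1 u =
  normal_pdf 0 (r s t) z * normal_pdf (s * z / r s t ^+ 2) (t / r s t) u.
Proof.
move=> s0 t0.
have p0 : 0 < s ^+ 2 + t ^+ 2 by rewrite addr_gt0// exprn_gt0.
have r0 : 0 < r s t by rewrite sqrtr_gt0.
have r2 : r s t ^+ 2 = s ^+ 2 + t ^+ 2 by rewrite sqr_sqrtr// ltW.
rewrite !normal_pdfE ?oner_neq0 ?gt_eqF ?divr_gt0//.
rewrite mulrACA [RHS]mulrACA; congr (_ * _).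
  by rewrite (normal_peakE t0) (normal_peakE r0) (normal_peakE (divr_gt0 t0 r0)); field; rewrite !gt_eqF.
rewrite /normal_fun -!expRD; congr expR.
rewrite expr_div_n r2; field.
by rewrite !gt_eqF.
Qed.

Lemma measurable_lin2 (s t : R) :
  measurable_fun setT (fun z : T * T => s * z.1 + t * z.2 : T).
Proof.
by apply: measurable_funD; apply: (measurableT_comp (measurable_scale _));
  [exact: measurable_fst|exact: measurable_snd].
Qed.

(** Exchange the integrals by Tonelli and integrate out [u] with [normal_pdf_mix], whose conditional
    density has total mass 1. *)
Lemma normal_add (s t : R) : 0 < s -> 0 < t ->
  eqlaw (law (pprod N N) (measurable_lin2 s t)) (normal_prob 0 (r s t) : prob).
Proof.
move=> s0 t0 A mA.
pose h (w : T * T) : R := \1_A w.2 * normal_pdf (s * w.1) t w.2.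
pose k (w : T * T) : \bar R := (h w * normal_pdf 0 1 w.1)%:E.
have h0 w : 0 <= h w by rewrite mulr_ge0// normal_pdf_ge0.
have k0 w : (0 <= k w)%E by rewrite lee_fin mulr_ge0// normal_pdf_ge0.
have mh : measurable_fun setT h.
  apply: measurable_funM; first exact: (measurableT_comp (measurable_indic _) measurable_snd).
  rewrite (_ : (fun _ => _) = (fun w : T * T =>
    normal_peak t * expR (- (w.2 - s * w.1) ^+ 2 / (t ^+ 2 *+ 2)))); last first.
    by apply/funext => w; rewrite normal_pdfE ?gt_eqF.
  apply: measurable_funM => //; apply: measurableT_comp => //.
  apply: measurable_funM => //; apply: measurableT_comp => //.
  apply: measurable_funX; apply: measurable_funB; first exact: measurable_snd.
  exact: (measurableT_comp (measurable_scale s) measurable_fst).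
have mk : measurable_fun setT k.
  apply/measurable_EFinP; apply: measurable_funM => //.
  exact: (measurableT_comp (@measurable_normal_pdf R 0 1) measurable_fst).
have mhE : measurable_fun setT (EFin \o h) by exact/measurable_EFinP.
have hE u : normal_prob (s * u) t A = (\int[leb]_z (h (u, z))%:E)%E.
  rewrite /normal_prob [LHS]integral_mkcond; apply: eq_integral => z _.
  by rewrite patchE /h /= indicE; case: (z \in A); rewrite ?mul1r ?mul0r.
transitivity (\int[leb]_u \int[leb]_z k (u, z))%E.
  transitivity (\int[N]_u \int[leb]_z (h (u, z))%:E)%E.
    rewrite [LHS]/=.
    apply: eq_integral => u _; rewrite -hE -(normal_affine _ t0 mA) /=.
    congr (normal_prob _ _ _); apply/seteqP; split => v /=; rewrite /xsection/= inE/= addrC//.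
  have mF : measurable_fun setT (fun u : T => \int[leb]_z (h (u, z))%:E)%E.
    by apply: (@measurable_fun_fubini_tonelli_F _ _ _ _ _ leb (EFin \o h) mhE) => w; rewrite lee_fin.
  rewrite (ge0_integral_normal_prob _ _ mF); last first.
    by move=> u; apply: integral_ge0 => z _; rewrite lee_fin.
  apply: eq_integral => u _; rewrite muleC -ge0_integralZl//; last 3 first.
  - exact: (measurableT_comp mhE (pair1_measurable u)).
  - by move=> z _; rewrite lee_fin.
  - by rewrite lee_fin normal_pdf_ge0.
  by apply: eq_integral => z _; rewrite /k /= EFinM muleC.
rewrite (fubini_tonelli _ mk k0).
rewrite /normal_prob [RHS]integral_mkcond; apply: eq_integral => z _.
rewrite patchE /k /h /=.
transitivity (\int[leb]_u ((\1_A z * normal_pdf 0 (r s t) z)%:E *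
   (normal_pdf (s * z / r s t ^+ 2) (t / r s t) u)%:E))%E.
  by apply: eq_integral => u _; rewrite -EFinM; congr EFin; rewrite -[LHS]mulrA -[RHS]mulrA -normal_pdf_mix.
rewrite ge0_integralZl//; last 3 first.
- by apply/measurable_EFinP; exact: measurable_normal_pdf.
- by move=> u _; rewrite lee_fin normal_pdf_ge0.
- by rewrite lee_fin mulr_ge0// normal_pdf_ge0.
rewrite integral_normal_pdf mule1 indicE; case: (z \in A); first by rewrite mul1r.
by rewrite mul0r.
Qed.


(** Stated through expectations so that a scale may be 0; such a scale has no density in
    [normal_add] and is treated directly. *)
Lemma Ex_normal_mix (f : T -> R) (M x s t : R) : 0 <= s -> 0 <= t ->
  measurable_fun setT f -> (forall y, `|f y| <= M) ->
  Ex N (fun u => Ex N (fun v => f (x + s * u + t * v))) = Ex N (fun w => f (x + r s t * w)).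
Proof.
move=> s0 t0 mf fM.
have [->|sn0] := eqVneq s 0.
  rewrite /r expr0n add0r sqrtr_sqr ger0_norm// -[RHS](Ex_cst N).
  by congr Ex; apply/funext => u; congr Ex; apply/funext => v; rewrite mul0r addr0.
have [->|tn0] := eqVneq t 0.
  rewrite /r expr0n addr0 sqrtr_sqr ger0_norm//.
  congr Ex; apply/funext => u; rewrite -[RHS](Ex_cst N).
  by congr Ex; apply/funext => v; rewrite mul0r addr0.
have sp : 0 < s by rewrite lt_neqAle eq_sym sn0.
have tp : 0 < t by rewrite lt_neqAle eq_sym tn0.
have rp : 0 < r s t by rewrite sqrtr_gt0 addr_gt0// exprn_gt0.
pose g (y : T) := f (x + y).
have mg : measurable_fun setT g by apply: measurableT_comp => //; exact: measurable_funD.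
have i d (Z : measurableType d) (m : probability Z R) (k : Z -> T) :
    measurable_fun setT k -> itg m (fun z => g (k z)).
  by move=> mk; apply: (@itg_bounded _ _ _ _ _ M); [exact: measurableT_comp|move=> z; exact: fM].
transitivity (Ex (law (pprod N N) (measurable_lin2 s t)) g).
  rewrite Ex_law//; last by apply: i; exact: measurable_lin2.
  have mgl := measurableT_comp mg (measurable_lin2 s t).
  rewrite (Ex_pprod N N mgl (M := M)); last by move=> z; exact: fM.
  by congr Ex; apply/funext => u; congr Ex; apply/funext => v; rewrite /g/= addrA.
rewrite (eqlaw_Ex g (normal_add sp tp)) -(eqlaw_Ex g (normal_affine 0 rp)) Ex_law//; last first.
  by apply: i; exact: measurable_affine.
by congr Ex; apply/funext => w; rewrite /g addr0.
Qed.

(** [f] is the density of [normal_prob m s] with respect to the standard law. Exponentials of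
    suitable quadratic polynomials are such ratios up to a constant, which is how their Gaussian
    expectations are obtained. *)
Lemma itg_normal_ratio (m s : R) (f : T -> R) : measurable_fun setT f ->
  (forall x, 0 <= f x) -> (forall x, f x * normal_pdf 0 1 x = normal_pdf m s x) ->
  itg N f /\ Ex N f = 1.
Proof.
move=> mf f0 e.
have e1 : (\int[N]_x (f x)%:E = 1)%E.
  rewrite integral_normal_prob// -[RHS](integral_normal_pdf m s).
  by apply: eq_integral => x _; rewrite e.
split; first by apply: itg_ge0P => //; rewrite e1 ltry.
by rewrite /Ex /Rintegral e1.
Qed.

(* Normalisation of the Gaussian density of standard deviation [s]; letting [s] tend to [1]
   from both sides yields the variance. *)
Lemma Ex_normal_exp_sqr (s : R) : 0 < s ->
  itg N (fun x => expR ((1 - s ^- 2) / 2 * x ^+ 2)) /\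
  Ex N (fun x => expR ((1 - s ^- 2) / 2 * x ^+ 2)) = s.
Proof.
move=> s0.
have mf : measurable_fun setT (fun x : T => expR ((1 - s ^- 2) / 2 * x ^+ 2) : R).
  by apply: measurableT_comp => //; apply: measurable_funM => //; exact: exprn_measurable.
have [i e] : itg N (fun x => s^-1 * expR ((1 - s ^- 2) / 2 * x ^+ 2)) /\
    Ex N (fun x => s^-1 * expR ((1 - s ^- 2) / 2 * x ^+ 2)) = 1.
  apply: (@itg_normal_ratio 0 s).
- exact: measurable_funM.
- by move=> x; rewrite mulr_ge0// ?invr_ge0 ?(ltW s0)// expR_ge0.
- move=> x; rewrite !normal_pdfE ?oner_neq0 ?gt_eqF// (normal_peakE s0) mulrACA.
  congr (_ * _); rewrite /normal_fun -expRD; congr expR.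
  by field; rewrite gt_eqF.
have := itgZ s i; under eq_fun do rewrite mulrA mulfV ?gt_eqF// mul1r.
move=> j; split => //.
by move: e; rewrite ExZ// => /(congr1 ( *%R s)); rewrite mulrA mulfV ?gt_eqF// mul1r mulr1.
Qed.

Lemma Ex_normal_exp (t : R) :
  itg N (fun x => expR (t * x)) /\ Ex N (fun x => expR (t * x)) = expR (t ^+ 2 / 2).
Proof.
have mf : measurable_fun setT (fun x : T => expR (t * x) : R).
  by apply: measurableT_comp => //; exact: measurable_funM.
have [i e] : itg N (fun x => expR (- (t ^+ 2 / 2)) * expR (t * x)) /\
    Ex N (fun x => expR (- (t ^+ 2 / 2)) * expR (t * x)) = 1.
  apply: (@itg_normal_ratio t 1).
- exact: measurable_funM.
- by move=> x; rewrite mulr_ge0// expR_ge0.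
- move=> x; rewrite !normal_pdfE ?oner_neq0// mulrCA.
  congr (_ * _); rewrite /normal_fun -!expRD; congr expR.
  by field.
have E0 : expR (t ^+ 2 / 2) * expR (- (t ^+ 2 / 2)) = 1 by rewrite -expRD subrr expR0.
have := itgZ (expR (t ^+ 2 / 2)) i; under eq_fun do rewrite mulrA E0 mul1r.
move=> j; split => //.
by move: e; rewrite ExZ// => /(congr1 ( *%R (expR (t ^+ 2 / 2)))); rewrite mulrA E0 mul1r mulr1.
Qed.

Lemma itg_normal_pow4 : itg N (fun x => `|x| ^+ 4).
Proof.
(* At [s = 2] the exponent is [2 * y] with [y = 3 / 16 * x^2]; then [y^2 <= expR (2 * y)] and
   [x^4 = (16 / 3)^2 * y^2]. *)
have [i _] := @Ex_normal_exp_sqr 2 ltac:(lra).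
apply: (itg_le (measurable_normpow 4) (itgZ (16 / 3 * (16 / 3)) i)) => x.
rewrite normrX normr_id (_ : (1 - 2 ^- 2) / 2 * x ^+ 2 = 3 / 16 * x ^+ 2 + 3 / 16 * x ^+ 2); last first.
  by field.
set y := 3 / 16 * x ^+ 2.
have y0 : 0 <= y by rewrite mulr_ge0 ?sqr_ge0//; lra.
have h : y <= expR y by rewrite (le_trans _ (expR_ge1Dx y))// lerDr.
rewrite expRD (_ : `|x| ^+ 4 = 16 / 3 * (16 / 3) * (y * y)); last first.
  rewrite (_ : `|x| ^+ 4 = (x ^+ 2) ^+ 2); first by rewrite /y; field.
  by rewrite -(real_normK (num_real x)) -exprM.
by apply: ler_wpM2l; [lra|exact: ler_pM].
Qed.

Lemma Ex_affine_le (m : prob) (a c : R) (f g : T -> R) : itg m f -> itg m g ->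
  (forall x, a + c * f x <= g x) -> a + c * Ex m f <= Ex m g.
Proof.
move=> i j fg; rewrite -{1}(Ex_cst m a) -(ExZ c i) -ExD; [|exact: itg_cst|exact: itgZ].
by apply: Ex_le => //; apply: itgD; [exact: itg_cst|exact: itgZ].
Qed.

(** From [1 + t * m <= Ex N (expR (t * x)) = expR (t^2 / 2)] for both signs of [t], the right side
    being [1 + O(t^2)], one gets [|m| <= t] for every [t] in []0, 1[]. *)
Lemma normal_mean : Ex N (fun x => x ^+ 1) = 0.
Proof.
have i := itg_pow (isT : (1 <= 4)%N) itg_normal_pow4.
set m := Ex N _.
have h t : `|t| < 1 -> t * m * (1 - t ^+ 2 / 2) <= t ^+ 2 / 2.
  move=> t1; have [it et] := Ex_normal_exp t.
  have t2 : t ^+ 2 < 1 by rewrite -(real_normK (num_real t)) expr_lt1.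
  have h1 : 1 + t * m <= expR (t ^+ 2 / 2).
    by rewrite -et; apply: Ex_affine_le => // x; rewrite expr1 expR_ge1Dx.
  have h2 := expR_ge1Dx (- (t ^+ 2 / 2)).
  have h3 : expR (t ^+ 2 / 2) * (1 - t ^+ 2 / 2) <= 1.
    have e : expR (t ^+ 2 / 2) * expR (- (t ^+ 2 / 2)) = 1 by rewrite -expRD subrr expR0.
    by rewrite -[leRHS]e ler_wpM2l ?expR_ge0.
  have h4 : (1 + t * m) * (1 - t ^+ 2 / 2) <= expR (t ^+ 2 / 2) * (1 - t ^+ 2 / 2).
    by rewrite ler_wpM2r//; lra.
  lra.
have k t : 0 < t -> t < 1 -> `|m| <= t.
  move=> t0 t1; have := h t; rewrite gtr0_norm// => /(_ t1) ha.
  have := h (- t); rewrite normrN gtr0_norm// sqrrN => /(_ t1) hb.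
  have t2 : t ^+ 2 < 1 by rewrite expr_lt1// ltW.
  have d0 : 1 / 2 <= 1 - t ^+ 2 / 2 by lra.
  rewrite ler_norml; apply/andP; split.
    have : - m * (1 - t ^+ 2 / 2) <= t / 2.
      by rewrite -(ler_pM2l t0) mulrA mulrN -mulNr (le_trans hb)// expr2 mulrA.
    nra.
  have : m * (1 - t ^+ 2 / 2) <= t / 2.
    by rewrite -(ler_pM2l t0) mulrA (le_trans ha)// expr2 mulrA.
  nra.
apply/eqP; rewrite -normr_le0; apply/ler_addgt0Pr => e e0; rewrite add0r.
have [e1|e1] := ltP e 1; first exact: k.
by apply: le_trans e1; apply: (@le_trans _ _ (1 / 2)); [apply: k; lra|lra].
Qed.

Lemma normal_sqr : Ex N (fun x => x ^+ 2) = 1.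
Proof.
have i := itg_pow (isT : (2 <= 4)%N) itg_normal_pow4.
set m := Ex N _.
(* This is [1 + (1 - s^-2) / 2 * m <= s], a consequence of [1 + x <= expR x], multiplied by
   [2 * s^2]. The factor [1 - s] changes sign at 1, so the two sides of 1 give opposite bounds on
   [m]. *)
have h s : 0 < s -> 0 <= (1 - s) * ((1 + s) * m - 2 * s ^+ 2).
  move=> s0; have [it et] := Ex_normal_exp_sqr s0.
  have h1 : 1 + (1 - s ^- 2) / 2 * m <= s.
    by rewrite -[leRHS]et; apply: Ex_affine_le => // x; rewrite expR_ge1Dx.
  have s2 : 0 < s ^+ 2 * 2 by rewrite mulr_gt0// exprn_gt0.
  rewrite -subr_ge0 -(pmulr_rge0 _ s2) in h1.
  by rewrite (_ : (1 - s) * _ = s ^+ 2 * 2 * (s - (1 + (1 - s ^- 2) / 2 * m)))//; field; rewrite gt_eqF.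
have ge1 : 1 <= m.
  apply/ler_addgt0Pr => e e0; have [e1|e1] := ltP e 1; last first.
    have : 0 <= m by apply: Ex_ge0 => x; exact: sqr_ge0.
    lra.
  have := h (1 - e / 4) ltac:(lra); rewrite pmulr_rge0; last lra.
  nra.
have le1 : m <= 1.
  apply/ler_addgt0Pr => e e0.
  wlog e1 : e e0 / e < 1.
    move=> H; have [|e1] := ltP e 1; first exact: H.
    by have := H (1 / 2) ltac:(lra) ltac:(lra); lra.
  have := h (1 + e / 4) ltac:(lra); rewrite nmulr_rge0; last lra.
  nra.
by apply/eqP; rewrite eq_le le1 ge1.
Qed.

End gauss.

(** * Expansion of the exponential and of shifted Gaussian densities *)

Section exp_taylor.
Context (R : realType).

Lemma mvt_bound (f df : R -> R) (B u : R) :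
  (forall v : R, is_derive (v : R) 1 f (df v)) -> f 0 = 0 ->
  (forall v, `|v| <= `|u| -> `|df v| <= B) -> `|f u| <= B * `|u|.
Proof.
move=> fd f0 dB.
have cf a c : {within `[a, c], continuous f}.
  apply: continuous_subspaceT => x; apply: differentiable_continuous.
  by apply/derivable1_diffP; have [] := fd x.
have [u0|u0|->] := ltgtP u 0; last by rewrite f0 !normr0 mulr0.
  have [c + e] := @MVT _ f df u 0 u0 (fun x _ => fd x) (cf _ _).
  rewrite in_itv/= => /andP[c1 c2].
  rewrite -normrN (_ : - f u = df c * (- u)); last by rewrite -[- u]add0r -e f0 sub0r.
  rewrite normrM normrN ler_wpM2r//; apply: dB.
  by rewrite !ltr0_norm// lerN2 ltW.
have [c + e] := @MVT _ f df 0 u u0 (fun x _ => fd x) (cf _ _).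
rewrite in_itv/= => /andP[c1 c2].
rewrite f0 !subr0 in e; rewrite e normrM ler_wpM2r//; apply: dB.
by rewrite !gtr0_norm// ltW.
Qed.

(** The mean value bound is applied three times, each remainder being the derivative of the next;
    the factor 1/6 is given up. *)
Lemma expR_taylor2 (u : R) : `|expR u - 1 - u - u ^+ 2 / 2| <= `|u| ^+ 3 * expR `|u|.
Proof.
have mono (v w : R) : `|v| <= `|w| -> expR v <= expR `|w|.
  by move=> h; rewrite ler_expR (le_trans (ler_norm v)).
have t0 (v : R) : `|expR v - 1| <= expR `|v| * `|v|.
  apply: (@mvt_bound (fun v => expR v - 1 : R) expR).
  - by move=> w; apply: is_derive_eq; rewrite subr0.
  - by rewrite expR0 subrr.
  - by move=> w h; rewrite ger0_norm ?expR_ge0// mono.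
have t1 (v : R) : `|expR v - 1 - v| <= expR `|v| * `|v| * `|v|.
  apply: (@mvt_bound (fun v => expR v - 1 - v) (fun v => expR v - 1)).
  - by move=> w; apply: is_derive_eq; rewrite subr0.
  - by rewrite expR0 !subrr.
  - by move=> w h; rewrite (le_trans (t0 w))// ler_pM// ?expR_ge0// ler_expR.
rewrite (_ : `|u| ^+ 3 * _ = expR `|u| * `|u| * `|u| * `|u|); last by ring.
apply: (@mvt_bound (fun v => expR v - 1 - v - v ^+ 2 / 2) (fun v => expR v - 1 - v)).
- move=> w; apply: is_derive_eq. rewrite subr0 /GRing.scale/=.
  by field.
- by rewrite expR0 !subrr expr0n mul0r subrr.
- move=> w h; rewrite (le_trans (t1 w))//; apply: ler_pM => //.
  by rewrite ler_pM// ?expR_ge0// ler_expR.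
Qed.
End exp_taylor.

Section cameron_martin.
Context (R : realType).
Local Notation T := (measurableTypeR R).
Local Notation N := (normal_prob (0 : R) 1 : probability T R).

(** The Cameron-Martin density: that of the standard normal law shifted by [w], with respect to the
    unshifted one. *)
Definition tilt (w : R) (y : T) : R := expR (w * y - w ^+ 2 / 2).

Let measurable_tilt w : measurable_fun setT (tilt w).
Proof.
by apply: measurableT_comp => //; apply: measurable_funB => //; exact: measurable_funM.
Qed.

Lemma Ex_tilt (w : R) : itg N (tilt w) /\ Ex N (tilt w) = 1.
Proof.
apply: (@itg_normal_ratio _ w 1) => //; first by move=> x; exact: expR_ge0.
move=> x; rewrite !normal_pdfE ?oner_neq0// mulrCA; congr (_ * _).
by rewrite /normal_fun -expRD; congr expR; field.
Qed.

Lemma itg_tiltM (w M : R) (g : T -> R) : measurable_fun setT g -> (forall x, `|g x| <= M) ->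
  itg N (fun y => g y * tilt w y).
Proof.
move=> mg gM; have [i _] := Ex_tilt w; apply: (itg_le _ (itgZ M i)).
  exact: measurable_funM.
by move=> x; rewrite normrM [X in _ * X]ger0_norm ?expR_ge0// ler_wpM2r ?expR_ge0.
Qed.

Lemma Ex_shift (g : T -> R) (M w : R) : measurable_fun setT g ->
  (forall x, `|g x| <= M) -> Ex N (fun y => g (y + w)) = Ex N (fun y => g y * tilt w y).
Proof.
move=> mg gM; have [iw ew] := Ex_tilt w.
have pos (h : T -> R) K : measurable_fun setT h -> (forall x, 0 <= h x) -> (forall x, `|h x| <= K) ->
    Ex N (fun y => h (y + w)) = Ex N (fun y => h y * tilt w y).
  move=> mh h0 hK.
  have i1 : itg N (fun y : T => h (1 * y + w)).
    by apply: itg_bounded => //; exact: measurableT_comp mh (measurable_affine _ _).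
  transitivity (Ex N (fun y => h (1 * y + w))).
    by congr Ex; apply/funext => y; rewrite mul1r.
  have := @Ex_law _ _ _ _ _ N _ (measurable_affine 1 w) h i1 mh => <-.
  rewrite (eqlaw_Ex h (normal_affine w ltr01)).
  suff ex : (\int[normal_prob w 1]_x (h x)%:E = \int[N]_x (h x * tilt w x)%:E)%E.
    exact: (congr1 fine ex).
  rewrite (integral_normal_prob _ _ mh h0).
  have mht : measurable_fun setT (fun x => h x * tilt w x) by exact: measurable_funM.
  have ht0 y : 0 <= h y * tilt w y by rewrite mulr_ge0// expR_ge0.
  rewrite (integral_normal_prob _ _ mht ht0); apply: eq_integral => y _; congr EFin.
  rewrite -[RHS]mulrA; congr (_ * _).
  rewrite !normal_pdfE ?oner_neq0// mulrCA; congr (_ * _).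
  by rewrite /normal_fun -expRD; congr expR; field.
have i2 : itg N (fun y : T => g (y + w)).
  by apply: itg_bounded => //; apply: measurableT_comp => //; exact: measurable_funD.
have := pos (fun y => g y + M) (M + M).
have c1 y : 0 <= g y + M by have := gM y; rewrite ler_norml => /andP[]; lra.
have c2 y : `|g y + M| <= M + M by rewrite ger0_norm//; have := gM y; rewrite ler_norml => /andP[]; lra.
move=> /(_ (measurable_funD mg (measurable_cst _)) c1 c2).
rewrite ExD//; last exact: itg_cst.
under [in X in _ = X -> _]eq_fun do rewrite mulrDl.
rewrite ExD; [|exact: itg_tiltM gM|exact: itgZ].
by rewrite Ex_cst ExZ// ew mulr1 => /addIr.
Qed.

(** Second-order Taylor remainder of [tilt w y] in [w]; the coefficients are the Hermite polynomials
    [y] and [(y^2 - 1) / 2]. *)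
Definition tilt_rem (w : R) (y : T) : R := tilt w y - 1 - w * y - w ^+ 2 * ((y ^+ 2 - 1) / 2).

Let i1 : itg N (fun x => x ^+ 1). Proof. exact: itg_pow (itg_normal_pow4 R). Qed.
Let i2 : itg N (fun x => x ^+ 2). Proof. exact: itg_pow (itg_normal_pow4 R). Qed.

Lemma itg_normal_id : itg N (fun x => x).
Proof. by move: i1; under eq_fun do rewrite expr1. Qed.

Lemma itg_normal_sqr1 : itg N (fun x => (x ^+ 2 - 1) / 2).
Proof.
under eq_fun do rewrite mulrC.
by apply: itgZ; apply: itgB => //; exact: itg_cst.
Qed.

Lemma itg_tilt_rem w : itg N (tilt_rem w).
Proof.
have [i _] := Ex_tilt w.
by apply: itgB; [apply: itgB; [apply: itgB => //; exact: itg_cst|apply: itgZ; exact: itg_normal_id]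
  |apply: itgZ; exact: itg_normal_sqr1].
Qed.

(** The exponential is expanded at [z = w * y - w^2 / 2]. Both the remainder in [z] and the terms of
    [z^2 / 2] beyond order two in [w] are at most [|w|^3] times a function of [y] with finite
    Gaussian expectation. *)
Lemma tilt_rem_small : exists2 C : R, 0 <= C & forall w, `|w| <= 1 ->
  Ex N (fun y => `|tilt_rem w y|) <= C * `|w| ^+ 3.
Proof.
(* With [Y = |y| + 1]: 27 comes from [Y^3 <= 27 * expR Y] and one more from [Y <= expR Y * expR Y];
   the other factors bound [expR (2 * Y) = expR 2 * expR (2 * |y|)]. *)
pose K (y : T) : R := 28 * expR 2 * (expR (2 * y) + expR (- 2 * y)).
have iK : itg N K.
  by apply: itgZ; apply: itgD; [case: (Ex_normal_exp (2 : R))|case: (Ex_normal_exp (-2 : R))].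
have K0 y : 0 <= K y by rewrite mulr_ge0// ?addr_ge0// ?mulr_ge0// ?expR_ge0.
exists (Ex N K); first exact: Ex_ge0.
move=> w w1.
have h y : `|tilt_rem w y| <= `|w| ^+ 3 * K y.
  set z := w * y - w ^+ 2 / 2; set Y := `|y| + 1; set v := `|w| in w1 *.
  have v0 : 0 <= v := normr_ge0 w.
  have wv : w ^+ 2 = v ^+ 2 by rewrite real_normK ?num_real.
  have Y1 : 1 <= Y by rewrite lerDr.
  have zv : `|z| <= v * Y.
    rewrite (le_trans (ler_normB _ _))// normrM -/v.
    have -> : `|w ^+ 2 / 2| = v ^+ 2 / 2 by rewrite ger0_norm ?divr_ge0 ?sqr_ge0// wv.
    by rewrite /Y mulrDr lerD2l; nra.
  have zY : `|z| <= Y by rewrite (le_trans zv)// ler_piMl// (le_trans _ Y1).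
  have -> : tilt_rem w y = (expR z - 1 - z - z ^+ 2 / 2) + (- w ^+ 3 * y / 2 + w ^+ 4 / 8).
    by rewrite /tilt_rem /tilt -/z [in RHS]/z; field.
  have t := expR_taylor2 z.
  have b1 : `|z| ^+ 3 * expR `|z| <= (v ^+ 3 * Y ^+ 3) * expR Y.
    by apply: ler_pM; rewrite ?exprn_ge0 ?expR_ge0 ?ler_expR// -exprMn lerXn2r// nnegrE// mulr_ge0// (le_trans _ Y1).
  have b2 : `|- w ^+ 3 * y / 2 + w ^+ 4 / 8| <= v ^+ 3 * Y.
    have n3 : `|- w ^+ 3 * y / 2| = v ^+ 3 * `|y| / 2.
      rewrite normrM [X in _ * X]ger0_norm ?invr_ge0//; congr (_ / _).
      by rewrite normrM normrN normrX.
    have n4 : `|w ^+ 4 / 8| = v ^+ 4 / 8.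
      by rewrite normrM [X in _ * X]ger0_norm ?invr_ge0// normrX.
    rewrite (le_trans (ler_normD _ _))// n3 n4.
    have v3 : 0 <= v ^+ 3 by rewrite exprn_ge0.
    have y0 : 0 <= `|y| by [].
    rewrite (_ : v ^+ 4 = v ^+ 3 * v); last by rewrite exprSr.
    have v1 : v <= 1 by exact: w1.
    have q1 : 0 <= v ^+ 3 * `|y| by exact: mulr_ge0.
    have q2 : v ^+ 3 * v <= v ^+ 3 by rewrite ler_piMr.
    by rewrite /Y mulrDr mulr1; lra.
  have e1 : Y <= expR Y by rewrite (le_trans _ (expR_ge1Dx Y))// lerDr.
  have e3 : Y ^+ 3 <= 27 * expR Y.
    have h3 : Y / 3 <= expR (Y / 3) by rewrite (le_trans _ (expR_ge1Dx _))// lerDr.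
    have -> : expR Y = expR (Y / 3) ^+ 3 by rewrite -expRM_natl; congr expR; field.
    rewrite -ler_pdivrMl// (_ : 27^-1 * Y ^+ 3 = (Y / 3) ^+ 3); last by field.
    by rewrite lerXn2r ?nnegrE ?expR_ge0//; lra.
  have E1 : 1 <= expR Y by rewrite -[leLHS]expR0 ler_expR; lra.
  have e2 : expR Y * expR Y <= expR 2 * (expR (2 * y) + expR (- 2 * y)).
    have -> : expR Y * expR Y = expR 2 * expR (2 * `|y|).
      by rewrite -!expRD; congr expR; rewrite /Y; ring.
    rewrite ler_wpM2l ?expR_ge0//.
    have [y0|y0] := leP 0 y.
      by rewrite ger0_norm// lerDl expR_ge0.
    by rewrite ltr0_norm// mulrN -mulNr lerDr expR_ge0.
  have v3 : 0 <= v ^+ 3 by rewrite exprn_ge0.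
  rewrite (le_trans (ler_normD _ _))//.
  apply: (@le_trans _ _ (v ^+ 3 * (Y ^+ 3 * expR Y + Y))).
    by rewrite mulrDr mulrA lerD// (le_trans t).
  rewrite ler_wpM2l// /K -mulrA; apply: le_trans (ler_wpM2l _ e2); last by lra.
  have : Y ^+ 3 * expR Y <= 27 * expR Y * expR Y by rewrite ler_wpM2r ?expR_ge0.
  have : Y <= expR Y * expR Y by rewrite (le_trans e1)// ler_peMr ?expR_ge0.
  lra.
rewrite mulrC -ExZ//; apply: Ex_le => //; first exact/itg_norm/itg_tilt_rem.
exact: itgZ.
Qed.

(** No cancellation is used: the four terms are bounded separately. The tilt has mean 1, so the
    total is at most [1 + 3 * w^2]. *)
Lemma tilt_rem_large (w : R) : 1 <= `|w| -> Ex N (fun y => `|tilt_rem w y|) <= 4 * w ^+ 2.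
Proof.
move=> w1; have [i e] := Ex_tilt w.
have v2 : 1 <= w ^+ 2 by rewrite -(real_normK (num_real w)) exprn_ege1.
have j := itgZ (w ^+ 2) (itgD (itg_cst N 2) i2).
apply: (@le_trans _ _ (Ex N (fun y => tilt w y + w ^+ 2 * (2 + y ^+ 2)))).
  apply: Ex_le; [exact/itg_norm/itg_tilt_rem|exact: itgD|move=> y].
  rewrite /tilt_rem (le_trans (ler_normB _ _))// (le_trans (lerD (ler_normB _ _) (lexx _)))//.
  rewrite (le_trans (lerD (lerD (ler_normB _ _) (lexx _)) (lexx _)))//.
  rewrite normr1 (ger0_norm (expR_ge0 _)) -!addrA lerD2l.
  have n1 : `|w ^+ 2 * ((y ^+ 2 - 1) / 2)| = w ^+ 2 * (`|y ^+ 2 - 1| / 2).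
    rewrite normrM (ger0_norm (sqr_ge0 w)) normrM; congr (_ * (_ * _)).
    by rewrite ger0_norm ?invr_ge0.
  rewrite n1 (normrM w y).
  have p1 : `|y ^+ 2 - 1| <= y ^+ 2 + 1.
    by rewrite (le_trans (ler_normB _ _))// normr1 ger0_norm ?sqr_ge0.
  have p2 := sqr_ge0 (`|w| - `|w| * `|y|).
  have p3 : `|w| ^+ 2 = w ^+ 2 by rewrite real_normK ?num_real.
  have p4 : `|y| ^+ 2 = y ^+ 2 by rewrite real_normK ?num_real.
  have p5 : `|w| * `|y| <= w ^+ 2 * ((1 + y ^+ 2) / 2).
    have q : `|w| <= w ^+ 2 by rewrite -p3 expr2 ler_peMr.
    have q2 : `|y| <= (1 + y ^+ 2) / 2 by have := sqr_ge0 (`|y| - 1); rewrite sqrrB1 p4; lra.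
    by apply: ler_pM.
  have p6 : w ^+ 2 * (`|y ^+ 2 - 1| / 2) <= w ^+ 2 * ((1 + y ^+ 2) / 2).
    by rewrite ler_wpM2l ?sqr_ge0//; lra.
  lra.
rewrite ExD// ExZ; last exact: itgD (itg_cst N 2) i2.
rewrite ExD//; last exact: itg_cst.
by rewrite Ex_cst normal_sqr e; lra.
Qed.

(** Pass to the L2 norm: [tilt w y ^ 2 = expR (w^2) * tilt (2 * w) y], so the expectation of the
    squared difference is [expR (w^2) - 1], at most [expR 1 * w^2]. *)
Lemma tilt_lipschitz (w : R) : `|w| <= 1 -> Ex N (fun y => `|tilt w y - 1|) <= expR 1 * `|w|.
Proof.
move=> w1; have [i e] := Ex_tilt w; have [i' e'] := Ex_tilt (2 * w).
have w2 : w ^+ 2 <= 1 by rewrite -(real_normK (num_real w)) expr_le1.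
have sq : (fun y : T => `|tilt w y - 1| ^+ 2) =
    (fun y => expR (w ^+ 2) * tilt (2 * w) y - 2 * tilt w y + 1).
  apply/funext => y; rewrite real_normK ?num_real//.
  have -> : expR (w ^+ 2) * tilt (2 * w) y = tilt w y ^+ 2.
    by rewrite [RHS]expr2 /tilt -!expRD; congr expR; field.
  by ring.
have ia : itg N (fun y => `|tilt w y - 1|) by apply/itg_norm/itgB => //; exact: itg_cst.
have ib := itgZ (expR (w ^+ 2)) i'; have ic := itgZ 2 i.
rewrite -(@ler_pXn2r _ 2) ?nnegrE ?Ex_ge0 ?mulr_ge0 ?expR_ge0//.
apply: le_trans (sqr_Ex_le ia _) _; rewrite sq.
  by apply: itgD; [exact: itgB|exact: itg_cst].
rewrite ExD; [|exact: itgB|exact: itg_cst].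
rewrite ExB// !ExZ// e e' Ex_cst exprMn real_normK ?num_real//.
have h1 : expR (w ^+ 2) <= expR 1 by rewrite ler_expR.
have h2 := expR_ge1Dx (- w ^+ 2).
have h3 : expR (w ^+ 2) * expR (- w ^+ 2) = 1 by rewrite -expRD subrr expR0.
have h4 : expR (w ^+ 2) * (1 - w ^+ 2) <= 1 by rewrite -[leRHS]h3 ler_wpM2l ?expR_ge0.
have h5 : expR (w ^+ 2) * w ^+ 2 <= expR 1 * w ^+ 2 by rewrite ler_wpM2r ?sqr_ge0.
have h6 : expR 1 * w ^+ 2 <= expR 1 ^+ 2 * w ^+ 2.
  by rewrite ler_wpM2r ?sqr_ge0// expr2 ler_peMr ?expR_ge0// -[leLHS]expR0 ler_expR.
lra.
Qed.

End cameron_martin.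

(** * Averaging operators and the central limit theorem *)

Section averages.
Context (R : realType).
Local Notation T := (measurableTypeR R).
Local Notation prob := (probability T R).
Local Notation N := (normal_prob (0 : R) 1 : prob).
Implicit Types (m : prob) (f g : T -> R).

(** The action of a law on bounded functions. It turns convolution into composition, such operators
    commute, and they do not increase uniform distances; laws of sums are therefore compared one
    summand at a time. *)
Definition avg m f : T -> R := fun x => Ex m (fun y => f (x + y)).

Definition bounded_meas (M : R) f := measurable_fun setT f /\ forall x, `|f x| <= M.

Lemma bounded_meas_shift M f x : bounded_meas M f -> bounded_meas M (fun y => f (x + y)).
Proof.
by move=> [mf fM]; split => //; apply: measurableT_comp => //; exact: measurable_funD.
Qed.

Lemma itg_shift m M f x : bounded_meas M f -> itg m (fun y => f (x + y)).
Proof. by move=> /(bounded_meas_shift x)[mf fM]; exact: itg_bounded mf fM. Qed.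

Let measurable_shift2 f : measurable_fun setT f ->
  measurable_fun setT (fun z : T * T => f (z.1 + z.2)).
Proof. by move=> mf; exact: (measurableT_comp mf (@measurable_add R)). Qed.

Lemma avg_bounded_meas m M f : bounded_meas M f -> bounded_meas M (avg m f).
Proof.
move=> bf; have [mf fM] := bf; split.
  exact: (measurable_Ex2 m m (measurable_shift2 mf) (M := M)).
by move=> x; have [mg gM] := bounded_meas_shift x bf; exact: Ex_bounded.
Qed.

Lemma iter_avg_bounded_meas m M f k : bounded_meas M f -> bounded_meas M (iter k (avg m) f).
Proof. by move=> bf; elim: k => //= k IH; exact: avg_bounded_meas. Qed.

Lemma avgC m m' M f : bounded_meas M f -> avg m (avg m' f) = avg m' (avg m f).
Proof.
move=> [mf fM]; apply/funext => x; rewrite /avg.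
have mz : measurable_fun setT (fun z : T * T => f (x + z.1 + z.2)).
  apply: measurableT_comp => //; apply: measurable_funD; last exact: measurable_snd.
  by apply: measurable_funD => //; exact: measurable_fst.
apply: etrans; first exact: (Ex_pprod_swap m m' mz (fun z => fM _)).
by congr Ex; apply/funext => y; congr Ex; apply/funext => z; rewrite addrAC.
Qed.

Lemma avg_dist m M f g c : bounded_meas M f -> bounded_meas M g ->
  (forall x, `|f x - g x| <= c) -> forall x, `|avg m f x - avg m g x| <= c.
Proof. by move=> bf bg h x; apply: Ex_dist; [exact: itg_shift bf|exact: itg_shift bg|]. Qed.

Lemma avg_convol m m' M f : bounded_meas M f -> avg (convol m m') f = avg m (avg m' f).
Proof.
move=> bf; have [mf fM] := bf; apply/funext => x; rewrite /avg.
have [mg gM] := bounded_meas_shift x bf.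
have mg2 := measurable_shift2 mg.
rewrite Ex_law//; last by apply: itg_bounded mg2 _ => z; exact: gM.
rewrite (@Ex_pprod _ _ _ _ _ _ _ _ M mg2) => [|z]; last exact: gM.
by congr Ex; apply/funext => y; congr Ex; apply/funext => z; rewrite addrA.
Qed.

Lemma iter_avgC m m' M f k : bounded_meas M f ->
  avg m (iter k (avg m') f) = iter k (avg m') (avg m f).
Proof.
move=> bf; elim: k => //= k <-.
by apply: (@avgC _ _ M); exact: iter_avg_bounded_meas.
Qed.

Lemma iter_avg_dist m M f g c k : bounded_meas M f -> bounded_meas M g ->
  (forall x, `|f x - g x| <= c) ->
  forall x, `|iter k (avg m) f x - iter k (avg m) g x| <= c.
Proof.
move=> bf bg h; elim: k => //= k IH.
by apply: (@avg_dist _ M) => //; exact: iter_avg_bounded_meas.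
Qed.

(** Lindeberg's exchange: the copies of [m] are replaced by copies of [m'] one by one, each exchange
    costing [c] since the remaining operators commute and contract. *)
Lemma avg_iter_dist m m' M f c k : bounded_meas M f ->
  (forall x, `|avg m f x - avg m' f x| <= c) ->
  forall x, `|iter k (avg m) f x - iter k (avg m') f x| <= k%:R * c.
Proof.
move=> bf h; elim: k => [|k IH] x /=; first by rewrite subrr normr0 mul0r.
have b1 := iter_avg_bounded_meas m k bf; have b2 := iter_avg_bounded_meas m' k bf.
rewrite (le_trans (ler_distD (avg m (iter k (avg m') f) x) _ _))//.
rewrite -natr1 mulrDl mul1r lerD//; first exact: (@avg_dist _ M).
rewrite (iter_avgC m m' k bf) (iter_avgC m' m' k bf).
by apply: (@iter_avg_dist _ M) => //; exact: avg_bounded_meas.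
Qed.

Lemma avg_convol_dist m1 m2 m1' m2' M f c1 c2 : bounded_meas M f ->
  (forall x, `|avg m1 f x - avg m1' f x| <= c1) ->
  (forall x, `|avg m2 f x - avg m2' f x| <= c2) ->
  forall x, `|avg (convol m1 m2) f x - avg (convol m1' m2') f x| <= c1 + c2.
Proof.
move=> bf h1 h2 x; rewrite !(avg_convol _ _ bf).
rewrite (le_trans (ler_distD (avg m1 (avg m2' f) x) _ _))// addrC lerD//; last first.
  by apply: (@avg_dist _ M) => //; exact: avg_bounded_meas.
rewrite !(avgC _ m2' bf).
by apply: (@avg_dist _ M) => //; exact: avg_bounded_meas.
Qed.

Lemma avg_scalec s m M f x : bounded_meas M f ->
  avg (scalec s m) f x = Ex m (fun y => f (x + s * y)).
Proof.
move=> bf; have [mg gM] := bounded_meas_shift x bf.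
rewrite /avg Ex_law//; apply: (@itg_bounded _ _ _ _ _ M) => [|y]; last exact: gM.
exact: (measurableT_comp mg (measurable_scale s)).
Qed.

Lemma avg_normal_mix (s t M : R) f : 0 <= s -> 0 <= t -> bounded_meas M f ->
  avg (convol (scalec s N) (scalec t N)) f = avg (scalec (Num.sqrt (s ^+ 2 + t ^+ 2)) N) f.
Proof.
move=> s0 t0 bf; have [mf fM] := bf; apply/funext => x.
rewrite (avg_convol _ _ bf) (avg_scalec _ _ _ (avg_bounded_meas _ bf)) (avg_scalec _ _ _ bf).
rewrite -(@Ex_normal_mix _ f M x s t s0 t0 mf fM).
by congr Ex; apply/funext => y; rewrite (avg_scalec _ _ _ bf).
Qed.

Lemma iter_avg_normal (s M : R) f k : 0 <= s -> bounded_meas M f ->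
  iter k (avg (scalec s N)) f = avg (scalec (Num.sqrt k%:R * s) N) f.
Proof.
move=> s0 bf; elim: k => [|k IH] /=.
  apply/funext => x; rewrite sqrtr0 mul0r (avg_scalec _ _ _ bf) -[LHS](Ex_cst N).
  by congr Ex; apply/funext => y; rewrite mul0r addr0.
have t0 : 0 <= Num.sqrt k%:R * s by rewrite mulr_ge0 ?sqrtr_ge0.
rewrite IH -(avg_convol (scalec s N) (scalec (Num.sqrt k%:R * s) N) bf).
rewrite (avg_normal_mix s0 t0 bf).
congr (avg (scalec _ N) f); rewrite exprMn sqr_sqrtr//.
rewrite (_ : s ^+ 2 + k%:R * s ^+ 2 = k.+1%:R * s ^+ 2); last by rewrite -natr1; ring.
by rewrite sqrtrM// sqrtr_sqr ger0_norm.
Qed.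

End averages.

(** * Powers between 2 and 3, and Gaussian smoothings *)

Section weight.
Context (R : realType) (theta : R).
Hypothesis theta01 : 0 < theta <= 1.

(** This is [|u|^(2 + theta)], factored so that the square stays polynomial. *)
Definition weight (u : R) : R := u ^+ 2 * `|u| `^ theta.

Lemma weight_ge0 u : 0 <= weight u.
Proof. by rewrite mulr_ge0 ?sqr_ge0 ?powR_ge0. Qed.

Lemma weightM u v : weight (u * v) = weight u * weight v.
Proof. by rewrite /weight exprMn normrM powRM// mulrACA. Qed.

Lemma sqr_le_weight u : 1 <= `|u| -> u ^+ 2 <= weight u.
Proof.
move=> u1; rewrite ler_peMr ?sqr_ge0// -(powRr0 `|u|) ler_powR//.
by case/andP: theta01 => /ltW.
Qed.

Lemma cube_le_weight u : `|u| <= 1 -> `|u| ^+ 3 <= weight u.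
Proof.
move=> u1; have [->|u0] := eqVneq u 0; first by rewrite normr0 expr0n weight_ge0.
rewrite /weight -(real_normK (num_real u)) exprSr ler_wpM2l ?exprn_ge0//.
by apply: ger1_powR; [rewrite normr_gt0 u0|case/andP: theta01].
Qed.

Lemma weight_le (p u : R) : theta + 2 <= p -> weight u <= 1 + `|u| `^ p.
Proof.
move=> tp; have /andP[/ltW t0 _] := theta01.
have [u1|/ltW u1] := leP `|u| 1.
  apply: (@le_trans _ _ 1); last by rewrite lerDl powR_ge0.
  rewrite /weight mulr_ile1 ?sqr_ge0 ?powR_ge0//.
    by rewrite -(real_normK (num_real u)) expr_le1.
  apply: (@le_trans _ _ (1 `^ theta)); last by rewrite powR1.
  by apply: ge0_ler_powR; rewrite ?nnegrE.
apply: (@le_trans _ _ (`|u| `^ p)); last by rewrite lerDr.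
have u0 : `|u| != 0 by rewrite gt_eqF// (lt_le_trans ltr01).
rewrite /weight -(real_normK (num_real u)) -powR_mulrn// -powRD; last by rewrite u0 implybT.
by apply: ler_powR => //; rewrite addrC.
Qed.

Lemma measurable_weight : measurable_fun setT (weight : measurableTypeR R -> R).
Proof.
apply: measurable_funM; first exact: exprn_measurable.
by apply: (measurableT_comp (measurable_powR _)); exact: normr_measurable.
Qed.

End weight.

Section smoothing.
Context (R : realType) (theta : R).
Hypothesis theta01 : 0 < theta <= 1.
Local Notation T := (measurableTypeR R).
Local Notation N := (normal_prob (0 : R) 1 : probability T R).
Local Notation wt := (weight theta).

(** The weight dominates [|w|^3] for [|w| <= 1], because [theta <= 1], and [w^2] for larger [w],
    because its extra exponent is nonnegative. One bound thus covers both regimes. *)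
Lemma tilt_rem_weight : exists2 C : R, 0 <= C & forall w, Ex N (fun y => `|tilt_rem w y|) <= C * wt w.
Proof.
have [C C0 hC] := tilt_rem_small R.
exists (C + 4) => [|w]; first lra.
have w0 := weight_ge0 theta w.
have [w1|w1] := leP `|w| 1.
  have h1 := hC w w1; have h2 : C * `|w| ^+ 3 <= C * wt w by rewrite ler_wpM2l// cube_le_weight.
  by lra.
have h1 := tilt_rem_large (ltW w1); have h2 := sqr_le_weight theta01 (ltW w1).
have h3 : 0 <= C * wt w by exact: mulr_ge0.
by lra.
Qed.

Variables (d M : R) (f : T -> R).
Hypotheses (d0 : 0 < d) (bf : bounded_meas M f).
Local Notation F := (avg (scalec d N) f).

Let M0 : 0 <= M. Proof. by have [_ fM] := bf; exact: le_trans (fM 0). Qed.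

Let bg x : bounded_meas M (fun y => f (x + d * y)).
Proof.
have [mg gM] := bounded_meas_shift x bf; split => [|y]; last exact: gM.
exact: (measurableT_comp mg (measurable_scale d)).
Qed.

Lemma smoothE x u : F (x + u) = Ex N (fun y => f (x + d * y) * tilt (u / d) y).
Proof.
have [mg gM] := bg x; rewrite -(Ex_shift (u / d) mg gM) (avg_scalec _ _ _ bf).
by congr Ex; apply/funext => y; congr f; field; rewrite gt_eqF.
Qed.

Lemma itg_boundedM x (g : T -> R) : itg N g -> itg N (fun y => f (x + d * y) * g y).
Proof.
move=> ig; have [mg gM] := bg x; apply: (itg_le _ (itgZ M (itg_norm ig))).
  by apply: measurable_funM => //; exact: itg_meas ig.
by move=> y; rewrite normrM ler_wpM2r.
Qed.

Lemma Ex_boundedM x (g : T -> R) : itg N g ->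
  `|Ex N (fun y => f (x + d * y) * g y)| <= M * Ex N (fun y => `|g y|).
Proof.
move=> ig; have i := itg_boundedM x ig; have [mg gM] := bg x.
rewrite (le_trans (Ex_norm_le i))// -ExZ; last exact: itg_norm.
apply: Ex_le; [exact: itg_norm|exact/itgZ/itg_norm|].
by move=> y; rewrite normrM ler_wpM2r.
Qed.

Lemma smooth_lipschitz : exists2 L : R, 0 <= L & forall x u, `|F (x + u) - F x| <= L * `|u|.
Proof.
have E0 : 0 <= expR 1 :> R by exact: expR_ge0.
exists ((2 + expR 1) * M / d) => [|x u]; first by rewrite divr_ge0 ?mulr_ge0 ?addr_ge0 ?(ltW d0).
rewrite -mulrA -[_^-1 * _]mulrC -[X in _ / X](gtr0_norm d0) -normrV ?unitfE ?gt_eqF// -normrM.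
set w := u / d; have wM : 0 <= `|w| * M by exact: mulr_ge0.
have [w1|/ltW w1] := leP `|w| 1; last first.
  have [_ FM] := avg_bounded_meas (scalec d N) bf.
  rewrite (le_trans (ler_normB _ _))// (le_trans (lerD (FM _) (FM _)))//.
  have : M <= `|w| * M by rewrite ler_peMl.
  have : 0 <= expR 1 * (`|w| * M) by exact: mulr_ge0.
  lra.
have [it _] := Ex_tilt w.
have i1 : itg N (fun y => tilt w y - 1) by apply: itgB => //; exact: itg_cst.
have -> : F (x + u) - F x = Ex N (fun y => f (x + d * y) * (tilt w y - 1)).
  rewrite smoothE (avg_scalec _ _ _ bf) -ExB; [|exact: itg_boundedM|].
    by congr Ex; apply/funext => y; rewrite mulrBr mulr1.
  by have [mg gM] := bg x; exact: itg_bounded mg gM.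
rewrite (le_trans (Ex_boundedM x i1))//.
have := ler_wpM2l M0 (tilt_lipschitz w1); lra.
Qed.

(** [g] and [h] stand for [F' x] and [F'' x / 2]: they are Gaussian integrals of [f] against the two
    Hermite polynomials, rescaled by powers of [d]. They depend on [x], but [C] does not. *)
Lemma smooth_taylor : exists2 C : R, 0 <= C & forall x, exists g h : R, forall u,
  `|F (x + u) - F x - g * u - h * u ^+ 2| <= C * wt u.
Proof.
have [C C0 hC] := tilt_rem_weight.
exists (M * (C * wt d^-1)) => [|x]; first by rewrite mulr_ge0// mulr_ge0// weight_ge0.
have i1 := itg_boundedM x (itg_normal_id R).
have i2 := itg_boundedM x (itg_normal_sqr1 R).
have [mg gM] := bg x; have i0 := itg_bounded N mg gM.
exists (d^-1 * Ex N (fun y => f (x + d * y) * y)).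
exists (d^-2 * Ex N (fun y => f (x + d * y) * ((y ^+ 2 - 1) / 2))) => u.
have [it _] := Ex_tilt (u / d); have it' := itg_boundedM x it.
set w := u / d in it it' *.
suff -> : F (x + u) - F x - d^-1 * Ex N (fun y => f (x + d * y) * y) * u -
    d^-2 * Ex N (fun y => f (x + d * y) * ((y ^+ 2 - 1) / 2)) * u ^+ 2 =
    Ex N (fun y => f (x + d * y) * tilt_rem w y).
  rewrite (le_trans (Ex_boundedM x (itg_tilt_rem w)))// -mulrA ler_wpM2l//.
  by rewrite (le_trans (hC w))// /w weightM -mulrA [wt u * _]mulrC.
rewrite smoothE (avg_scalec _ _ _ bf) -/w.
have -> : (fun y : T => f (x + d * y) * tilt_rem w y) =
    (fun y => f (x + d * y) * tilt w y - f (x + d * y) - w * (f (x + d * y) * y) -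
      w ^+ 2 * (f (x + d * y) * ((y ^+ 2 - 1) / 2))).
  by apply/funext => y; rewrite /tilt_rem; ring.
rewrite ExB; [|by apply: itgB; [exact: itgB|exact: itgZ]|exact: itgZ].
rewrite ExB; [|exact: itgB|exact: itgZ].
rewrite ExB// (ExZ _ i1) (ExZ _ i2) /w expr_div_n.
by field; rewrite gt_eqF.
Qed.

End smoothing.

(** * Comparison of standardised laws at a fixed scale *)

Section taylor.
Context (R : realType) (theta : R).
Hypothesis theta01 : 0 < theta <= 1.
Local Notation T := (measurableTypeR R).
Local Notation prob := (probability T R).
Local Notation N := (normal_prob (0 : R) 1 : prob).
Local Notation wt := (weight theta).

Definition standard (m : prob) :=
  [/\ itg m (fun x => `|x| ^+ 2), Ex m (fun x => x ^+ 1) = 0 & Ex m (fun x => x ^+ 2) = 1].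

Lemma standard_normal : standard N.
Proof.
by split; [exact: itg_pow_le (itg_normal_pow4 R)|exact: normal_mean|exact: normal_sqr].
Qed.

Lemma itg_weight_normal : itg N wt.
Proof.
have /andP[_ t1] := theta01.
apply: (itg_le (measurable_weight theta) (itgD (itg_cst N 1) (itg_normal_pow4 R))) => x.
rewrite ger0_norm ?weight_ge0// -powR_mulrn//; apply: weight_le => //; lra.
Qed.

Lemma taylor_avg (m : prob) (F : T -> R) (M C g h x a : R) :
  standard m -> itg m wt -> bounded_meas M F ->
  (forall u, `|F (x + u) - F x - g * u - h * u ^+ 2| <= C * wt u) ->
  `|avg (scalec a m) F x - F x - h * a ^+ 2| <= C * (wt a * Ex m wt).
Proof.
move=> [i2 e1 e2] iw bF tay; rewrite (avg_scalec _ _ _ bF).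
have j1 : itg m (fun x => x ^+ 1) by exact: itg_pow i2.
have j2 : itg m (fun x => x ^+ 2) by exact: itg_pow i2.
have iF : itg m (fun y => F (x + a * y)).
  have [mG GM] := bounded_meas_shift x bF; apply: (itg_bounded m (M := M)) => [|y]; last exact: GM.
  exact: (measurableT_comp mG (measurable_scale a)).
have -> : Ex m (fun y => F (x + a * y)) - F x - h * a ^+ 2 =
    Ex m (fun y => F (x + a * y) - F x - (g * a) * y ^+ 1 - (h * a ^+ 2) * y ^+ 2).
  rewrite ExB; [|by apply: itgB; [apply: itgB => //; exact: itg_cst|exact: itgZ]|exact: itgZ].
  rewrite ExB; [|by apply: itgB => //; exact: itg_cst|exact: itgZ].
  rewrite ExB//; last exact: itg_cst.
  by rewrite (ExZ _ j1) (ExZ _ j2) e1 e2 Ex_cst mulr0 mulr1 subr0.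
have j : itg m (fun y => F (x + a * y) - F x - g * a * y ^+ 1 - h * a ^+ 2 * y ^+ 2).
  by apply: itgB; [apply: itgB; [apply: itgB => //; exact: itg_cst|exact: itgZ]|exact: itgZ].
rewrite (le_trans (Ex_norm_le j))//.
rewrite mulrA -ExZ//; apply: Ex_le; [exact: itg_norm|exact: itgZ|move=> y].
by rewrite expr1 -mulrA -[h * _ * _]mulrA -exprMn -mulrA -weightM.
Qed.

(** Laws with mean 0 and variance 1 share the expansion [F x + h * a^2], so only the two remainders
    survive in the difference. *)
Lemma taylor_dist (m m' : prob) (F : T -> R) (M C K K' x a : R) :
  standard m -> itg m wt -> Ex m wt <= K ->
  standard m' -> itg m' wt -> Ex m' wt <= K' -> 0 <= C -> bounded_meas M F ->
  (exists g h, forall u, `|F (x + u) - F x - g * u - h * u ^+ 2| <= C * wt u) ->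
  `|avg (scalec a m) F x - avg (scalec a m') F x| <= C * (K + K') * wt a.
Proof.
move=> s1 i1 k1 s2 i2 k2 C0 bF [g [h tay]].
have h1 := taylor_avg a s1 i1 bF tay.
have h2 := taylor_avg a s2 i2 bF tay.
set u := avg _ _ _ in h1 *; set v := avg _ _ _ in h2 *.
have -> : u - v = (u - F x - h * a ^+ 2) - (v - F x - h * a ^+ 2) by ring.
rewrite (le_trans (ler_normB _ _))//.
rewrite mulrDr mulrDl -!mulrA lerD//.
  by rewrite (le_trans h1)// ler_wpM2l// mulrC ler_wpM2r// weight_ge0.
by rewrite (le_trans h2)// ler_wpM2l// mulrC ler_wpM2r// weight_ge0.
Qed.
End taylor.

Section recentre.
Context (R : realType).
Local Notation T := (measurableTypeR R).
Local Notation prob := (probability T R).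

(** Centring the sum amounts to centring each summand; this presents the law of a centred sum as the
    iteration of a single averaging operator. *)
Lemma iter_avg_affine (m : prob) (M c x : R) (f : T -> R) k : bounded_meas M f ->
  iter k (avg (law m (measurable_affine c (- c)))) f x =
  Ex (cpow m k) (fun z => f (x + (c * z - k%:R * c))).
Proof.
elim: k f x => [|k IH] f x bf.
  have [mg gM] := bounded_meas_shift x bf.
  rewrite /= Ex_dirac; first by rewrite mulr0 mul0r subr0 addr0.
  by apply: (measurableT_comp mg); apply: measurable_funB => //; exact: measurable_funM.
rewrite iterSr IH; last exact: avg_bounded_meas.
have mg a : measurable_fun setT (fun z : T => f (x + (c * z - a))).
  have [mg _] := bounded_meas_shift x bf.
  by apply: (measurableT_comp mg); apply: measurable_funB => //; exact: measurable_funM.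
have [mf fM] := bf.
have mg2 := measurableT_comp (mg (k.+1%:R * c)) (@measurable_add R).
rewrite /= [RHS]Ex_law//; last by apply: (itg_bounded _ (M := M)).
rewrite (Ex_pprod (cpow m k) m mg2 (M := M)); last by move=> z; exact: fM.
congr Ex; apply/funext => z; rewrite /avg Ex_law//.
- by congr Ex; apply/funext => v; congr f; rewrite /= -[k.+1%:R]natr1; ring.
- have [mh _] := bounded_meas_shift (x + (c * z - k%:R * c)) bf.
  apply: (itg_bounded _ (M := M)) => //.
  exact: (measurableT_comp mh (measurable_affine c (- c))).
- by have [mh _] := bounded_meas_shift (x + (c * z - k%:R * c)) bf.
Qed.

End recentre.

(** * The recursion for the standardised variables *)

Section standardized.
Context (R : realType) (b : nat) (hb : (3 <= b)%N).
Local Notation T := (measurableTypeR R).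
Local Notation prob := (probability T R).
Local Notation B := (b%:R : R).
Variables (mu : prob) (mu_good : good b mu).
Local Notation nu := (orbitT b mu).
Local Notation V := (fun n => var1 (nu n)).

Local Notation sd := (sd b mu).

Definition stdlaw n : prob := law (nu n) (measurable_affine (sd n)^-1 (- (sd n)^-1)).
Local Notation X := stdlaw.

Lemma sd_ratio n : sd n / sd n.+1 = Num.sqrt (B - 1 - V n).
Proof.
have s0 := sd_gt0 hb mu_good n.+1; rewrite -[RHS](mulfK (_ : sd n.+1 != 0)) ?gt_eqF//; congr (_ / _).
by rewrite -[RHS]mulrC -sqrtrM ?(orbit_varS hb mu_good)// ltW// orbit_var_gt0.
Qed.

Lemma sd_ratio_cvg : sd n / sd n.+1 @[n --> \oo] --> Num.sqrt (B - 1).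
Proof.
under eq_fun do rewrite sd_ratio.
have h : B - 1 - V n @[n --> \oo] --> B - 1 - 0.
  by apply: cvgB; [exact: cvg_cst|exact: (@orbit_var_cvg0 R b hb mu mu_good)].
by rewrite subr0 in h; apply: (cvg_comp _ _ h); exact: sqrt_continuous.
Qed.

Lemma itg_dev n : itg (nu n) (fun y => y - 1).
Proof.
have [_ i2 _ _] := orbit_good hb mu_good n.
by have := itg_sub1_pow (itg_pow_le (isT : (1 <= 2)%N) i2); under eq_fun do rewrite expr1.
Qed.

Lemma itg_dev_sqr n : itg (nu n) (fun y => (y - 1) ^+ 2).
Proof. by have [_ i2 _ _] := orbit_good hb mu_good n; exact: itg_sub1_pow. Qed.

Lemma Ex_dev n : Ex (nu n) (fun y => y - 1) = 0.
Proof.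
have [_ i2 e1 _] := orbit_good hb mu_good n.
have i1 : itg (nu n) (fun y => y ^+ 1) by exact: itg_pow i2.
rewrite (_ : (fun y => y - 1) = (fun y : T => y ^+ 1 - 1)); last first.
  by apply/funext => y; rewrite expr1.
by rewrite ExB//; [rewrite e1 Ex_cst subrr|exact: itg_cst].
Qed.

Lemma Ex_dev_norm_le n : Ex (nu n) (fun y => `|y - 1|) <= sd n.
Proof.
have i := itg_norm (itg_dev n); have i2 := itg_dev_sqr n.
have e : (fun y : T => `|y - 1| ^+ 2) = (fun y => (y - 1) ^+ 2).
  by apply/funext => y; rewrite real_normK ?num_real.
rewrite -(ler_pXn2r (ltn0Sn 1)) ?nnegrE ?Ex_ge0 ?(ltW (sd_gt0 hb mu_good n))// (sd_sqr hb mu_good).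
by have := sqr_Ex_le i; rewrite e; apply.
Qed.

Lemma standard_stdlaw n : standard (X n).
Proof.
have s0 := sd_gt0 hb mu_good n; have i := itg_dev n; have i2 := itg_dev_sqr n.
have e (y : T) k : ((sd n)^-1 * y + - (sd n)^-1) ^+ k = (sd n)^-1 ^+ k * (y - 1) ^+ k.
  by rewrite -exprMn mulrBr mulr1.
split.
- apply/itg_law; first exact: measurable_normpow.
  have := itgZ ((sd n)^-1 ^+ 2) i2; congr itg; apply/funext => y.
  by rewrite real_normK ?num_real// e.
- rewrite Ex_law; [|have := itgZ (sd n)^-1 i; congr itg|exact: measurable_pow].
  + under eq_fun do rewrite e !expr1.
    by rewrite ExZ// Ex_dev mulr0.
  + by apply/funext => y; rewrite e !expr1.
- rewrite Ex_law; [|have := itgZ ((sd n)^-1 ^+ 2) i2; congr itg|exact: measurable_pow].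
  + under eq_fun do rewrite e.
    by rewrite ExZ// -/(var1 _) -(sd_sqr hb mu_good n) -exprMn mulVf ?expr1n// gt_eqF.
  + by apply/funext => y; rewrite e.
Qed.

(** Law of [c * (W * Y - 1)] with [c = a / (B * sd n.+1)]: one of the [b] i.i.d. summands of [a]
    times the standardised variable of index [n.+1]. *)
Definition blocklaw n (a : R) : prob :=
  law (mulc (nu n) (nu n.+1)) (measurable_affine (a / (B * sd n.+1)) (- (a / (B * sd n.+1)))).

Let B0 : B != 0. Proof. by rewrite pnatr_eq0 -lt0n; case: b hb. Qed.

Lemma avg_stdlawS n a M (f : T -> R) : bounded_meas M f ->
  avg (scalec a (X n.+1)) f = iter b (avg (blocklaw n a)) f.
Proof.
move=> bf; apply/funext => x.
have [_ fx _ _] := good_transform hb (orbit_good hb mu_good n).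
have s0 := sd_gt0 hb mu_good n.+1.
have [mg gM] := bounded_meas_shift x bf.
have mh (c d : R) : measurable_fun setT (fun z : T => f (x + (c * z + d))).
  by apply: (measurableT_comp mg); exact: measurable_affine.
have ih (c d : R) (m : prob) : itg m (fun z : T => f (x + (c * z + d))).
  by apply: (itg_bounded _ (M := M)) => // y; exact: gM.
rewrite (iter_avg_affine _ _ _ _ bf) (avg_scalec _ _ _ bf).
have mk : measurable_fun setT (fun y : T => f (x + a * y)).
  by have := mh a 0; under eq_fun do rewrite addr0.
have e1 : (fun y : T => f (x + a * ((sd n.+1)^-1 * y + - (sd n.+1)^-1))) =
    (fun y => f (x + (a / sd n.+1 * y + - (a / sd n.+1)))).
  by apply/funext => y; congr f; ring.
rewrite Ex_law//; last by rewrite e1.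
rewrite e1 (eqlaw_Ex _ fx) Ex_law//; last first.
  have := ih (a / sd n.+1 * B^-1) (- (a / sd n.+1)) (cpow (mulc (nu n) (nu n.+1)) b).
  by congr itg; apply/funext => y; congr f; ring.
congr Ex; apply/funext => y; congr f.
by field; rewrite B0 gt_eqF.
Qed.

(* [c (W Y - 1) - c (W - 1) - c (Y - 1) = c (W - 1) (Y - 1)] is of smaller order. *)
Lemma avg_blocklaw_dist n (a s M L : R) (f : T -> R) x :
  0 <= a -> bounded_meas M f -> 0 <= L -> (forall x y, `|f x - f y| <= L * `|x - y|) ->
  `|avg (blocklaw n a) f x -
    avg (convol (scalec s (X n)) (scalec (a / B) (X n.+1))) f x| <=
  L * (a / B * sd n + `|a / B * (sd n / sd n.+1) - s|).
Proof.
move=> a0 bf L0 Lf.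
have s0 := sd_gt0 hb mu_good n; have s1 := sd_gt0 hb mu_good n.+1.
set t := a / B; set c := a / (B * sd n.+1).
have t0 : 0 <= t by rewrite divr_ge0.
have ce : c = t / sd n.+1 by rewrite /c invfM mulrA.
have [mg gM] := bounded_meas_shift x bf.
pose h1 (z : T * T) : T := c * (z.1 * z.2) + - c.
pose h2 (z : T * T) : T := s * ((sd n)^-1 * z.1 + - (sd n)^-1) +
  t * ((sd n.+1)^-1 * z.2 + - (sd n.+1)^-1).
have mh1 : measurable_fun setT h1.
  exact: (measurableT_comp (measurable_affine c (- c)) (@measurable_mul R)).
have mh2 : measurable_fun setT h2.
  apply: measurable_funD; apply: (measurableT_comp (measurable_scale _)).
    exact: (measurableT_comp (measurable_affine _ _) measurable_fst).
  exact: (measurableT_comp (measurable_affine _ _) measurable_snd).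
have ms1 := measurableT_comp mg mh1; have ms2 := measurableT_comp mg mh2.
have ib (k : T * T -> T) : measurable_fun setT (fun z => f (x + k z)) ->
    itg (pprod (nu n) (nu n.+1)) (fun z => f (x + k z)).
  by move=> mk; apply: (itg_bounded _ (M := M)) => // z; exact: gM.
have E1 : avg (blocklaw n a) f x = Ex (pprod (nu n) (nu n.+1)) (fun z => f (x + h1 z)).
  have ma := measurableT_comp mg (measurable_affine c (- c)).
  rewrite /avg Ex_law//; last by apply: (itg_bounded _ (M := M)) => // z; exact: gM.
  by rewrite Ex_law//; exact: ib.
have E2 : avg (convol (scalec s (X n)) (scalec t (X n.+1))) f x =
    Ex (pprod (nu n) (nu n.+1)) (fun z => f (x + h2 z)).
  rewrite (avg_convol _ _ bf) (avg_scalec _ _ _ (avg_bounded_meas _ bf)).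
  rewrite (Ex_pprod _ _ ms2 (M := M)) => [|z]; last exact: gM.
  have [mF FM] := bounded_meas_shift x (avg_bounded_meas (scalec t (X n.+1)) bf).
  rewrite Ex_law//; last 2 first.
  - apply: (itg_bounded _ (M := M)) => [|z]; last exact: FM.
    apply: (measurableT_comp mF).
    exact: (measurableT_comp (measurable_scale s) (measurable_affine _ _)).
  - exact: (measurableT_comp mF (measurable_scale s)).
  congr Ex; apply/funext => y; rewrite (avg_scalec _ _ _ bf).
  have [mk kM] := bounded_meas_shift (x + s * ((sd n)^-1 * y - (sd n)^-1)) bf.
  rewrite Ex_law//; last 2 first.
  - apply: (itg_bounded _ (M := M)) => [|z]; last exact: kM.
    apply: (measurableT_comp mk).
    exact: (measurableT_comp (measurable_scale t) (measurable_affine _ _)).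
  - exact: (measurableT_comp mk (measurable_scale t)).
  by congr Ex; apply/funext => z; rewrite /h2/= addrA.
rewrite E1 E2 -ExB; [|exact: ib|exact: ib].
pose r := `|t * (sd n / sd n.+1) - s| / sd n.
have r0 : 0 <= r by rewrite divr_ge0// ltW.
have j1 := itg_norm (itg_dev n); have j2 := itg_norm (itg_dev n.+1).
have c0 : 0 <= c by rewrite ce divr_ge0// ltW.
have k1 := itgZ c (itg_prodM j1 j2).
have k2 := itgZ r (itg_prod1 (nu n.+1) j1).
have D : Ex (pprod (nu n) (nu n.+1)) (fun z => L * (c * (`|z.1 - 1| * `|z.2 - 1|) + r * `|z.1 - 1|)) <=
    L * (t * sd n + `|t * (sd n / sd n.+1) - s|).
  rewrite ExZ; last exact: itgD.
  rewrite ler_wpM2l// (ExD k1 k2) (ExZ _ (itg_prodM j1 j2)) (ExZ _ (itg_prod1 (nu n.+1) j1)).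
  rewrite (Ex_prodM j1 j2) (Ex_prod1 (nu n.+1) j1).
  have n1 := Ex_dev_norm_le n; have n2 := Ex_dev_norm_le n.+1.
  apply: lerD.
    have -> : t * sd n = c * (sd n * sd n.+1) by rewrite ce; field; rewrite gt_eqF.
    by rewrite ler_wpM2l// ler_pM// Ex_ge0.
  by rewrite /r -[leLHS]mulrA ler_piMr// mulrC ler_pdivrMr// mul1r.
apply: le_trans D; rewrite (le_trans (Ex_norm_le _))//; first by apply: itgB; exact: ib.
apply: Ex_le; [by apply: itg_norm; apply: itgB; exact: ib|by apply: itgZ; exact: itgD|].
move=> z; rewrite (le_trans (Lf _ _))// ler_wpM2l//.
(* Taking [c = t / sd n.+1] makes the terms in [z.2 - 1] cancel exactly; what remains is the product
   term and the error in the coefficient of [z.1 - 1]. *)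
have -> : x + h1 z - (x + h2 z) =
    c * ((z.1 - 1) * (z.2 - 1)) + (t * (sd n / sd n.+1) - s) / sd n * (z.1 - 1).
  by rewrite /h1 /h2 ce; field; rewrite !gt_eqF.
rewrite (le_trans (ler_normD _ _))// lerD//.
  by rewrite normrM (ger0_norm c0) normrM.
by rewrite normrM normrM normfV (gtr0_norm s0).
Qed.

End standardized.

(** * Contraction towards the normal law for one smooth test function *)

Section contraction.
Context (R : realType) (b : nat) (hb : (3 <= b)%N) (theta : R).
Hypothesis theta01 : 0 < theta <= 1.
Local Notation T := (measurableTypeR R).
Local Notation prob := (probability T R).
Local Notation N := (normal_prob (0 : R) 1 : prob).
Local Notation B := (b%:R : R).
Local Notation wt := (weight theta).
Variables (mu : prob) (mu_good : good b mu) (K : R).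
Local Notation X := (stdlaw b mu).
Local Notation sd := (sd b mu).
Hypothesis X_wt : forall n, (0 < n)%N -> itg (X n) wt /\ Ex (X n) wt <= K.

Variables (F : T -> R) (M L C0 : R).
Hypotheses (bF : bounded_meas M F) (L0 : 0 <= L) (C00 : 0 <= C0).
Hypothesis F_lip : forall x y, `|F x - F y| <= L * `|x - y|.
Hypothesis F_taylor : forall x, exists g h, forall u,
  `|F (x + u) - F x - g * u - h * u ^+ 2| <= C0 * wt u.

(* The eventual bound has to be uniform in [x] only, not in the scale [a]. *)
Definition normal_dist_le (C : R) := forall a e : R, 0 <= a -> 0 < e ->
  exists n0 : nat, forall n x, (n0 <= n)%N ->
    `|avg (scalec a (X n)) F x - avg (scalec a N) F x| <= C * wt a + e.

Let B3 : 3 <= B. Proof. by rewrite ler_nat. Qed.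
(** Limit of [(sd n / sd n.+1) / B], the coefficient of the standardised weight in a block; the
    coefficient [B^-1] of the other factor is exact. *)
Let alpha : R := Num.sqrt (B - 1) / B.
Let kappa : R := B * (wt alpha + wt B^-1).

Let alpha_sqr : alpha ^+ 2 = (B - 1) / B ^+ 2.
Proof. by rewrite expr_div_n sqr_sqrtr//; have := B3; lra. Qed.

Let alpha_gt0 : 0 < alpha.
Proof. by rewrite divr_gt0 ?sqrtr_gt0; have := B3; lra. Qed.

Let powR_lt1 (x : R) : 0 < x -> x ^+ 2 < 1 -> x `^ theta < 1.
Proof.
move=> x0 x2; have x1 : x < 1 by rewrite -(expr_lt1 (n := 2)) ?ltW.
apply: (@lt_le_trans _ _ (1 `^ theta)); last by rewrite powR1.
by apply: gt0_ltr_powR; rewrite ?nnegrE ?(ltW x0)//; case/andP: theta01.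
Qed.

Lemma kappa_ge0 : 0 <= kappa.
Proof. by rewrite mulr_ge0// addr_ge0// weight_ge0. Qed.

(** [alpha] and [B^-1] lie in []0, 1[], so the extra exponent [theta > 0] brings each weight
    strictly below the corresponding square, and [B] times the sum of the squares is 1. *)
Lemma kappa_lt1 : kappa < 1.
Proof.
have b3 := B3; have Bp : 0 < B by lra.
have B2 : 0 < B ^+ 2 by rewrite exprn_gt0.
have a2 : alpha ^+ 2 < 1 by rewrite alpha_sqr ltr_pdivrMr// mul1r; nra.
have i2 : B^-1 ^+ 2 < 1 by rewrite exprVn invf_lt1//; nra.
have h1 : wt alpha < alpha ^+ 2.
  by rewrite /weight gtr0_norm// gtr_pMr ?exprn_gt0// powR_lt1.
have h2 : wt B^-1 < B^-1 ^+ 2.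
  by rewrite /weight gtr0_norm ?invr_gt0// gtr_pMr ?exprn_gt0 ?invr_gt0// powR_lt1 ?invr_gt0.
have : kappa < B * (alpha ^+ 2 + B^-1 ^+ 2) by rewrite ltr_pM2l// ltrD.
have -> : B * (alpha ^+ 2 + B^-1 ^+ 2) = 1 by rewrite alpha_sqr; field; rewrite gt_eqF.
by [].
Qed.

Lemma normal_dist_base : exists2 C, 0 <= C & normal_dist_le C.
Proof.
have [i1 e1] := X_wt (isT : (0 < 1)%N).
have K0 : 0 <= K by apply: le_trans e1; apply: Ex_ge0 => x; exact: weight_ge0.
have N0 : 0 <= Ex N wt by apply: Ex_ge0 => x; exact: weight_ge0.
exists (C0 * (K + Ex N wt)) => [|a e a0 e0]; first by rewrite mulr_ge0// addr_ge0.
exists 1 => n x n1; have [i k] := X_wt n1.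
rewrite (le_trans _ (_ : C0 * (K + Ex N wt) * wt a <= _)) ?lerDl ?(ltW e0)//.
apply: (taylor_dist a (standard_stdlaw hb mu_good n) i k (standard_normal R)
  (itg_weight_normal theta01) (lexx _) C00 bF).
exact: F_taylor.
Qed.

Lemma block_error_cvg0 a : 
  L * (a / B * sd n + `|a / B * (sd n / sd n.+1) - a * alpha|) @[n --> \oo] --> (0 : R).
Proof.
have h : L * (a / B * sd n + `|a / B * (sd n / sd n.+1) - a * alpha|) @[n --> \oo] -->
    L * (a / B * 0 + `|a / B * Num.sqrt (B - 1) - a * alpha|).
  apply: cvgM; first exact: cvg_cst.
  apply: cvgD; first by apply: cvgM; [exact: cvg_cst|exact: (sd_cvg0 hb mu_good)].
  apply: cvg_norm; apply: cvgB; last exact: cvg_cst.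
  by apply: cvgM; [exact: cvg_cst|exact: sd_ratio_cvg].
rewrite (_ : L * _ = 0) in h => //.
by rewrite /alpha (_ : a / B * _ - _ = 0) ?normr0 ?mulr0 ?addr0 ?mulr0//; ring.
Qed.

(** The hypothesis is used at scale [a * alpha] for index [n] and at scale [a / B] for index [n.+1],
    the very index under study. An induction on [n] would be circular; what improves is the
    constant, at the price of a later starting index. *)
Lemma normal_dist_step C : 0 <= C -> normal_dist_le C -> normal_dist_le (kappa * C).
Proof.
move=> C_ge0 DC a e a0 e0.
have b3 := B3; have Bp : 0 < B by lra.
(* Each of the [B] exchanged blocks carries three errors: one from linearising the product and two
   from the hypothesis. *)
have e1 : 0 < e / (3 * B) by rewrite divr_gt0// mulr_gt0.
have s0 : 0 <= a * alpha by rewrite mulr_ge0// ltW.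
have t0 : 0 <= a / B by rewrite divr_ge0// ltW.
have [n1 h1] := DC _ _ s0 e1; have [n2 h2] := DC _ _ t0 e1.
have [n3 _ h3] : \forall n \near \oo,
    L * (a / B * sd n + `|a / B * (sd n / sd n.+1) - a * alpha|) < e / (3 * B).
  exact: (cvgr_lt _ (block_error_cvg0 a)).
exists (n1 + n2 + n3).+1 => -[//|n] x; rewrite ltnS => hn.
have l1 : (n1 <= n)%N by apply: leq_trans hn; rewrite -addnA leq_addr.
have l2 : (n2 <= n.+1)%N by apply: (leq_trans _ (leqnSn n)); apply: leq_trans hn; rewrite addnAC leq_addl.
have l3 : (n3 <= n)%N by apply: leq_trans hn; rewrite leq_addl.
rewrite (avg_stdlawS hb mu_good n a bF).
(* The normal law satisfies the limiting recursion exactly, since [B * (alpha^2 + B^-2) = 1]. *)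
have -> : avg (scalec a N) F = iter b (avg (convol (scalec (a * alpha) N) (scalec (a / B) N))) F.
  set r := Num.sqrt ((a * alpha) ^+ 2 + (a / B) ^+ 2).
  have it k : iter k (avg (convol (scalec (a * alpha) N) (scalec (a / B) N))) F =
      iter k (avg (scalec r N)) F.
    by elim: k => //= k ->; exact: (avg_normal_mix s0 t0 (iter_avg_bounded_meas (scalec r N) k bF)).
  have r0 : 0 <= r by exact: sqrtr_ge0.
  rewrite it (iter_avg_normal b r0 bF) /r -sqrtrM ?ler0n//.
  rewrite (_ : B * _ = a ^+ 2) ?sqrtr_sqr ?ger0_norm//.
  by rewrite exprMn alpha_sqr; field; rewrite gt_eqF.
rewrite (le_trans (avg_iter_dist b bF (c := e / (3 * B) + ((C * wt (a * alpha) + e / (3 * B)) +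
  (C * wt (a / B) + e / (3 * B)))) _ x))//.
  move=> y; rewrite (le_trans (ler_distD (avg (convol (scalec (a * alpha) (X n))
    (scalec (a / B) (X n.+1))) F y) _ _))//.
  apply: lerD.
    rewrite (le_trans (avg_blocklaw_dist hb mu_good n (a * alpha) y a0 bF L0 F_lip))//.
    exact: ltW (h3 _ l3).
  by apply: (avg_convol_dist bF) => z; [exact: h1|exact: h2].
rewrite (weightM theta a alpha) (weightM theta a B^-1) /kappa.
by rewrite le_eqVlt; apply/orP; left; apply/eqP; field; rewrite gt_eqF.
Qed.

Lemma test_function_cvg e : 0 < e ->
  exists n0 : nat, forall n, (n0 <= n)%N -> `|Ex (X n) F - Ex N F| <= e.
Proof.
move=> e0; have [C C_ge0 DC] := normal_dist_base.
have DK k : normal_dist_le (kappa ^+ k * C) /\ 0 <= kappa ^+ k * C.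
  elim: k => [|k [IH IH0]]; first by rewrite expr0 mul1r.
  rewrite exprS -mulrA; split; first exact: normal_dist_step.
  by rewrite mulr_ge0// kappa_ge0.
have hk : kappa ^+ k * C @[k --> \oo] --> 0 * C.
  apply: cvgM; last exact: cvg_cst.
  by apply: cvg_expr; rewrite ger0_norm ?kappa_ge0 ?kappa_lt1.
rewrite mul0r in hk.
have e2 : 0 < e / 2 by lra.
(* The number [k] of improvements is fixed first, from [e] alone; the starting index [n0] is chosen
   afterwards. *)
have [k _ /(_ k (leqnn _)) hk'] : \forall k \near \oo, kappa ^+ k * C < e / 2 by exact: (cvgr_lt _ hk).
have [Dk _] := DK k; have [n0 h] := Dk 1 _ ler01 e2.
have av (m : prob) : avg (scalec 1 m) F 0 = Ex m F.
  by rewrite (avg_scalec _ _ _ bF); congr Ex; apply/funext => y; rewrite add0r mul1r.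
exists n0 => n hn; have := h n 0 hn; rewrite !av.
have -> : wt 1 = 1 by rewrite /weight expr1n mul1r normr1 powR1.
by lra.
Qed.

End contraction.

(** * From smoothed test functions to continuous ones *)

Section weak_limit.
Context (R : realType).
Local Notation T := (measurableTypeR R).
Local Notation prob := (probability T R).
Local Notation N := (normal_prob (0 : R) 1 : prob).

(** Compactness in its near-covering form, with the increments [v] tending to 0 as the filter; [x]
    stays in the segment, but [x + v] may leave it. *)
Lemma continuous_uniform_segment (f : R -> R) (K e : R) : continuous f -> 0 < e ->
  exists2 h, 0 < h & forall x v, `|x| <= K -> `|v| <= h -> `|f (x + v) - f x| <= e.
Proof.
move=> cf e0; have e2 : 0 < e / 2 by rewrite divr_gt0.
have cK : compact `[- K, K]%classic by exact: segment_compact.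
have := (compact_near_coveringP _).1 cK R (nbhs (0 : R))
  (fun v x => `|f (x + v) - f x| <= e) _.
case=> [x _|h h0 hP].
  have c1 : \forall z \near (x, 0 : R), `|f x - f z.1| < e / 2.
    have : f z.1 @[z --> (x, 0 : R)] --> f x.
      by apply: cvg_comp; [exact: cvg_fst|exact: cf].
    by move/cvgrPdist_lt; apply.
  have c2 : \forall z \near (x, 0 : R), `|f x - f (z.1 + z.2)| < e / 2.
    have : f (z.1 + z.2) @[z --> (x, 0 : R)] --> f x.
      have h : z.1 + z.2 @[z --> (x, 0 : R)] --> x + 0.
        by apply: cvgD; [exact: cvg_fst|exact: cvg_snd].
      by rewrite addr0 in h; apply: cvg_comp h _; exact: cf.
    by move/cvgrPdist_lt; apply.
  apply: filterS2 c1 c2 => -[x' v] /= c1 c2.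
  rewrite (_ : f (x' + v) - f x' = (f x - f x') - (f x - f (x' + v))); last by ring.
  by rewrite (le_trans (ler_normB _ _))//; lra.
exists (h / 2) => [|x v xK vh]; first by rewrite divr_gt0.
apply: (hP v); rewrite /= ?in_itv/= -?ler_norml// /ball_/= sub0r normrN.
by rewrite (le_lt_trans vh)// ltr_pdivrMr// ltr_pMr// ltr1n.
Qed.

(** A continuous bounded [f] need not be uniformly continuous, so the approximation is uniform only
    on segments. The slack [e * x^2] absorbs the rest and is harmless for laws with second moment
    1. *)
Lemma smooth_approx (f : T -> R) (M e : R) : continuous (f : R -> R) -> bounded_meas M f -> 0 < e ->
  exists2 d : R, 0 < d & forall x, `|avg (scalec d N) f x - f x| <= e + e * x ^+ 2.
Proof.
move=> cf bf e0; have [mf fM] := bf.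
have M0 : 0 <= M by exact: le_trans (fM 0).
have e2 : 0 < e / 2 by rewrite divr_gt0.
(* Beyond [K] the trivial bound [2 * M] is at most [e * x^2]. *)
pose K := Num.sqrt (2 * M / e).
have K2 : K ^+ 2 = 2 * M / e by rewrite sqr_sqrtr// divr_ge0 ?mulr_ge0// ltW.
have [h h0 hf] := continuous_uniform_segment K cf e2.
(* The second entry makes the Chebyshev term [2 * M * d^2 / h^2] at most [e / 2], using [d^2 <= d]
   from the first; the [+ 1] keeps the denominator positive when [M = 0]. *)
pose d := Num.min 1 (h ^+ 2 * e / (4 * M + 1)).
have M1 : 0 < 4 * M + 1 by lra.
have d0 : 0 < d by rewrite lt_min ltr01/= divr_gt0// mulr_gt0// exprn_gt0.
have dM : 2 * M * d ^+ 2 / h ^+ 2 <= e / 2.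
  have d1 : d <= 1 by rewrite ge_min lexx.
  have d2 : d <= h ^+ 2 * e / (4 * M + 1) by rewrite ge_min lexx orbT.
  have h2 : 0 < h ^+ 2 by rewrite exprn_gt0.
  rewrite ler_pdivrMr//; rewrite ler_pdivlMr// in d2.
  have : d ^+ 2 <= d by rewrite expr2 ler_piMl// ltW.
  have : M * d ^+ 2 <= M * d by rewrite ler_wpM2l// expr2 ler_piMl// ltW.
  have := ltW d0; nra.
exists d => // x.
have [mg gM] := bounded_meas_shift x bf.
have mgs : measurable_fun setT (fun y : T => f (x + d * y)).
  exact: (measurableT_comp mg (measurable_scale d)).
have i : itg N (fun y => f (x + d * y)) by apply: (itg_bounded N (M := M)) => // y; exact: gM.
have osc y : `|f (x + d * y) - f x| <= 2 * M.
  by rewrite (le_trans (ler_normB _ _))// mulr2n mulrDl !mul1r lerD.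
have ef : Ex N (fun y => f (x + d * y) - f x) = avg (scalec d N) f x - f x.
  by rewrite (avg_scalec _ _ _ bf) ExB//; [rewrite Ex_cst|exact: itg_cst].
have i' : itg N (fun y => f (x + d * y) - f x) by apply: itgB => //; exact: itg_cst.
rewrite -ef (le_trans (Ex_norm_le i'))//.
have [xK|xK] := leP `|x| K.
  have i2 : itg N (fun y => y ^+ 2) by apply: itg_pow (itg_normal_pow4 R).
  have h2 : 0 < h ^+ 2 by rewrite exprn_gt0.
  apply: (@le_trans _ _ (Ex N (fun y => e / 2 + (2 * M * d ^+ 2 / h ^+ 2) * y ^+ 2))).
    apply: Ex_le; [exact: itg_norm|by apply: itgD; [exact: itg_cst|exact: itgZ]|move=> y].
    have c0 : 0 <= 2 * M * d ^+ 2 / h ^+ 2 * y ^+ 2.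
      by rewrite mulr_ge0 ?sqr_ge0// divr_ge0 ?sqr_ge0// mulr_ge0 ?sqr_ge0// mulr_ge0.
    have [dy|dy] := leP `|d * y| h; first by have := hf x _ xK dy; lra.
    have : 2 * M <= 2 * M * d ^+ 2 / h ^+ 2 * y ^+ 2.
      rewrite (_ : 2 * M * d ^+ 2 / h ^+ 2 * y ^+ 2 = 2 * M * ((d * y) ^+ 2 / h ^+ 2)); last first.
        by field; rewrite gt_eqF.
      rewrite ler_peMr ?mulr_ge0// ler_pdivlMr// mul1r.
      by rewrite -(real_normK (num_real (d * y))) lerXn2r ?nnegrE ?(ltW h0)// ltW.
    by have := osc y; lra.
  rewrite ExD; [|exact: itg_cst|exact: itgZ].
  rewrite (ExZ _ i2) normal_sqr mulr1 Ex_cst.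
  have : 0 <= e * x ^+ 2 by rewrite mulr_ge0 ?sqr_ge0// ltW.
  lra.
apply: (@le_trans _ _ (2 * M)).
  rewrite -[leRHS](Ex_cst N); apply: Ex_le => //; [exact: itg_norm|exact: itg_cst].
have : K ^+ 2 <= x ^+ 2.
  rewrite -(real_normK (num_real x)) lerXn2r ?nnegrE ?sqrtr_ge0//; exact: ltW.
rewrite K2 ler_pdivrMr// => h2.
lra.
Qed.

Lemma standard_smooth_dist (m : prob) (f : T -> R) (M d e : R) : standard m -> bounded_meas M f ->
  (forall x, `|avg (scalec d N) f x - f x| <= e + e * x ^+ 2) ->
  `|Ex m (avg (scalec d N) f) - Ex m f| <= 2 * e.
Proof.
move=> [i2 _ e2] bf h; have [mf fM] := bf; have [mF FM] := avg_bounded_meas (scalec d N) bf.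
have j2 : itg m (fun x => x ^+ 2) by exact: itg_pow i2.
have i1 := itg_bounded m mf fM; have iF := itg_bounded m mF FM.
rewrite -ExB// (le_trans (Ex_norm_le (itgB iF i1)))//.
apply: (@le_trans _ _ (Ex m (fun x => e + e * x ^+ 2))).
  apply: Ex_le => //; first exact/itg_norm/itgB.
  by apply: itgD; [exact: itg_cst|exact: itgZ].
rewrite ExD; [|exact: itg_cst|exact: itgZ].
by rewrite (ExZ _ j2) e2 Ex_cst; lra.
Qed.

End weak_limit.

(** * Convergence in distribution *)

Section clt.
Context (R : realType) (b : nat) (hb : (3 <= b)%N).
Local Notation T := (measurableTypeR R).
Local Notation prob := (probability T R).
Local Notation N := (normal_prob (0 : R) 1 : prob).
Variables (mu : prob) (mu_good : good b mu).
Local Notation nu := (orbitT b mu).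
Local Notation X := (stdlaw b mu).

Variable p : R.
Hypothesis p2 : 2 < p.
Hypothesis std_bounded :
  (ereal_sup [set std_abs_moment p (nu n) | n in [set n | (1 <= n)%N]] < +oo)%E.
(** [theta + 2 <= p] lets the moment hypothesis bound the weighted moments, and the cap at 1 is what
    [cube_le_weight] requires. *)
Let theta : R := Num.min (p - 2) 1.

Let theta01 : 0 < theta <= 1.
Proof. by rewrite lt_min ltr01 andbT ge_min lexx orbT andbT; have := p2; lra. Qed.

Lemma stdlaw_weight_bounded : exists K, forall n, (0 < n)%N ->
  itg (X n) (weight theta) /\ Ex (X n) (weight theta) <= K.
Proof.
have := std_bounded; set S := ereal_sup _ => Sy.
have Sn n : (0 < n)%N -> (std_abs_moment p (nu n) <= S)%E.
  by move=> n0; apply: ereal_sup_ubound; exists n.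
have S0 : (0 <= S)%E.
  apply: le_trans (Sn 1 isT); apply: integral_ge0 => x _.
  by rewrite lee_fin powR_ge0.
have Sfin : S \is a fin_num by rewrite ge0_fin_numE.
exists (1 + fine S) => n n0.
have s0 := sd_gt0 hb mu_good n.
have mp : measurable_fun setT (fun y : T => `|y| `^ p : R).
  by apply: (measurableT_comp (measurable_powR _)); exact: normr_measurable.
have e : (\int[X n]_x (`|x| `^ p)%:E = std_abs_moment p (nu n))%E.
  have mE : measurable_fun setT (fun y : T => (`|y| `^ p)%:E) by exact/measurable_EFinP.
  have p0 (y : T) : (0 <= (`|y| `^ p)%:E)%E by rewrite lee_fin powR_ge0.
  rewrite (ge0_integral_law _ _ mE p0).
  apply: eq_integral => x _; congr (_ `^ _)%:E.
  rewrite sigma_var1 -/(sd b mu n) (_ : _ + _ = (x - 1) / sd b mu n); last by ring.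
  by rewrite normrM normfV (gtr0_norm s0).
have ip : itg (X n) (fun y => `|y| `^ p).
  apply: itg_ge0P => //.
  by rewrite e (le_lt_trans (Sn n n0))// ltey_eq Sfin.
have ep : Ex (X n) (fun y => `|y| `^ p) <= fine S.
  by rewrite -lee_fin EFin_Ex// e fineK//; exact: Sn.
have le x : weight theta x <= 1 + `|x| `^ p.
  by apply: weight_le => //; rewrite -lerBrDr ge_min lexx.
have iw : itg (X n) (weight theta).
  apply: (itg_le (measurable_weight theta) (itgD (itg_cst _ 1) ip)) => x.
  by rewrite ger0_norm ?weight_ge0.
split => //; apply: (@le_trans _ _ (Ex (X n) (fun y => 1 + `|y| `^ p))).
  by apply: Ex_le => //; apply: itgD => //; exact: itg_cst.
by rewrite ExD//; [rewrite Ex_cst lerD2l|exact: itg_cst].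
Qed.

Lemma stdlaw_Ex_cvg (f : T -> R) : continuous (f : R -> R) -> bounded_fun f ->
  Ex (X n) f @[n --> \oo] --> Ex N f.
Proof.
move=> cf /bounded_fun_gt0[M M0 fM]; apply/cvgrPdist_le => e e0.
have mf : measurable_fun setT (f : T -> R) by exact: continuous_measurable_fun.
have bf : bounded_meas M f by [].
(* Smoothing [f] costs [2 * e / 5] under each of the two laws, and the smoothed expectations differ
   by at most [e / 5]. *)
have e5 : 0 < e / 5 by rewrite divr_gt0.
have [K XK] := stdlaw_weight_bounded.
have [d d0 df] := smooth_approx cf bf e5.
have [L L0 hL] := smooth_lipschitz d0 bf.
have [C C0 hC] := smooth_taylor theta01 d0 bf.
have bF := avg_bounded_meas (scalec d N) bf.
have lip x y : `|avg (scalec d N) f x - avg (scalec d N) f y| <= L * `|x - y|.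
  by have := hL y (x - y); rewrite [y + _]addrC subrK.
have [n0 h] := test_function_cvg hb theta01 mu_good XK bF L0 C0 lip hC e5.
exists n0 => // n /= /h hn.
have hX := standard_smooth_dist (standard_stdlaw hb mu_good n) bf df.
have hN := standard_smooth_dist (standard_normal R) bf df.
move: hX hN hn; set A := Ex _ (avg _ f); set A' := Ex _ f; set D := Ex _ (avg _ f); set D' := Ex _ f.
by rewrite !ler_norml => /andP[? ?] /andP[? ?] /andP[? ?]; apply/andP; split; lra.
Qed.

Lemma stdlaw_cvg_in_distribution (d : nat -> measure_display)
    (Omega : forall n, measurableType (d n)) (P : forall n, probability (Omega n) R)
    (W : forall n, {RV (P n) >-> R}) :
  (forall n, (1 <= n)%N -> has_law (W n) (nu n)) ->
  cvg_in_distribution P (fun n omega => (W n omega - 1) / sigma (nu n)) N.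
Proof.
move=> W_law f cf bf; have [M M0 fM] := bounded_fun_gt0 bf.
have mf : measurable_fun setT (f : T -> R) by exact: continuous_measurable_fun.
have iN : itg N f by exact: (itg_bounded _ mf fM).
rewrite -(EFin_Ex iN).
suff h : \forall n \near \oo,
    ('E_(P n)[f \o (fun omega => ((W n omega - 1) / sigma (nu n))%R)] = (Ex (X n) f)%:E)%E.
  apply: cvg_trans; first by apply: near_eq_cvg; apply: filterS h => n ->; reflexivity.
  apply: cvg_EFin; first exact: nearW.
  exact: stdlaw_Ex_cvg.
(* No law is prescribed for [W 0], so the identity is claimed from index 1 on. *)
exists 1 => // n /= n1.
have s0 := sd_gt0 hb mu_good n.
have mg : measurable_fun setT (fun y : T => f ((sd b mu n)^-1 * y + - (sd b mu n)^-1)).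
  exact: (measurableT_comp mf (measurable_affine _ _)).
have mW : measurable_fun setT (W n : Omega n -> T) by exact: (measurable_funPT (W n)).
have eW : eqlaw (law (P n) mW) (nu n) by move=> A mA; exact: W_law.
have iW : itg (P n) (fun om => f ((sd b mu n)^-1 * W n om + - (sd b mu n)^-1)).
  apply: (itg_bounded _ (M := M)) => [|om]; last exact: fM.
  exact: (measurableT_comp mg mW).
rewrite Ex_law//; last by apply: (itg_bounded _ (M := M)) => // y; exact: fM.
rewrite -(eqlaw_Ex _ eW) Ex_law// EFin_Ex// unlock.
apply: eq_integral => om _; congr (f _)%:E.
by rewrite sigma_var1 /sd; ring.
Qed.

End clt.

Theorem theorem1 (R : realType) (b : nat) (hb : (3 <= b)%N)
    (mu : probability (measurableTypeR R) R) (hmu : Pb b mu) :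
  let Tmu (n : nat) := iter n (@transform R b) mu in
  [/\ (exists2 l : R, 0 < l &
         (b%:R - 1) `^ (n%:R / 2) * sigma (Tmu n) @[n --> \oo] --> l) /\
      weak_cvg Tmu (dirac (1 : measurableTypeR R)),
      Db b mu ->
        (ereal_sup [set std_abs_moment 3 (Tmu n) | n in [set n | (1 <= n)%N]]
           < +oo)%E &
      (exists2 p : R, 2 < p &
        (ereal_sup [set std_abs_moment p (Tmu n) | n in [set n | (1 <= n)%N]]
           < +oo)%E) ->
      forall (d : nat -> measure_display)
        (Omega : forall n, measurableType (d n))
        (P : forall n, probability (Omega n) R)
        (W : forall n, {RV (P n) >-> R}),
        (forall n, (1 <= n)%N -> has_law (W n) (Tmu n)) ->
        cvg_in_distribution P
          (fun n omega => (W n omega - 1) / sigma (Tmu n))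
          (normal_prob (0 : R) 1)].
Proof.
have mu_good := good_Pb hmu.
split.
- split; last exact: (orbit_weak_cvg hb mu_good).
  exists (Num.sqrt (var_lim b mu)); last exact: (sigma_cvg hb mu_good).
  by rewrite sqrtr_gt0 var_lim_gt0.
- by move=> mu_D; exact: (std_third_bounded hb mu_D).
- move=> [p p2 hp] d Omega P W W_law.
  exact: (stdlaw_cvg_in_distribution hb mu_good p2 hp W_law).
Qed.
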